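(* Suppose $\mathcal I$ is not a building. Let $d$ be a distance on $\mathcal I$ inducing the affine topology on each apartment. Then the interior (in $(\mathcal I,d)$) of each apartment of $\mathcal I$ is empty.
   Context: **Vectorial data.** $I$ is a finite set and $C=(c_{i,j})_{i,j\in I}$ is a Kac--Moody matrix: $c_{i,j}\in\mathbb Z$, $c_{i,i}=2$, $c_{i,j}\le 0$ for $i\neq j$, and $c_{i,j}=0\iff c_{j,i}=0$. $X,Y$ are dual free $\mathbb Z$-modules of finite rank with $\mathbb Z$-linearly independent families $(\alpha_i)_{i\in I}$ in $X$ and $(\alpha_i^\vee)_{i\in I}$ in $Y$ such that $\alpha_j(\alpha_i^\vee)=c_{i,j}$. $\mathbb A=Y\otimes\mathbb R$, with its usual topology; elements of $X$ are linear forms on $\mathbb A$. $r_i(v)=v-\alpha_i(v)\alpha_i^\vee$, and $W^v=\langle r_i\mid i\in I\rangle\subset \mathrm{GL}(\mathbb A)$ (Weyl group), acting on $\mathbb A^*$ by $(w.\alpha)(x)=\alpha(w^{-1}x)$. $\Phi=\{w.\alpha_i\}$ is the set of real roots; for $\alpha=w.\alpha_i\in\Phi$, $\alpha^\vee=w.\alpha_i^\vee$. $Q^\vee=\bigoplus_i\mathbb Z\alpha_i^\vee$ and $W^a=Q^\vee\rtimes W^v$. $\Delta\subset\bigoplus_i\mathbb Z\alpha_i\subset\mathbb A^*$ is the set of all (real and imaginary) roots of the Kac--Moody algebra of $C$. For $\alpha\in\mathbb A^*$, $k\in\mathbb R$: $D(\alpha,k)=\{\alpha(x)+k\ge0\}$,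 $D^\circ(\alpha,k)=\{\alpha(x)+k>0\}$, $M(\alpha,k)=\{\alpha(x)+k=0\}$, and $D(\alpha,+\infty)=D^\circ(\alpha,+\infty)=\mathbb A$. Walls (resp. half-apartments) are the $M(\alpha,k)$ (resp. $D(\alpha,k)$), $\alpha\in\Phi$, $k\in\mathbb Z$. $C^v_f=\{v\mid\alpha_i(v)>0\ \forall i\}$; for $J\subset I$, $F^v(J)=\{v\mid \alpha_i(v)=0\ (i\in J),\ \alpha_i(v)>0\ (i\notin J)\}$. Positive (resp. negative) vectorial faces are the $w.F^v(J)$ (resp. $-w.F^v(J)$), $w\in W^v$; vectorial chambers are the $\pm w.C^v_f$. Tits cone: $\mathcal T=\bigcup_{w}w.\overline{C^v_f}$. A vectorial face is spherical if it meets $\pm\mathring{\mathcal T}$. $x\le y$ means $y-x\in\mathcal T$. A ray or segment through $x\ne y$ from $x$ is preordered if $x\le y$ or $y\le x$, generic if $y-x\in\pm\mathring{\mathcal T}$. **Filters.** A filter lies in a set $Z$ if $Z$ is an element of it; a set (e.g. an apartment) contains a filter if it contains an element of it; a map fixes a filter if it fixes pointwise some element of it. The support of a filter is the smallest affine subspace containing it. $\mathcal F\Cup\mathcal F'=\{E\cup E'\mid E\in\mathcal F,E'\in\mathcal F'\}$. The enclosure $\mathrm{cl}(\mathcal F)$ of a filter on $\mathbb A$ is the filter of sets $E$ containing some $\bigcap_{\alpha\in\Delta}D(\alpha,k_\alpha)\in\mathcal F$ with $k_\alpha\in\mathbb Z\cup\{+\infty\}$ (a set is treated as its principal filter). The face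 $F(x,F^v)$ ($x\in\mathbb A$, $F^v$ a vectorial face) is the filter of sets $E$ for which there are $k_\alpha,k'_\alpha\in\mathbb Z\cup\{+\infty\}$ $(\alpha\in\Delta)$ and a neighbourhood $\Omega$ of $x$ with $E\supset\bigcap_{\alpha}(D(\alpha,k_\alpha)\cap D^\circ(\alpha,k'_\alpha))\supset\Omega\cap(x+F^v)$. A chamber (resp. panel) is a face with support $\mathbb A$ (resp. a wall). A chimney is $\mathfrak r(F,F^v)=\mathrm{cl}(F+F^v)$, $F$ a face, $F^v$ a vectorial face; it is splayed if $F^v$ is spherical, solid if the pointwise stabilizer in $W^v$ of the direction of its support is finite. Its germ is the filter of sets belonging to some $\mathfrak r(F+u,F^v)$, $u\in\overline{F^v}$. **Apartments.** $\mathrm{Aut}(\mathbb A)$ is the group of affine bijections of $\mathbb A$ stabilizing $\{(M(\alpha,k),\alpha^\vee)\mid\alpha\in\Phi,k\in\mathbb Z\}$. An apartment of type $\mathbb A$ is a set $A$ with a nonempty set $\mathrm{Isom}^w(\mathbb A,A)$ of bijections $\mathbb A\to A$ forming one orbit $f_0\circ W^a$. A bijection $\phi:A\to A'$ is a Weyl isomorphism (resp. an isomorphism, which here always means vectorially Weyl isomorphism) if $f'^{-1}\circ\phi\circ f\in W^a$ (resp. $\in(W^v\ltimes\mathbb A)\cap\mathrm{Aut}(\mathbb A)$) for $f\in\mathrm{Isom}^w(\mathbb A,A)$, $f'\in\mathrm{Isom}^w(\mathbb A,A')$. All above notions, the affine structure and the affine topology (topology of finite-dimensional real affine space) are transported to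 every apartment. **Masure.** A masure of type $\mathbb A$ is a set $\mathcal I$ covered by a family of subsets called apartments such that: (MA1) each apartment has a structure of apartment of type $\mathbb A$. (MA2) If $F$ is a point, a germ of a preordered interval, a generic ray or a solid chimney in an apartment $A$, and $A'$ is another apartment containing $F$, then $A\cap A'$ contains $\mathrm{cl}_A(F)$ and there is a Weyl isomorphism $A\to A'$ fixing $\mathrm{cl}_A(F)$. (MA3) If $\mathfrak R$ is the germ of a splayed chimney and $F$ is a face or a germ of a solid chimney, some apartment contains $\mathfrak R$ and $F$. (MA4) If apartments $A,A'$ contain $\mathfrak R$ and $F$ as in (MA3), there is a Weyl isomorphism $A\to A'$ fixing $\mathrm{cl}_A(\mathfrak R\Cup F)$. (MAO) If $x,y\in A\cap A'$ and $x\le_A y$ then $[x,y]_A=[x,y]_{A'}$. Standing assumptions: $\mathcal I$ is such a masure; each panel lies in the closure of finitely many, and more than $2$, chambers; a group $G$ acts strongly transitively on $\mathcal I$ (it permutes apartments, each $g:A\to g.A$ is an isomorphism of apartments, and all isomorphisms in the axioms are induced by elements of $G$); $\mathbb A$ is identified with a fixed apartment of $\mathcal I$, and the stabilizer of $\mathbb A$ in $G$ induces on $\mathbb A$ the group $W^v\ltimes Y$. $\mathcal I$ is a building if and only if $W^v$ is finite. *)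

(* Defs.v *)
From HB Require Import structures.
From mathcomp Require Import all_boot all_order all_algebra.
From mathcomp Require Import all_classical all_reals all_analysis.
From mathcomp Require Import complex.

Set Implicit Arguments.
Unset Strict Implicit.
Unset Printing Implicit Defensive.

Import Order.TTheory GRing.Theory Num.Theory.
Import numFieldTopology.Exports numFieldNormedType.Exports.

Local Open Scope classical_set_scope.
Local Open Scope ring_scope.

Record is_Kac_Moody_matrix (I : finType) (c : I -> I -> int) : Prop := {
  KM_diag : forall i, c i i = 2;
  KM_off_diag : forall i j, i != j -> c i j <= 0;
  KM_zero : forall i j, c i j = 0 <-> c j i = 0
}.

(* The dual lattices are given by dual bases: Y = 'cV[int]_n, X = 'rV[int]_n,
   and x in X takes the value x *m y at y in Y.  Accordingly the apartment
   Y (x) R is 'cV[R]_n, its linear forms are row vectors and its linear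
   automorphisms are invertible matrices acting on the left.                 *)
Record vectorial_datum (I : finType) := VectorialDatum {
  vd_rank : nat;
  vd_mat : I -> I -> int;
  vd_root : I -> 'rV[int]_vd_rank;
  vd_coroot : I -> 'cV[int]_vd_rank;
  vd_matP : is_Kac_Moody_matrix vd_mat;
  vd_root_free : forall m : I -> int,
    \sum_i m i *: vd_root i = 0 -> forall i, m i = 0;
  vd_coroot_free : forall m : I -> int,
    \sum_i m i *: vd_coroot i = 0 -> forall i, m i = 0;
  vd_pairing : forall i j,
    (vd_root j *m vd_coroot i) ord0 ord0 = vd_mat i j
}.

(* The Kac-Moody algebra of c in the sense of Kac: Lie algebra with a minimal
   realization (h, simple roots, simple coroots) of c and Chevalley
   generators, generated by these and h, and without nonzero ideal meeting h
   trivially.  These conditions determine it up to isomorphism.  The last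
   condition says that an ideal a with a \cap h = 0 is zero.                  *)
Record Kac_Moody_algebra (K : fieldType) (I : finType) (c : I -> I -> int) :=
    KacMoodyAlgebra {
  km_lie :> lmodType K;
  km_bracket : km_lie -> km_lie -> km_lie;
  km_linearl : forall (a : K) x y z,
    km_bracket (a *: x + y) z = a *: km_bracket x z + km_bracket y z;
  km_linearr : forall (a : K) x y z,
    km_bracket z (a *: x + y) = a *: km_bracket z x + km_bracket z y;
  km_alt : forall x, km_bracket x x = 0;
  km_jacobi : forall x y z,
    km_bracket x (km_bracket y z) + km_bracket y (km_bracket z x)
    + km_bracket z (km_bracket x y) = 0;
  km_cartan : vectType K;
  km_incl : {linear km_cartan -> km_lie};
  km_incl_inj : injective km_incl;
  km_root : I -> {scalar km_cartan};
  km_coroot : I -> km_cartan;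
  km_root_free : forall a : I -> K,
    (forall h, \sum_i a i * km_root i h = 0) -> forall i, a i = 0;
  km_coroot_free : forall a : I -> K,
    \sum_i a i *: km_coroot i = 0 -> forall i, a i = 0;
  km_pairing : forall i j, km_root j (km_coroot i) = (c i j)%:~R;
  km_dim : (\dim {: km_cartan}
    + \rank (\matrix_(i < #|I|, j < #|I|)
               (c (enum_val i) (enum_val j))%:~R : 'M[K]_#|I|) = #|I|.*2)%N;
  km_e : I -> km_lie;
  km_f : I -> km_lie;
  km_hh : forall h h', km_bracket (km_incl h) (km_incl h') = 0;
  km_he : forall h i, km_bracket (km_incl h) (km_e i) = km_root i h *: km_e i;
  km_hf : forall h i,
    km_bracket (km_incl h) (km_f i) = - (km_root i h *: km_f i);
  km_ef : forall i j, km_bracket (km_e i) (km_f j) =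
    if i == j then km_incl (km_coroot i) else 0;
  km_generated : forall S : set km_lie,
    S 0 -> (forall a x y, S x -> S y -> S (a *: x + y)) ->
    (forall x y, S x -> S y -> S (km_bracket x y)) ->
    (forall h, S (km_incl h)) -> (forall i, S (km_e i)) ->
    (forall i, S (km_f i)) -> S = setT;
  km_no_ideal : forall S : set km_lie,
    S 0 -> (forall a x y, S x -> S y -> S (a *: x + y)) ->
    (forall x y, S y -> S (km_bracket x y)) ->
    (forall h, S (km_incl h) -> h = 0) -> S = [set 0]
}.

(* Coordinates, in the simple roots, of the roots of the algebra; all roots
   are integral combinations of the simple roots.                            *)
Definition km_is_root (K : fieldType) (I : finType) (c : I -> I -> int)
    (g : Kac_Moody_algebra K c) (m : I -> int) : Prop :=
  (exists i, m i != 0) /\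
  exists2 x : g, x != 0 & forall h,
    km_bracket (km_incl g h) x = (\sum_i (m i)%:~R * km_root g i h) *: x.

Section Apartment.
Variables (R : realType) (I : finType) (D : vectorial_datum I).
Variable g : Kac_Moody_algebra R[i] (vd_mat D).

Local Notation n := (vd_rank D).

Definition model := 'cV[R]_n.
Definition model_form := 'rV[R]_n.

Implicit Types (a : model_form) (x y : model).

Definition app_form a x : R := (a *m x) ord0 ord0.

Definition simple_root (i : I) : model_form := map_mx intr (vd_root D i).
Definition simple_coroot (i : I) : model := map_mx intr (vd_coroot D i).

Definition reflection (i : I) : 'M[R]_n :=
  1%:M - simple_coroot i *m simple_root i.

Inductive Weyl_gen : 'M[R]_n -> Prop :=
| Weyl_refl i : Weyl_gen (reflection i)
| Weyl_one : Weyl_gen 1%:M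
| Weyl_mul v w : Weyl_gen v -> Weyl_gen w -> Weyl_gen (v *m w)
| Weyl_inv w : Weyl_gen w -> Weyl_gen (invmx w).

Definition Wv : set 'M[R]_n := [set w | Weyl_gen w].

(* w.alpha = alpha o w^-1 *)
Definition real_root : set model_form :=
  [set a | exists w i, Wv w /\ a = simple_root i *m invmx w].

(* av is the coroot of the real root a *)
Definition is_coroot a (av : model) : Prop :=
  exists w i, [/\ Wv w, a = simple_root i *m invmx w & av = w *m simple_coroot i].

Definition Delta : set model_form :=
  [set a | exists2 m : I -> int, km_is_root g m
         & a = \sum_i (m i)%:~R *: simple_root i].

Definition affine_map (w : 'M[R]_n) (b : model) : model -> model :=
  fun x => w *m x + b.

Definition coroot_lattice : set model :=
  [set v | exists m : I -> int, v = \sum_i (m i)%:~R *: simple_coroot i].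

Definition lattice_Y : set model := range (fun y : 'cV[int]_n => map_mx intr y).

Definition Wa : set (model -> model) :=
  [set h | exists w b, [/\ Wv w, coroot_lattice b & h = affine_map w b]].

Definition Wv_lattice_Y : set (model -> model) :=
  [set h | exists w b, [/\ Wv w, lattice_Y b & h = affine_map w b]].

Definition Wv_translations : set (model -> model) :=
  [set h | exists w b, Wv w /\ h = affine_map w b].

Definition hyperplane a (k : R) : set model := [set x | app_form a x + k = 0].

(* None stands for k = +oo *)
Definition half_space a (k : option int) : set model :=
  if k is Some k then [set x | 0 <= app_form a x + k%:~R] else setT.
Definition open_half_space a (k : option int) : set model :=
  if k is Some k then [set x | 0 < app_form a x + k%:~R] else setT.

Definition wall : set (set model) :=
  [set M | exists a (k : int), real_root a /\ M = hyperplane a k%:~R].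

Definition marked_walls : set (set model * model) :=
  [set p | exists a (k : int),
     [/\ real_root a, p.1 = hyperplane a k%:~R & is_coroot a p.2]].

Definition Aut_model : set (model -> model) :=
  [set h | exists w b, [/\ w \in unitmx, h = affine_map w b &
     [set (affine_map w b @` p.1, w *m p.2) | p in marked_walls] = marked_walls]].

Definition fundamental_chamber : set model :=
  [set v | forall i, 0 < app_form (simple_root i) v].

Definition fundamental_face (J : {set I}) : set model :=
  [set v | forall i, if i \in J then app_form (simple_root i) v = 0
                     else 0 < app_form (simple_root i) v].

Definition vectorial_face : set (set model) :=
  [set V | exists w J, Wv w /\
     (V = [set w *m v | v in fundamental_face J] \/
      V = [set - (w *m v) | v in fundamental_face J])].

Definition Tits_cone : set model :=
  [set x | exists w v, [/\ Wv w, closure fundamental_chamber v & x = w *m v]].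

(* Tits_cone^o together with its opposite *)
Definition generic_vector : set model :=
  [set v | interior Tits_cone v \/ interior Tits_cone (- v)].

Definition spherical (V : set model) : Prop := V `&` generic_vector !=set0.

Definition Tits_le x y : Prop := Tits_cone (y - x).

Definition segment x y : set model :=
  [set x + t *: (y - x) | t in `[(0 : R), 1]].

Definition ray x y : set model := [set x + t *: (y - x) | t in [set t : R | 0 <= t]].

(* A set is treated as a filter through [globally]; a filter is given by the
   upward closed set system of its elements.                                 *)

Definition affine_subspace (p : model) (V : {vspace model}) : set model :=
  [set x | x - p \in V].

Definition support_of (F : set_system model) p V : Prop :=
  F (affine_subspace p V) /\
  forall q U, F (affine_subspace q U) ->
    affine_subspace p V `<=` affine_subspace q U.

Definition enclosed_set (k : model_form -> option int) : set model :=
  \bigcap_(a in Delta) half_space a (k a).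

Definition enclosure (F : set_system model) : set_system model :=
  filter_from [set k | F (enclosed_set k)] enclosed_set.

Definition half_open_enclosed_set
    (k : (model_form -> option int) * (model_form -> option int)) : set model :=
  \bigcap_(a in Delta) (half_space a (k.1 a) `&` open_half_space a (k.2 a)).

Definition face (x : model) (V : set model) : set_system model :=
  filter_from
    [set k | exists2 O : set model, nbhs x O &
       O `&` [set x + v | v in V] `<=` half_open_enclosed_set k]
    half_open_enclosed_set.

Definition is_face (F : set_system model) : Prop :=
  exists x V, vectorial_face V /\ F = face x V.

Definition is_chamber (F : set_system model) : Prop :=
  is_face F /\ exists p V, support_of F p V /\ affine_subspace p V = setT.

Definition is_panel (F : set_system model) : Prop :=
  is_face F /\ exists p V, support_of F p V /\ wall (affine_subspace p V).

Definition add_set (F : set_system model) (V : set model) : set_system model :=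
  filter_from F (fun E => [set x + v | x in E & v in V]).

Definition translate (F : set_system model) (u : model) : set_system model :=
  fmap (fun x : model => x + u) F.

Definition chimney (F : set_system model) (V : set model) : set_system model :=
  enclosure (add_set F V).

Definition chimney_germ (F : set_system model) (V : set model) :
    set_system model :=
  [set E | exists2 u, closure V u & chimney (translate F u) V E].

Definition solid (F : set_system model) (V : set model) : Prop :=
  exists p U, support_of (chimney F V) p U /\
    finite_set [set w | Wv w /\ forall u : model, u \in U -> w *m u = u].

Definition is_point (F : set_system model) : Prop :=
  exists x, F = globally [set x].

(* within (segment x y) (nbhs x) is the germ at x of [x, y] *)
Definition is_preordered_germ (F : set_system model) : Prop :=
  exists x y, [/\ x <> y, Tits_le x y \/ Tits_le y x
                & F = within (segment x y) (nbhs x)].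

Definition is_generic_ray (F : set_system model) : Prop :=
  exists x y, [/\ x <> y, generic_vector (y - x) & F = globally (ray x y)].

Definition is_solid_chimney (F : set_system model) : Prop :=
  exists F0 V, [/\ is_face F0, vectorial_face V, solid F0 V & F = chimney F0 V].

Definition is_solid_chimney_germ (F : set_system model) : Prop :=
  exists F0 V,
    [/\ is_face F0, vectorial_face V, solid F0 V & F = chimney_germ F0 V].

Definition is_splayed_chimney_germ (F : set_system model) : Prop :=
  exists F0 V,
    [/\ is_face F0, vectorial_face V, spherical V & F = chimney_germ F0 V].

Definition MA2_filter (F : set_system model) : Prop :=
  [\/ is_point F, is_preordered_germ F, is_generic_ray F | is_solid_chimney F].

Definition MA3_filter (F : set_system model) : Prop :=
  is_face F \/ is_solid_chimney_germ F.

End Apartment.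

Arguments Wv R {I} D _.
Arguments Wa R {I} D _.
Arguments Wv_lattice_Y R {I} D _.
Arguments Wv_translations R {I} D _.
Arguments Aut_model R {I} D _.

Section Masure.
Variables (R : realType) (I : finType) (D : vectorial_datum I).
Variable g : Kac_Moody_algebra R[i] (vd_mat D).
Variable T : Type.

Local Notation model := (model R D).

(* Candidate apartments, each with a set of parametrizations by the model.    *)
Record apartment_system := ApartmentSystem {
  apartment : set (set T);
  Isomw : set T -> set (model -> T)
}.

Variable M : apartment_system.

Implicit Types (A : set T) (F : set_system T) (phi : T -> T).

(* A set contains a filter if it is an element of it, so that [F A] reads:
   A contains F.  A filter of A is the image of a filter of the model.       *)
Definition filter_in A (P : set_system model -> Prop) F : Prop :=
  exists f (F0 : set_system model), [/\ Isomw M A f, P F0 & F = fmap f F0].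

Definition filter_somewhere (P : set_system model -> Prop) F : Prop :=
  exists2 A, apartment M A & filter_in A P F.

(* cl_A(F), for F a filter contained in A *)
Definition enclosure_in A F : set_system T :=
  [set E | exists2 f, Isomw M A f &
     enclosure g [set S | F (f @` S)] (f @^-1` E)].

Definition fixes phi F : Prop := exists2 E, F E & forall x, E x -> phi x = x.

Definition filter_cup F F' : set_system T :=
  [set E | exists E1 E2, [/\ F E1, F' E2 & E = E1 `|` E2]].

(* Isomorphisms A -> A' are represented by maps phi : T -> T, whose values
   outside A are irrelevant.                                                 *)
Definition iso_of_type (H : set (model -> model)) A A' phi : Prop :=
  set_bij A A' phi /\
  forall f f', Isomw M A f -> Isomw M A' f' ->
    exists2 h, H h & forall x, phi (f x) = f' (h x).

Definition Weyl_iso := iso_of_type (Wa R D).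
Definition vect_Weyl_iso := iso_of_type (Wv_translations R D `&` Aut_model R D).

Definition apartment_segment A (x y : T) : set T :=
  [set z | exists f (a b : model), [/\ Isomw M A f, f a = x, f b = y
     & (f @` segment a b) z]].

Definition apartment_le A (x y : T) : Prop :=
  exists f (a b : model), [/\ Isomw M A f, f a = x, f b = y & Tits_le a b].

Definition MA1 : Prop :=
  forall A, apartment M A -> exists2 f0 : model -> T,
    set_bij setT A f0 & Isomw M A = [set f0 \o w | w in Wa R D].

(* MA2 and MA4 are stated for isomorphisms taken in a set Phi of maps: all
   maps in the definition of masures, those induced by the elements of a group
   in the definition of strong transitivity.                                 *)
Definition MA2 (Phi : set (T -> T)) : Prop :=
  forall A A' F, apartment M A -> apartment M A' ->
    filter_in A (MA2_filter g) F -> F A' ->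
    enclosure_in A F (A `&` A') /\
    exists phi, [/\ Phi phi, Weyl_iso A A' phi & fixes phi (enclosure_in A F)].

Definition MA3 : Prop :=
  forall F F', filter_somewhere (is_splayed_chimney_germ g) F ->
    filter_somewhere (MA3_filter g) F' ->
    exists A, [/\ apartment M A, F A & F' A].

Definition MA4 (Phi : set (T -> T)) : Prop :=
  forall A A' F F', apartment M A -> apartment M A' ->
    filter_somewhere (is_splayed_chimney_germ g) F ->
    filter_somewhere (MA3_filter g) F' ->
    F A -> F' A -> F A' -> F' A' ->
    exists phi, [/\ Phi phi, Weyl_iso A A' phi
                  & fixes phi (enclosure_in A (filter_cup F F'))].

Definition MAO : Prop :=
  forall A A' x y, apartment M A -> apartment M A' ->
    (A `&` A') x -> (A `&` A') y -> apartment_le A x y ->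
    apartment_segment A x y = apartment_segment A' x y.

Record is_masure : Prop := {
  masure_cover : \bigcup_(A in apartment M) A = setT;
  masure_MA1 : MA1;
  masure_MA2 : MA2 setT;
  masure_MA3 : MA3;
  masure_MA4 : MA4 setT;
  masure_MAO : MAO
}.

(* Inclusion of filters is reverse inclusion of set systems, and the closure of
   a filter is generated by the closures of its elements: P0 is in the closure
   of C0 when every closure of an element of C0 is an element of P0.         *)
Definition in_closure (P C : set_system T) : Prop :=
  exists A f (P0 C0 : set_system model), [/\ apartment M A, Isomw M A f,
    is_panel g P0 /\ is_chamber g C0,
    filter_from C0 closure `<=` P0 & P = fmap f P0 /\ C = fmap f C0].

Definition thick : Prop :=
  forall P, filter_somewhere (is_panel g) P ->
    exists2 k : nat, (2 < k)%N & ([set C | in_closure P C] #= `I_k)%card.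

Record strongly_transitive (G : groupType) (act : G -> T -> T) : Prop := {
  st_act1 : forall x, act 1%g x = x;
  st_actM : forall u v x, act (u * v)%g x = act u (act v x);
  st_apartment : forall u A, apartment M A -> apartment M (act u @` A);
  st_iso : forall u A, apartment M A -> vect_Weyl_iso A (act u @` A) (act u);
  st_MA2 : MA2 (range act);
  st_MA4 : MA4 (range act)
}.

(* f0 identifies the model with a fixed apartment, on which its stabilizer
   induces W^v |x Y.                                                         *)
Definition standard_apartment (G : groupType) (act : G -> T -> T)
    (f0 : model -> T) : Prop :=
  [/\ apartment M (range f0), Isomw M (range f0) f0 &
      [set h : model -> model | exists u,
         act u @` range f0 = range f0 /\ forall x, act u (f0 x) = f0 (h x)]
      = Wv_lattice_Y R D].

End Masure.

(* A masure of type D is a building if and only if its Weyl group is finite;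
   this is taken as the meaning of the word.                                 *)
Definition is_building (R : realType) (I : finType) (D : vectorial_datum I)
    (T : Type) (M : apartment_system R D T) : Prop := finite_set (Wv R D).

(* The subspace topology of every apartment is its affine topology. *)
Definition induces_affine_topology (R : realType) (I : finType)
    (D : vectorial_datum I) (T : topologicalType)
    (M : apartment_system R D T) : Prop :=
  forall A f, apartment M A -> Isomw M A f ->
    forall U : set 'cV[R]_(vd_rank D),
      open U <-> exists2 V : set T, open V & U = f @^-1` V.

(* Main.v *)
(* Suppose that an open set U of the masure lies in an apartment A.  As the Weyl
   group is infinite there are infinitely many real roots, of unbounded height,
   so walls meet U; let x in U be a generic point of such a wall.  The filter of
   sets containing a half-open enclosed set that contains x + t v for small t > 0
   describes the faces at x, and combining this with sign coherence, W-invariance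
   and symmetry of the roots one finds that in one apartment at most two chambers
   have the panel at x in their closure.  If a chamber C of another apartment A1
   has this panel in its closure, then (MA2) identifies A and A1 near the panel.
   Since U is open, A1 stays in U, hence in A, along a short segment from x into
   C; a second use of (MA2) then shows that C is one of the two chambers of A.
   This contradicts thickness.                                                  *)
Require Import Defs.
From HB Require Import structures.
From mathcomp Require Import all_boot all_order all_algebra.
From mathcomp Require Import all_classical all_reals all_analysis.
From mathcomp Require Import complex ring lra zify.

Set Implicit Arguments.
Unset Strict Implicit.
Unset Printing Implicit Defensive.

Import Order.TTheory GRing.Theory Num.Theory.
Import numFieldTopology.Exports numFieldNormedType.Exports.
Local Open Scope ring_scope.

(** * Roots of Kac-Moody algebras *)

(** Faces and enclosures are cut out by all of [Delta], imaginary roots included, and [Delta] is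
    known only as the set of weights of an algebra without nonzero ideals meeting the Cartan
    subalgebra trivially. This is why the properties of roots are derived from that algebra. The
    main obstacle comes afterwards: an element of a face filter is an intersection over infinitely
    many roots, so inequalities obtained for each root separately must be made to hold on one
    segment common to all of them. Two facts give the uniformity. Apart from the root alpha_i of the
    wall, the height of a positive root is at most a constant times its value on the direction of
    the panel; and only finitely many positive roots have bounded height. The root alpha_i itself is
    handled by integrality of the bounds. Genericity of x puts x in every element of the filter of
    the panel. Another apartment containing the panel therefore contains x, and this is what lets
    openness of U be used in that apartment. *)

Record Lie_bracket (K : fieldType) (L : lmodType K) (br : L -> L -> L) : Prop := {
  br_linearl : forall a x y z, br (a *: x + y) z = a *: br x z + br y z;
  br_linearr : forall a x y z, br z (a *: x + y) = a *: br z x + br z y;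
  br_alt : forall x, br x x = 0;
  br_Jacobi : forall x y z, br x (br y z) + br y (br z x) + br z (br x y) = 0
}.

(** * Derivations and sl_2-strings *)

Section LieTheory.
Variables (K : fieldType) (L : lmodType K) (br : L -> L -> L).
Hypothesis brL : Lie_bracket br.

Lemma brDl x y z : br (x + y) z = br x z + br y z.
Proof. by rewrite -[x]scale1r (br_linearl brL) !scale1r. Qed.

Lemma brDr x y z : br z (x + y) = br z x + br z y.
Proof. by rewrite -[x]scale1r (br_linearr brL) !scale1r. Qed.

Lemma br0l x : br 0 x = 0.
Proof. by apply: (addrI (br 0 x)); rewrite -brDl !addr0. Qed.

Lemma br0r x : br x 0 = 0.
Proof. by apply: (addrI (br x 0)); rewrite -brDr !addr0. Qed.

Lemma brZl a x z : br (a *: x) z = a *: br x z.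
Proof. by rewrite -[a *: x]addr0 (br_linearl brL) br0l addr0. Qed.

Lemma brZr a x z : br z (a *: x) = a *: br z x.
Proof. by rewrite -[a *: x]addr0 (br_linearr brL) br0r addr0. Qed.

Lemma brNl x z : br (- x) z = - br x z.
Proof. by rewrite -scaleN1r brZl scaleN1r. Qed.

Lemma brNr x z : br z (- x) = - br z x.
Proof. by rewrite -scaleN1r brZr scaleN1r. Qed.

Lemma brC x y : br x y = - br y x.
Proof.
have := br_alt brL (x + y).
rewrite brDl !brDr !(br_alt brL) add0r addr0 => /eqP.
by rewrite addr_eq0 => /eqP.
Qed.

Lemma br_suml (T : Type) (r : seq T) (F : T -> L) z :
  br (\sum_(t <- r) F t) z = \sum_(t <- r) br (F t) z.
Proof.
by elim: r => [|t r IH]; rewrite ?big_nil ?br0l // !big_cons brDl IH.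
Qed.

Lemma br_sumr (T : Type) (r : seq T) (F : T -> L) z :
  br z (\sum_(t <- r) F t) = \sum_(t <- r) br z (F t).
Proof.
by elim: r => [|t r IH]; rewrite ?big_nil ?br0r // !big_cons brDr IH.
Qed.

Lemma br_br x y z : br x (br y z) = br (br x y) z + br y (br x z).
Proof.
apply/eqP; rewrite -subr_eq0 opprD addrA.
rewrite [br (br x y) z]brC opprK [br x z]brC brNr opprK.
by rewrite -[X in _ == X](br_Jacobi brL x y z) addrAC.
Qed.

Lemma br_iterD (x y z : L) : br x y = 0 ->
  forall k, br x (iter k (br y) z) = iter k (br y) (br x z).
Proof.
move=> xy; elim=> //= k IH.
by rewrite br_br xy br0l add0r IH.
Qed.

(** [br x] is a derivation: in the Leibniz expansion of its (p + q)-th power on [br y z], every term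
    has at least p powers on y or at least q on z. The nested induction performs this expansion one
    step at a time. *)
Lemma br_iter_nilpotent (x y z : L) : 
  (exists k, iter k (br x) y = 0) -> (exists k, iter k (br x) z = 0) ->
  exists k, iter k (br x) (br y z) = 0.
Proof.
have it0 k : iter k (br x) 0 = 0 by elim: k => //= k ->; rewrite br0r.
have itD k a b : iter k (br x) (a + b) = iter k (br x) a + iter k (br x) b.
  by elim: k => //= k ->; rewrite brDr.
move=> [p yp] [q zq]; exists (p + q)%N.
elim: p q y z yp zq => [|p IHp] q y z; first by move=> /= -> _; rewrite br0l it0.
elim: q y z => [|q IHq] y z; first by move=> _ /= ->; rewrite br0r it0 br0r.
move=> yp zq; rewrite addSn iterSr br_br itD.
rewrite IHp ?add0r //; last by rewrite -iterSr.
by rewrite addnS -addSn; apply: IHq => //; rewrite -iterSr.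
Qed.

Section String.
Variables (e f h : L) (a : K).
Hypotheses (hf : br h f = - (2 *: f)) (ef : br e f = h).

Lemma br_h_iter_f y : br h y = a *: y ->
  forall j, br h (iter j (br f) y) = (a - (j.*2)%:R) *: iter j (br f) y.
Proof.
move=> hy; elim=> [|j IH]; first by rewrite subr0.
rewrite [iter _ _ _]/= br_br hf IH brNl brZl brZr.
by rewrite -scaleNr -scalerDl doubleS -[(j.*2).+2]addn2 natrD; congr (_ *: _); ring.
Qed.

(** The Serre relations use this formula with the two generators exchanged, the reflection of roots
    as it stands. *)
Lemma br_e_iter_f y : br h y = a *: y -> br e y = 0 ->
  forall j, br e (iter j.+1 (br f) y)
            = (j.+1%:R * (a - j%:R)) *: iter j (br f) y.
Proof.
move=> hy ey; elim=> [|j IH].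
  by rewrite /= br_br ef ey br0r addr0 hy subr0 mul1r.
rewrite [iter j.+2 _ _]/= br_br ef IH.
rewrite brZr -[br f (iter j _ _)]/(iter j.+1 (br f) y) br_h_iter_f // -scalerDl; congr (_ *: _).
rewrite -addnn natrD -[j.+2]addn1 -[j.+1]addn1 !natrD; ring.
Qed.

End String.

End LieTheory.

(** * Degrees and the triangular decomposition *)

Section Degrees.
Variable I : finType.
Implicit Types (m : {ffun I -> int}) (i j : I).

Definition deg i : {ffun I -> int} := [ffun j => (j == i)%:Z].

Definition deg_pos m := (m != 0) && [forall j, 0 <= m j].

Lemma deg_pos_deg i : deg_pos (deg i).
Proof.
apply/andP; split; last by apply/forallP => j; rewrite ffunE; case: eqP.
by apply/eqP => /ffunP/(_ i); rewrite !ffunE eqxx.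
Qed.

Lemma deg_posP m : reflect (m <> 0 /\ forall j, 0 <= m j) (deg_pos m).
Proof.
by apply: (iffP andP) => -[/eqP m0 mp]; split=> //; apply/forallP.
Qed.

Lemma deg_posD m m' : deg_pos m -> deg_pos m' -> deg_pos (m + m').
Proof.
move=> /deg_posP[m0 mp] /deg_posP[m0' mp']; apply/deg_posP; split; last first.
  by move=> j; rewrite ffunE addr_ge0.
move=> /ffunP mm; apply: m0; apply/ffunP => j; have := mm j.
by rewrite !ffunE => /eqP; rewrite paddr_eq0 // => /andP[/eqP].
Qed.

Lemma deg_posN m : deg_pos m -> ~~ deg_pos (- m).
Proof.
move=> mp; apply/negP => mn; have /deg_posP[] := deg_posD mp mn.
by rewrite subrr.
Qed.

End Degrees.

(** The relations are separated from generation and from the ideal condition so that they serve for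
    the Kac-Moody algebra, for its square, and with E and F exchanged. *)
Record Chevalley (K : fieldType) (I : finType) (V : lmodType K)
    (al : I -> V -> K) (av : I -> V)
    (L : lmodType K) (br : L -> L -> L) (H : V -> L) (E F : I -> L) : Prop := {
  ch_H : forall a h h', H (a *: h + h') = a *: H h + H h';
  ch_hh : forall h h', br (H h) (H h') = 0;
  ch_he : forall h i, br (H h) (E i) = al i h *: E i;
  ch_hf : forall h i, br (H h) (F i) = - (al i h *: F i);
  ch_ef : forall i j, br (E i) (F j) = if i == j then H (av i) else 0
}.

Section Words.
Variables (K : fieldType) (I : finType) (L : lmodType K) (br : L -> L -> L).
Local Notation Q := {ffun I -> int}.

(** Only right-normed brackets occur, so that bracketing with some [F j] can be computed letter by
    letter. The degree is part of the derivation and is not read off from weights. *)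
Inductive word (E : I -> L) : Q -> L -> Prop :=
| word_gen i : word E (deg i) (E i)
| word_lin m a x y : word E m x -> word E m y -> word E m (a *: x + y)
| word_br i m x : word E m x -> word E (deg i + m) (br (E i) x).

Lemma word_pos E m x : word E m x -> deg_pos m.
Proof.
elim=> [i|//|i {}m {}x _ mp]; first exact: deg_pos_deg.
by rewrite deg_posD ?deg_pos_deg.
Qed.

Lemma word_scale E a m x : word E m x -> word E m (a *: x).
Proof.
move=> w; have -> : a *: x = (a - 1) *: x + x.
  by rewrite scalerBl scale1r subrK.
exact: word_lin.
Qed.

Inductive graded (V : Type) (H : V -> L) (E F : I -> L) : Q -> L -> Prop :=
| graded0 m : graded H E F m 0
| graded_lin m a x y :
    graded H E F m x -> graded H E F m y -> graded H E F m (a *: x + y)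
| gradedE i : graded H E F (deg i) (E i)
| gradedF i : graded H E F (- deg i) (F i)
| gradedH h : graded H E F 0 (H h)
| graded_br m m' x y : graded H E F m x -> graded H E F m' y ->
    graded H E F (m + m') (br x y).

End Words.

Section Triangular.
Variables (K : fieldType) (I : finType) (V : lmodType K).
Variables (al : I -> V -> K) (av : I -> V).
Variables (L : lmodType K) (br : L -> L -> L).
Hypothesis brL : Lie_bracket br.
Local Notation Q := {ffun I -> int}.

Definition weight (m : Q) (h : V) : K := \sum_i (m i)%:~R * al i h.

Lemma weight0 h : weight 0 h = 0.
Proof. by rewrite /weight big1 // => i _; rewrite ffunE mul0r. Qed.

Lemma weightD m m' h : weight (m + m') h = weight m h + weight m' h.
Proof.
rewrite /weight -big_split; apply: eq_bigr => i _.
by rewrite ffunE intrD mulrDl.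
Qed.

Lemma weightN m h : weight (- m) h = - weight m h.
Proof. by apply/eqP; rewrite -addr_eq0 -weightD addNr weight0. Qed.

Lemma weight_deg i h : weight (deg i) h = al i h.
Proof.
rewrite /weight (bigD1 i) //= ffunE eqxx mul1r big1 ?addr0 // => j /negbTE ji.
by rewrite ffunE ji mul0r.
Qed.

Definition weight_vector (H : V -> L) (m : Q) (x : L) :=
  forall h, br (H h) x = weight m h *: x.

Section Relations.
Variables (H : V -> L) (E F : I -> L).
Hypothesis chv : Chevalley al av br H E F.

Lemma Chevalley_H0 : H 0 = 0.
Proof.
have := ch_H chv 1 0 0; rewrite scaler0 add0r scale1r => e.
by apply: (addrI (H 0)); rewrite -e addr0.
Qed.

Lemma graded_weight_vector m x :
  graded br H E F m x -> weight_vector H m x.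
Proof.
elim=> {m x} [m|m a x y _ hx _ hy|i|i|h'|m m' x y _ hx _ hy] h.
- by rewrite (br0r brL) scaler0.
- by rewrite (brDr brL) (brZr brL) hx hy scalerDr !scalerA mulrC.
- by rewrite (ch_he chv) weight_deg.
- by rewrite (ch_hf chv) weightN weight_deg scaleNr.
- by rewrite (ch_hh chv) weight0 scale0r.
- by rewrite (br_br brL) hx hy (brZl brL) (brZr brL) weightD scalerDl.
Qed.

Lemma word_graded m x : word br E m x -> graded br H E F m x.
Proof.
elim=> [i|{}m a {}x y _ gx _ gy|i {}m {}x _ gx]; first exact: gradedE.
- exact: graded_lin.
- by apply: graded_br gx; apply: gradedE.
Qed.

Definition nonneg_part (m : Q) (x : L) :=
  [\/ x = 0, m = 0 /\ exists h, x = H h | word br E m x].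

Lemma nonneg_part_lin m a x y :
  nonneg_part m x -> nonneg_part m y -> nonneg_part m (a *: x + y).
Proof.
have w0 x' : word br E 0 x' -> False by move=> /word_pos/deg_posP[].
case=> [->|[m0 [h ->]]|wx] [->|[m0' [h' ->]]|wy]; rewrite ?scaler0 ?add0r ?addr0.
- by constructor 1.
- by constructor 2; split=> //; exists h'.
- by constructor 3.
- constructor 2; split=> //; exists (a *: h).
  by rewrite -[a *: h]addr0 (ch_H chv) Chevalley_H0 addr0.
- by constructor 2; split=> //; exists (a *: h + h'); rewrite (ch_H chv).
- by case: (w0 y); rewrite -m0.
- by constructor 3; apply: word_scale.
- by case: (w0 x); rewrite -m0'.
- by constructor 3; apply: word_lin.
Qed.

(** Moving [F j] past the first letter leaves an element of the Cartan part, which acts on the rest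
    of the word by a scalar. Only a word of one letter descends to the Cartan part. *)
Lemma word_lower m x j :
  word br E m x -> nonneg_part (m - deg j) (br (F j) x).
Proof.
elim=> [i|{}m a {}x y _ nx _ ny|i {}m {}x wx nx].
- rewrite (brC brL) (ch_ef chv); case: eqP => [->|_].
    rewrite subrr; constructor 2; split=> //; exists (-1 *: av j + 0).
    by rewrite (ch_H chv) Chevalley_H0 scaleN1r addr0.
  by rewrite oppr0; constructor 1.
- by rewrite (brDr brL) (brZr brL); apply: nonneg_part_lin.
rewrite (br_br brL) -[X in nonneg_part _ (X + _)]scale1r.
apply: nonneg_part_lin.
  rewrite [br (F j) (E i)](brC brL) (ch_ef chv); case: eqP => [->|_]; last first.
    by rewrite oppr0 (br0l brL); constructor 1.
  rewrite (brNl brL) (graded_weight_vector (word_graded wx)) -scaleNr addrC addKr.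
  by constructor 3; apply: word_scale.
case: nx => [->|[m0 [h ->]]|w].
- by rewrite (br0r brL); constructor 1.
- rewrite (brC brL) (ch_he chv) -scaleNr -addrA m0 addr0.
  by constructor 3; apply: word_scale; apply: word_gen.
- by rewrite -addrA; constructor 3; apply: word_br.
Qed.

Lemma br_H_nonneg m x h : nonneg_part m x -> nonneg_part m (br (H h) x).
Proof.
case=> [->|[m0 [h' ->]]|w].
- by rewrite (br0r brL); constructor 1.
- by rewrite (ch_hh chv); constructor 1.
- rewrite (graded_weight_vector (word_graded w)); constructor 3.
  exact: word_scale.
Qed.

End Relations.
Arguments word_lower {H E F} chv {m x} j.

(** By this symmetry every lemma on words in E yields the one on words in F. *)
Lemma Chevalley_opp H E F :
  Chevalley al av br H E F -> Chevalley al av br (fun h => - H h) F E.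
Proof.
case=> cH hh he hf ef; split.
- by move=> a h h'; rewrite cH opprD scalerN.
- by move=> h h'; rewrite (brNl brL) (brNr brL) hh !oppr0.
- by move=> h i; rewrite (brNl brL) hf opprK.
- by move=> h i; rewrite (brNl brL) he.
- move=> i j; rewrite (brC brL) ef eq_sym; case: eqP => [->|_] //.
  by rewrite oppr0.
Qed.

Section Decomposition.
Variables (H : V -> L) (E F : I -> L).
Hypothesis chv : Chevalley al av br H E F.

Definition triangular (m : Q) (x : L) :=
  nonneg_part H E m x \/ word br F (- m) x.

Lemma nonneg_part_opp m x :
  nonneg_part (fun h => - H h) F (- m) x <->
  [\/ x = 0, m = 0 /\ exists h, x = H h | word br F (- m) x].
Proof.
have HN h : exists h', H h = - H h'.
  exists (-1 *: h + 0); rewrite (ch_H chv) (Chevalley_H0 chv).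
  by rewrite scaleN1r addr0 opprK.
split=> -[->|[m0 [h ->]]|w]; try by [constructor 1|constructor 3].
  constructor 2; split; first by apply/eqP; rewrite -oppr_eq0 m0.
  by have [h' e] := HN h; exists h'; rewrite e opprK.
by rewrite m0 oppr0; constructor 2; split.
Qed.

Lemma triangularP m x :
  triangular m x <->
  nonneg_part H E m x \/ nonneg_part (fun h => - H h) F (- m) x.
Proof.
rewrite nonneg_part_opp; split.
  by case=> [n|w]; [left|right; constructor 3].
case=> [n|[->|[m0 hx]|w]]; [by left|by left; constructor 1| |by right].
by left; constructor 2.
Qed.

Lemma triangular_lin m a x y :
  triangular m x -> triangular m y -> triangular m (a *: x + y).
Proof.
(* The sign of the degree decides on which side a nonzero element lies, so two nonzero elements of
   the same degree lie on the same side. *)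
have key n z : triangular n z -> z = 0 \/ 
   ~~ deg_pos (- n) /\ nonneg_part H E n z \/ deg_pos (- n) /\ word br F (- n) z.
  case=> [[->|[n0 zh]|w]|w]; first by left.
  - right; left; split; last by constructor 2.
    by rewrite n0 oppr0; apply/negP => /deg_posP[].
  - by right; left; split; [apply: deg_posN (word_pos w)|constructor 3].
  - by right; right; split; first exact: word_pos w.
move=> /key[->|ktx].
  by rewrite scaler0 add0r.
move=> /key[->|kty].
  rewrite addr0; case: ktx => -[_]; last by right; apply: word_scale.
  left; rewrite -[_ *: _]addr0; apply: (nonneg_part_lin chv) => //.
  by constructor 1.
case: ktx kty => -[p tx] [] [p' ty].
- by left; apply: (nonneg_part_lin chv).
- by rewrite p' in p.
- by rewrite p in p'.
- by right; apply: word_lin.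
Qed.

Lemma triangular_E i m x : triangular m x -> triangular (deg i + m) (br (E i) x).
Proof.
case=> [[->|[-> [h ->]]|w]|w].
- by rewrite (br0r brL); left; constructor 1.
- rewrite (brC brL) (ch_he chv) addr0 -scaleNr; left; constructor 3.
  by apply: word_scale; apply: word_gen.
- by left; constructor 3; apply: word_br.
- apply/triangularP; right; rewrite opprD addrC.
  exact: (word_lower (Chevalley_opp chv)).
Qed.

Lemma triangular_F i m x : triangular m x -> triangular (- deg i + m) (br (F i) x).
Proof.
case=> [[->|[-> [h ->]]|w]|w].
- by rewrite (br0r brL); left; constructor 1.
- rewrite (brC brL) (ch_hf chv) addr0 opprK; right.
  by rewrite opprK; apply: word_scale; apply: word_gen.
- by left; rewrite addrC; apply: (word_lower chv).
- by right; rewrite opprD opprK; apply: word_br.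
Qed.

Lemma triangular_H h m x : triangular m x -> triangular m (br (H h) x).
Proof.
case=> [n|w]; first by left; apply: (br_H_nonneg chv).
right; have gx := graded_weight_vector (Chevalley_opp chv)
  (word_graded (fun h => - H h) E w).
have := gx h; rewrite (brNl brL) => /eqP; rewrite eqr_oppLR -scaleNr => /eqP ->.
exact: word_scale.
Qed.

(* The subalgebra generated by the H h, E i, F i is the sum of the image of H and
   of the spans of the right-normed brackets in the E i and in the F i.       *)
Lemma graded_triangular m x : graded br H E F m x -> triangular m x.
Proof.
(* The induction is on the element that acts. For a bracket, the Jacobi identity expresses its
   action by those of its two factors, and no bracket of two words has to be rewritten. *)
have stab n z : graded br H E F n z ->
    forall m' y, triangular m' y -> triangular (n + m') (br z y).
  elim=> {n z} [n|n a z z' _ hz _ hz'|i|i|h|n n' z z' _ hz _ hz'] m' y ty.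
  - by rewrite (br0l brL); left; constructor 1.
  - by rewrite (brDl brL) (brZl brL); apply: triangular_lin; auto.
  - exact: triangular_E.
  - exact: triangular_F.
  - by rewrite add0r; apply: triangular_H.
  - have -> : br (br z z') y = -1 *: br z' (br z y) + br z (br z' y).
      by rewrite (br_br brL z) scaleN1r addrC addrK.
    apply: triangular_lin; last by rewrite -addrA; auto.
    by rewrite addrAC [n + m' + n']addrC; auto.
elim=> {m x} [m|m a x y _ tx _ ty|i|i|h|m m' x y gx _ _ ty].
- by left; constructor 1.
- exact: triangular_lin.
- by left; constructor 3; apply: word_gen.
- by right; rewrite opprK; apply: word_gen.
- by left; constructor 2; split=> //; exists h.
- exact: stab.
Qed.

End Decomposition.

End Triangular.

(** * Sums of weight vectors *)

Section GradedSums.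
Variables (K : fieldType) (I : finType) (V : lmodType K).
Variables (al : I -> V -> K).
Hypothesis intK : forall n : int, n%:~R = 0 :> K -> n = 0.
Hypothesis al_free : forall a : I -> K,
  (forall h, \sum_i a i * al i h = 0) -> forall i, a i = 0.
Variables (L : lmodType K) (br : L -> L -> L) (H : V -> L).
Hypothesis brL : Lie_bracket br.
Local Notation Q := {ffun I -> int}.

Lemma weight_inj (m m' : Q) : weight al m =1 weight al m' -> m = m'.
Proof.
move=> mm; apply/ffunP => i; apply/eqP; rewrite -subr_eq0; apply/eqP/intK.
rewrite intrB; apply: (al_free (a := fun i => (m i)%:~R - (m' i)%:~R)) => h.
under eq_bigr do rewrite mulrBl.
by rewrite sumrB; apply/eqP; rewrite subr_eq0; apply/eqP/mm.
Qed.

Lemma weight_vectors_free (s : seq Q) (X : Q -> L) : uniq s ->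
  (forall m, m \in s -> weight_vector al br H m (X m)) ->
  \sum_(m <- s) X m = 0 -> forall m, m \in s -> X m = 0.
Proof.
elim: s X => [//|m0 s IH] X /= /andP[m0s us] wX sX.
have Xs m : m \in s -> X m = 0.
  move=> ms; have [//|Xm] := eqVneq (X m) 0.
  (* If the weights of m and m0 differ at h, apply [br (H h)] minus the scalar [weight al m0 h] to
     the relation: the term of m0 disappears, and the induction hypothesis for the rescaled family
     kills [X m]. *)
  have mm0 : m = m0.
    apply: weight_inj => h; apply/eqP; rewrite -subr_eq0; apply/negPn/negP => ne.
    have := IH (fun m => (weight al m h - weight al m0 h) *: X m) us.
    move=> /(_ _ _ m ms) /eqP; rewrite scaler_eq0 (negbTE ne) (negbTE Xm) => e.
    apply: notF; apply: e => [m1 m1s h'|].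
      by rewrite (brZr brL) (wX m1) ?inE ?m1s ?orbT // !scalerA mulrC.
    under eq_bigr do rewrite scalerBl.
    rewrite sumrB -scaler_sumr.
    have -> : \sum_(m <- s) X m = - X m0.
      by apply/eqP; rewrite -addr_eq0 addrC; move/eqP: sX; rewrite big_cons.
    rewrite scalerN opprK -(wX m0) ?inE ?eqxx //.
    rewrite (eq_big_seq (fun m => br (H h) (X m))) => [|m1 m1s]; last first.
      by rewrite (wX m1) // inE m1s orbT.
    by move: sX; rewrite -(br_sumr brL) -(brDr brL) addrC big_cons => ->; apply: br0r.
  by rewrite mm0 (negbTE m0s) in ms.
move=> m; rewrite inE => /orP[/eqP->|]; last exact: Xs.
by have := sX; rewrite big_cons (eq_big_seq (fun=> 0)) // big1 ?addr0.
Qed.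

Record graded_space (P : Q -> L -> Prop) : Prop := {
  gs0 : forall m, P m 0;
  gs_lin : forall m a x y, P m x -> P m y -> P m (a *: x + y);
  gs_weight : forall m x, P m x -> weight_vector al br H m x
}.

Definition graded_sums (P : Q -> L -> Prop) (z : L) :=
  exists s X, [/\ uniq s, forall m, P m (X m) & z = \sum_(m <- s) X m].

Section Sums.
Variable P : Q -> L -> Prop.
Hypothesis gsP : graded_space P.

Lemma sums_hom m x : P m x -> graded_sums P x.
Proof.
move=> Px; exists [:: m], (fun m' => if m' == m then x else 0); split=> //.
  by move=> m'; case: eqP => [->//|_]; apply: (gs0 gsP).
by rewrite big_seq1 eqxx.
Qed.

Lemma sums_lin a x y : graded_sums P x -> graded_sums P y -> graded_sums P (a *: x + y).
Proof.
move=> [s [X [us PX ->]]] [s' [Y [us' PY ->]]].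
exists (undup (s ++ s')), (fun m => a *: (if m \in s then X m else 0)
                                   + (if m \in s' then Y m else 0)).
have sub (r r' : seq Q) (Z : Q -> L) : uniq r -> uniq r' -> {subset r <= r'} ->
    \sum_(m <- r') (if m \in r then Z m else 0) = \sum_(m <- r) Z m.
  move=> ur ur' rr'; rewrite -big_mkcond -big_filter; apply: perm_big.
  apply: uniq_perm; rewrite ?filter_uniq // => m; rewrite mem_filter.
  by case mr: (m \in r) => //=; rewrite rr'.
split; first exact: undup_uniq.
  move=> m; apply: (gs_lin gsP); case: ifP => // _; apply: (gs0 gsP).
rewrite big_split /= -scaler_sumr !sub ?undup_uniq // => m ms;
by rewrite mem_undup mem_cat ms ?orbT.
Qed.

Lemma sums0 : graded_sums P 0.
Proof. exact: sums_hom (gs0 gsP 0). Qed.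

Lemma sums_sum (T : Type) (r : seq T) (F : T -> L) :
  (forall t, graded_sums P (F t)) -> graded_sums P (\sum_(t <- r) F t).
Proof.
move=> PF; elim: r => [|t r IH]; first by rewrite big_nil; apply: sums0.
by rewrite big_cons -[F t]scale1r; apply: sums_lin.
Qed.

(** Subtract z from the component of degree m: the sum becomes a vanishing sum of weight vectors,
    which are independent. If the degree m does not occur, the same argument gives z = 0. *)
Lemma sums_proj m z : graded_sums P z -> weight_vector al br H m z -> P m z.
Proof.
move=> [s [X [us PX ez]]] wz.
have [ms|ms] := boolP (m \in s).
  have := @weight_vectors_free s (fun m' => X m' - (if m' == m then z else 0)) us.
  move=> /(_ _ _ m ms); rewrite eqxx => /(_ _ _)/eqP; rewrite subr_eq0.
  move=> e; have /eqP <- : X m == z by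
    apply: e => [m' _|]; [ case: eqP => [->|_] h;
      [ rewrite (brDr brL) (brNr brL) wz (gs_weight gsP (PX m)) scalerBr //
      | rewrite subr0 (gs_weight gsP (PX m')) //]
    | rewrite sumrB -ez -big_mkcond -big_filter (@eq_filter _ _ (pred1 m)) //;
      rewrite filter_pred1_uniq // big_seq1 subrr].
  exact: PX.
suff -> : z = 0 by apply: (gs0 gsP).
have us' : uniq (m :: s) by rewrite /= ms.
have := @weight_vectors_free (m :: s) (fun m' => if m' == m then - z else X m') us'.
move=> /(_ _ _ m); rewrite eqxx inE eqxx => /(_ _ _ isT)/eqP; rewrite oppr_eq0 => e.
apply/eqP/e => [m' _|].
  case: eqP => [-> h|_]; last exact: gs_weight (PX m').
  by rewrite (brNr brL) wz scalerN.
rewrite big_cons eqxx [X in _ + X](eq_big_seq X) ?{1}ez ?addNr // => m' m's.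
by case: eqP => // e'; rewrite -e' m's in ms.
Qed.

End Sums.

Lemma sums_br P P' z x : graded_space P' ->
  (forall m m' x y, P m x -> P' m' y -> P' (m + m') (br x y)) ->
  graded_sums P z -> graded_sums P' x -> graded_sums P' (br z x).
Proof.
move=> gsP' PP [s [X [us PX ->]]] [s' [Y [us' PY ->]]].
rewrite (br_suml brL); apply: (sums_sum gsP') => m.
rewrite (br_sumr brL); apply: (sums_sum gsP') => m'.
by apply: (sums_hom gsP') (PP _ _ _ _ (PX m) (PY m')).
Qed.

End GradedSums.

(** * The Chevalley involution and the signs of roots *)

Section KacMoodyRoots.
Variables (K : fieldType) (I : finType) (c : I -> I -> int).
Hypothesis cP : is_Kac_Moody_matrix c.
Hypothesis intK : forall n : int, n%:~R = 0 :> K -> n = 0.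
Variable g : Kac_Moody_algebra K c.
Local Notation Q := {ffun I -> int}.
Local Notation br := (@km_bracket K I c g).
Local Notation e := (@km_e K I c g).
Local Notation f := (@km_f K I c g).
Local Notation incl := (@km_incl K I c g).
Local Notation al := (fun i => km_root g i : km_cartan g -> K).
Local Notation av := (@km_coroot K I c g).
Local Notation wt := (weight_vector al br incl).

Lemma km_Lie : Lie_bracket br.
Proof.
by split; [apply: km_linearl|apply: km_linearr|apply: km_alt|apply: km_jacobi].
Qed.
Let brL := km_Lie.

Lemma km_Chevalley : Chevalley al av br incl e f.
Proof.
split; [|exact: km_hh|exact: km_he|exact: km_hf|exact: km_ef].
by move=> a h h'; rewrite linearP.
Qed.
Let chg := km_Chevalley.

(* The subalgebra of g x g generated by the (e_i, -f_i), (f_i, -e_i), (h, -h) is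
   the graph of the Chevalley involution, which exchanges m and -m.           *)
Definition pair_bracket (x y : g * g) : g * g := (br x.1 y.1, br x.2 y.2).
Definition pair_incl h : g * g := (incl h, - incl h).
Definition pair_e i : g * g := (e i, - f i).
Definition pair_f i : g * g := (f i, - e i).

Lemma pair_Lie : Lie_bracket pair_bracket.
Proof.
split=> [a x y z|a x y z|x|x y z]; congr pair => /=;
  by rewrite ?(br_linearl brL) ?(br_linearr brL) ?(br_alt brL) ?(br_Jacobi brL).
Qed.
Let brL2 := pair_Lie.

Lemma pair_Chevalley : Chevalley al av pair_bracket pair_incl pair_e pair_f.
Proof.
split=> [a h h'|h h'|h i|h i|i j].
- by rewrite /pair_incl linearP opprD -scalerN.
- by congr pair; rewrite /= ?(brNl brL) ?(brNr brL) (ch_hh chg) ?oppr0.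
- by congr pair; rewrite /= ?(brNl brL) ?(brNr brL) ?(ch_he chg) ?(ch_hf chg)
    ?opprK ?scalerN.
- by congr pair; rewrite /= ?(brNl brL) ?(brNr brL) ?(ch_he chg) ?(ch_hf chg)
    ?opprK ?scalerN ?opprK.
- rewrite /pair_bracket /= (brNl brL) (brNr brL) opprK [br (f i) _](brC brL).
  by rewrite !(ch_ef chg) eq_sym; case: eqP => [->|_]; rewrite ?oppr0.
Qed.
Let ch2 := pair_Chevalley.

Local Notation gr := (graded pair_bracket pair_incl pair_e pair_f).

Lemma km_root_linindep (a : I -> K) :
  (forall h, \sum_i a i * al i h = 0) -> forall i, a i = 0.
Proof. exact: km_root_free. Qed.

Lemma pair_graded_space : graded_space al pair_bracket pair_incl gr.
Proof.
split; [exact: graded0|exact: graded_lin|].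
by move=> m x; apply: (graded_weight_vector brL2 ch2).
Qed.
Let gs2 := pair_graded_space.

Lemma wt_fst m x : weight_vector al pair_bracket pair_incl m x -> wt m x.1.
Proof. by move=> wx h; have /(congr1 fst) := wx h. Qed.

Lemma wt_snd m x : weight_vector al pair_bracket pair_incl m x -> wt (- m) x.2.
Proof.
move=> wx h; have /(congr1 snd)/= := wx h.
by rewrite (brNl brL) weightN scaleNr => <-; rewrite opprK.
Qed.

(** The first coordinates form a subalgebra containing the generators. *)
Lemma pair_sums_surj x : exists y, graded_sums gr (x, y).
Proof.
have sl := sums_lin gs2.
have : (fun x => exists y, graded_sums gr (x, y)) = classical_sets.setT.
  apply: km_generated.
  - by exists 0; apply: (sums0 gs2).
  - by move=> a x1 x2 [y1 s1] [y2 s2]; exists (a *: y1 + y2); apply: sl s1 s2.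
  - move=> x1 x2 [y1 s1] [y2 s2]; exists (br y1 y2).
    exact: (@sums_br _ _ _ _ _ pair_bracket pair_incl brL2 gr gr _ _ gs2
      (@graded_br _ _ _ _ _ _ _ _) s1 s2).
  - by move=> h; exists (- incl h); apply: (sums_hom gs2 (gradedH _ _ _ _ h)).
  - by move=> i; exists (- f i); apply: (sums_hom gs2 (gradedE _ _ _ _ i)).
  - by move=> i; exists (- e i); apply: (sums_hom gs2 (gradedF _ _ _ _ i)).
by move=> /(congr1 (fun S => S x)) e0; change (exists y, graded_sums gr (x, y)); rewrite e0.
Qed.

(** By surjectivity of the first projection, these x form an ideal of the algebra. It meets the
    Cartan subalgebra trivially: [(incl h, 0)] has weight 0, so the triangular decomposition makes
    it some [pair_incl h'], whose second coordinate vanishes only for h' = 0. *)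
Lemma pair_sums_inj x : graded_sums gr (x, 0) -> x = 0.
Proof.
move=> sx; have sl := sums_lin gs2.
suff : (fun x => graded_sums gr (x, 0)) = (classical_sets.set1 0).
  by move=> /(congr1 (fun S => S x)) e0; have : graded_sums gr (x, 0) by []; rewrite e0.
apply: km_no_ideal.
- exact: (sums0 gs2).
- move=> a x1 x2 s1 s2.
  have : graded_sums gr (a *: x1 + x2, a *: 0 + 0) := sl a _ _ s1 s2.
  by rewrite scaler0 addr0.
- move=> x1 x2 s2; have [y1 s1] := pair_sums_surj x1.
  have := @sums_br _ _ _ _ _ pair_bracket pair_incl brL2 gr gr _ _ gs2
      (@graded_br _ _ _ _ _ _ _ _) s1 s2.
  by rewrite /pair_bracket /= (br0r brL).
- move=> h sh; have w0 : weight_vector al pair_bracket pair_incl 0 (incl h, 0).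
    move=> h'; rewrite weight0 scale0r /pair_bracket /= (br0r brL) (ch_hh chg).
    by [].
  have := graded_triangular brL2 ch2 (sums_proj intK km_root_linindep brL2 gs2 sh w0).
  case=> [[[]|[_ [h' []]]|/word_pos/deg_posP[]//]|/word_pos].
  + by rewrite -(linear0 incl) => /km_incl_inj.
  + move=> /km_incl_inj -> /esym/eqP; rewrite oppr_eq0 -(linear0 incl).
    by move=> /eqP/km_incl_inj.
  + by rewrite oppr0 => /deg_posP[].
Qed.

Lemma weight_vector_lift m x : wt m x -> exists y, gr m (x, y).
Proof.
move=> wx; have [y [s [X [us gX]]]] := pair_sums_surj x.
have gs1 : graded_space al br incl (fun m x => exists y, gr m (x, y)).
  split=> [m'|m' a x1 x2 [y1 s1] [y2 s2]|m' x1 [y1 s1]].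
  - by exists 0; apply: graded0.
  - by exists (a *: y1 + y2); apply: graded_lin s1 s2.
  - exact: wt_fst (gs_weight gs2 s1).
move=> /(congr1 fst)/=; rewrite raddf_sum => ex; apply: (sums_proj intK km_root_linindep brL gs1) wx.
exists s, (fun m => (X m).1); split=> // m'; exists (X m').2.
by rewrite -surjective_pairing.
Qed.

Definition is_root (m : Q) := km_is_root g m.

Lemma is_rootP (m : Q) : is_root m <-> m <> 0 /\ exists2 x, x <> 0 & wt m x.
Proof.
split=> [[[i mi] [x /eqP x0 wx]]|[m0 [x /eqP x0 wx]]].
  by split; [move=> m0; rewrite m0 ffunE eqxx in mi|exists x].
split; last by exists x.
apply: contrapT => nex; apply: m0; apply/ffunP => i; rewrite ffunE.
by apply/eqP/negPn/negP => mi; apply: nex; exists i.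
Qed.

(** The second coordinate of a homogeneous lift of a root vector has the opposite weight, and it is
    nonzero by [pair_sums_inj]. *)
Lemma root_opp m : is_root m -> is_root (- m).
Proof.
move=> /is_rootP[m0 [x x0 wx]]; apply/is_rootP; split.
  by move=> /eqP; rewrite oppr_eq0 => /eqP.
have [y gxy] := weight_vector_lift wx.
exists y; last exact: wt_snd (gs_weight gs2 gxy).
by move=> y0; apply: x0; apply: pair_sums_inj; apply: (sums_hom gs2); rewrite -y0; exact: gxy.
Qed.

(** A nonzero degree excludes the Cartan part of the triangular decomposition. The word lives in the
    square of the algebra, where the lift of the root vector is homogeneous. *)
Lemma root_word m : is_root m ->
  exists2 z, z <> 0 & word pair_bracket pair_e m z \/ word pair_bracket pair_f (- m) z.
Proof.
move=> /is_rootP[m0 [x x0 wx]]; have [y gxy] := weight_vector_lift wx.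
exists (x, y); first by case.
case: (graded_triangular brL2 ch2 gxy) => [[[]//|[]//|w]|w]; by [left|right].
Qed.

Lemma root_sign m : is_root m -> deg_pos m \/ deg_pos (- m).
Proof. by move=> /root_word[z _ [w|w]]; [left|right]; apply: word_pos w. Qed.

(** A word in the single letter [E i] of length at least two vanishes because [b (E i) (E i) = 0].
    Hence no multiple of a simple root other than itself and its opposite is a root. *)
Lemma word_rank1 (L : lmodType K) (b : L -> L -> L) (E : I -> L) i m x :
  Lie_bracket b -> word b E m x -> (forall j, j != i -> m j = 0) ->
  x = 0 \/ m = deg i /\ exists a, x = a *: E i.
Proof.
move=> bL; elim=> {m x} [j|m a x y _ hx _ hy|j m x wx hx] m0.
- have [->|ji] := eqVneq j i.
    by right; split=> //; exists 1; rewrite scale1r.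
  by have := m0 j ji; rewrite ffunE eqxx.
- have [->|[-> [a1 ->]]] := hx m0; first by rewrite scaler0 add0r; apply: hy.
  have [->|[_ [a2 ->]]] := hy m0; right; split=> //.
    by exists (a * a1); rewrite addr0 scalerA.
  by exists (a * a1 + a2); rewrite scalerA scalerDl.
- have /deg_posP[mn mp] := word_pos wx.
  have ji : j = i.
    apply/eqP/negPn/negP => ji; have := m0 j ji; rewrite !ffunE eqxx => e0.
    by have := mp j; move: e0 => /= /(canRL (addKr _)) ->; rewrite addr0.
  have mi k : k != i -> m k = 0.
    move=> ki; have := m0 k ki; rewrite !ffunE ji (negbTE ki).
    by rewrite add0r.
  have [->|[_ [a ->]]] := hx mi; left; first by rewrite (br0r bL).
  by rewrite (brZr bL) ji (br_alt bL) scaler0.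
Qed.

Lemma root_rank1 i m : is_root m -> (forall j, j != i -> m j = 0) ->
  m = deg i \/ m = - deg i.
Proof.
move=> /root_word[z z0 [w|w]] m0.
  by left; have [//|[]] := word_rank1 brL2 w m0.
right; have [|//|[e _]] := word_rank1 brL2 w (i := i).
  by move=> j ji; rewrite ffunE m0 ?oppr0.
by rewrite -e opprK.
Qed.

Lemma km_e_neq0 i : e i <> 0.
Proof.
move=> ei; have := ch_ef chg i i; rewrite eqxx ei (br0l brL) => /esym.
rewrite -(linear0 incl) => /km_incl_inj h0.
have := @km_coroot_free _ _ _ g (fun j => (j == i)%:R).
rewrite (bigD1 i) //= eqxx scale1r h0 add0r big1 => [/(_ erefl i)/eqP|j /negbTE ->].
  by rewrite eqxx oner_eq0.
by rewrite scale0r.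
Qed.

Lemma root_deg i : is_root (deg i).
Proof.
apply/is_rootP; split; first by have /deg_posP[] := deg_pos_deg i.
exists (e i); first exact: km_e_neq0.
by move=> h; rewrite weight_deg (ch_he chg).
Qed.

End KacMoodyRoots.

(** * Serre relations and reflection of roots *)

Section RootReflection.
Variables (K : fieldType) (I : finType) (c : I -> I -> int).
Hypothesis cP : is_Kac_Moody_matrix c.
Hypothesis intK : forall n : int, n%:~R = 0 :> K -> n = 0.
Variable g : Kac_Moody_algebra K c.
Local Notation Q := {ffun I -> int}.
Local Notation br := (@km_bracket K I c g).
Local Notation e := (@km_e K I c g).
Local Notation f := (@km_f K I c g).
Local Notation incl := (@km_incl K I c g).
Local Notation al := (fun i => km_root g i : km_cartan g -> K).
Local Notation av := (@km_coroot K I c g).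
Local Notation wt := (weight_vector al br incl).

Let brL := km_Lie g.
Let chg := km_Chevalley g.

Lemma weight_vector_e m x i : wt m x -> wt (deg i + m) (br (e i) x).
Proof.
move=> wx h; rewrite (br_br brL) (ch_he chg) wx (brZl brL) (brZr brL).
by rewrite weightD weight_deg scalerDl.
Qed.

Lemma weight_vector_f m x i : wt m x -> wt (m - deg i) (br (f i) x).
Proof.
move=> wx h; rewrite (br_br brL) (ch_hf chg) wx (brNl brL) (brZl brL) (brZr brL).
by rewrite weightD weightN weight_deg scalerDl scaleNr addrC.
Qed.

Section SingularVector.
Variables (m0 : Q) (theta : g).
Hypotheses (m0_pos : deg_pos m0) (theta_wt : wt m0 theta).
Hypothesis theta_f : forall k, br (f k) theta = 0.

Inductive e_span : Q -> g -> Prop :=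
| e_span0 m : e_span m 0
| e_span_lin m a x y : e_span m x -> e_span m y -> e_span m (a *: x + y)
| e_span_vec : e_span m0 theta
| e_span_e i m x : e_span m x -> e_span (deg i + m) (br (e i) x).

Lemma e_span_weight m x : e_span m x -> wt m x.
Proof.
elim=> {m x} [m h|m a x y _ hx _ hy h|//|i m x _]; last exact: weight_vector_e.
- by rewrite (br0r brL) scaler0.
- by rewrite (brDr brL) (brZr brL) hx hy scalerDr !scalerA mulrC.
Qed.

Lemma e_span_graded : graded_space al br incl e_span.
Proof. by split; [apply: e_span0|apply: e_span_lin|apply: e_span_weight]. Qed.

Lemma e_span_pos m x : e_span m x -> x = 0 \/ deg_pos m.
Proof.
elim=> {m x} [m|m a x y _ [->|px] _ [->|py]||i m x _ [->|px]].
all: try by [right|left].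
- by left; rewrite scaler0 addr0.
- by left; rewrite (br0r brL).
- by right; rewrite deg_posD ?deg_pos_deg.
Qed.

Lemma e_span_f k m x : e_span m x -> e_span (m - deg k) (br (f k) x).
Proof.
elim=> {m x} [m|m a x y _ sx _ sy||i m x sx sfx].
- by rewrite (br0r brL); apply: e_span0.
- by rewrite (brDr brL) (brZr brL); apply: e_span_lin.
- by rewrite theta_f; apply: e_span0.
rewrite (br_br brL) -addrA -[X in e_span _ (X + _)]scale1r.
apply: e_span_lin; last exact: e_span_e.
rewrite [br (f k) (e i)](brC brL) (ch_ef chg); case: eqP => [->|_]; last first.
  by rewrite oppr0 (br0l brL); apply: e_span0.
rewrite (brNl brL) (e_span_weight sx) -scaleNr addrC subrK -[_ *: _]addr0.
by apply: e_span_lin => //; apply: e_span0.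
Qed.

(* The vectors e_i1 ... e_ip theta span an ideal, whose weights are positive. *)
Lemma singular_vector_eq0 : theta = 0.
Proof.
have gsE := e_span_graded; have sl := sums_lin gsE.
have stab z : forall x, graded_sums e_span x -> graded_sums e_span (br z x).
  pose S : classical_sets.set g :=
    fun z => forall x, graded_sums e_span x -> graded_sums e_span (br z x).
  have hom y : (forall m x, e_span m x -> exists m', e_span m' (br y x)) -> S y.
    move=> hy x [s [X [us PX ->]]]; rewrite (br_sumr brL).
    by apply: (sums_sum gsE) => m; have [m' sm'] := hy _ _ (PX m); apply: (sums_hom gsE sm').
  have : S = classical_sets.setT.
    apply: km_generated.
    - by apply: hom => m x _; exists m; rewrite (br0l brL); apply: e_span0.
    - move=> a x y Sx Sy z' sz; rewrite (brDl brL) (brZl brL).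
      by apply: sl; [apply: Sx|apply: Sy].
    - move=> x y Sx Sy z' sz.
      have -> : br (br x y) z' = -1 *: br y (br x z') + br x (br y z').
        by rewrite (br_br brL x) scaleN1r addrC addrK.
      by apply: sl; [apply: Sy; apply: Sx|apply: Sx; apply: Sy].
    - move=> h; apply: hom => m x sx; exists m.
      rewrite (e_span_weight sx) -[_ *: _]addr0.
      by apply: e_span_lin => //; apply: e_span0.
    - by move=> i; apply: hom => m x sx; exists (deg i + m); apply: e_span_e.
    - by move=> i; apply: hom => m x sx; exists (m - deg i); apply: e_span_f.
  by move=> ST; have : S z by rewrite ST.
suff : graded_sums e_span = classical_sets.set1 0.
  move=> s0; have : graded_sums e_span theta by apply: (sums_hom gsE e_span_vec).
  by rewrite s0.
apply: km_no_ideal.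
- exact: (sums0 gsE).
- by move=> a x y; apply: sl.
- by move=> x y; apply: stab.
- move=> h sh; have w0 : wt 0 (incl h).
    by move=> h'; rewrite (ch_hh chg) weight0 scale0r.
  have := e_span_pos (sums_proj intK (@km_root_linindep _ _ _ g) brL gsE sh w0).
  case=> [|/deg_posP[]//]; rewrite -(linear0 incl); exact: km_incl_inj.
Qed.

End SingularVector.

(** For i different from j the exponent is 1 - c i j, since c i j is nonpositive. *)
Definition serre i j := iter `|c i j|.+1 (br (e i)) (e j).

Lemma weight_vector_iter_e i k m x :
  wt m x -> wt (m + deg i *+ k) (iter k (br (e i)) x).
Proof.
move=> wx; elim: k => [|k IH]; first by rewrite addr0.
by rewrite mulrS addrCA; apply: weight_vector_e.
Qed.

Lemma weight_vector_iter_f i k m x :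
  wt m x -> wt (m - deg i *+ k) (iter k (br (f i)) x).
Proof.
move=> wx; elim: k => [|k IH]; first by rewrite subr0.
rewrite mulrS opprD addrCA addrC; exact: weight_vector_f.
Qed.

Lemma iter_br0 x k : iter k (br x) 0 = 0.
Proof. by elim: k => //= k ->; rewrite (br0r brL). Qed.

(** The element is a singular vector, that is, every [f k] kills it: for k = i by the sl_2-formula,
    for k = j because [e i] commutes with itself, and otherwise because [f k] commutes with both
    letters. *)
Lemma serre_eq0 i j : i != j -> serre i j = 0.
Proof.
move=> ij; have wej : wt (deg j) (e j).
  by move=> h; rewrite weight_deg (ch_he chg).
have cij : c i j = - (`|c i j|%N)%:Z.
  by have := KM_off_diag cP ij; lia.
apply: (@singular_vector_eq0 (deg j + deg i *+ `|c i j|.+1)).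
- apply: deg_posD (deg_pos_deg _) _; elim: `|c i j|%N => [|k IH].
    exact: deg_pos_deg.
  by rewrite mulrS deg_posD ?deg_pos_deg.
- exact: weight_vector_iter_e.
move=> k; rewrite /serre; have [->|ki] := eqVneq k i.
  (* Here [f i] plays the raising operator and [e j] has weight - c i j, so the last coefficient of
     the string is zero. *)
  have := @br_e_iter_f _ _ _ brL (f i) (e i) (- incl (av i)) (- (c i j)%:~R) _ _ (e j).
  move=> -> //.
  - have -> : - (c i j)%:~R = `|c i j|%N%:R :> K by rewrite {1}cij rmorphN opprK.
    by rewrite subrr mulr0 scale0r.
  - by rewrite (brNl brL) (ch_he chg) km_pairing (KM_diag cP).
  - by rewrite (brC brL) (ch_ef chg) eqxx.
  - by rewrite (brNl brL) (ch_he chg) km_pairing scaleNr.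
  - by rewrite (brC brL) (ch_ef chg) eq_sym (negbTE ij) oppr0.
have fkei : br (f k) (e i) = 0.
  by rewrite (brC brL) (ch_ef chg) eq_sym (negbTE ki) oppr0.
rewrite (br_iterD brL _ fkei) [br (f k) (e j)](brC brL) (ch_ef chg) eq_sym.
case: eqP => [_|_]; last by rewrite oppr0 iter_br0.
have eh : br (e i) (- incl (av j)) = (c j i)%:~R *: e i.
  by rewrite (brNr brL) (brC brL) opprK (ch_he chg) km_pairing.
(* When c i j = 0 only one bracket is available and does not kill the coroot by itself; the
   vanishing then comes from c j i = 0. *)
rewrite iterSr eh; case: `|c i j|%N cij => [|k' _].
  by rewrite oppr0 => /(KM_zero cP) ->; rewrite mulr0z scale0r iter_br0.
by rewrite iterSr (brZr brL) (br_alt brL) scaler0 iter_br0.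
Qed.

(** The elements killed by some power of [br (e i)] form a subalgebra, and it contains the
    generators: [e j] by the Serre relations, [f i] after three brackets. *)
Lemma br_e_nilpotent i z : exists k, iter k (br (e i)) z = 0.
Proof.
pose S : classical_sets.set g := fun z => exists k, iter k (br (e i)) z = 0.
have grow k k' x : (k <= k')%N -> iter k (br (e i)) x = 0 -> iter k' (br (e i)) x = 0.
  by move=> /subnK <-; rewrite iterD => ->; apply: iter_br0.
have itD k a b b' : iter k (br (e i)) (a *: b + b') =
    a *: iter k (br (e i)) b + iter k (br (e i)) b'.
  by elim: k => //= k ->; rewrite (brDr brL) (brZr brL).
suff ST : S = classical_sets.setT by have : S z by rewrite ST.
apply: km_generated.
- by exists 0.
- move=> a x y [k xk] [k' yk']; exists (maxn k k').
  by rewrite itD (grow k) ?leq_maxl // (grow k') ?leq_maxr // scaler0 addr0.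
- by move=> x y; apply: (br_iter_nilpotent brL).
- move=> h; exists 2 => /=.
  by rewrite [br _ (incl h)](brC brL) (ch_he chg) (brNr brL) (brZr brL)
    (br_alt brL) scaler0 oppr0.
- move=> j; have [->|ij] := eqVneq j i; first by exists 1; rewrite /= (br_alt brL).
  by exists `|c i j|.+1; apply: serre_eq0; rewrite eq_sym.
- move=> j; have [->|ij] := eqVneq j i; last first.
    by exists 1; rewrite /= (ch_ef chg) eq_sym (negbTE ij).
  exists 3; rewrite /= (ch_ef chg) eqxx.
  by rewrite [br _ (incl _)](brC brL) (ch_he chg) (brNr brL) (brZr brL)
    (br_alt brL) scaler0 oppr0.
Qed.

Definition pairing (m : Q) i : int := \sum_j m j * c i j.

Definition refl_deg i (m : Q) : Q := m - deg i *~ pairing m i.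

Lemma pairing_coroot m i : weight al m (av i) = (pairing m i)%:~R.
Proof.
rewrite /weight /pairing rmorph_sum; apply: eq_bigr => j _.
by rewrite km_pairing rmorphM.
Qed.

Lemma pairingD m m' i : pairing (m + m') i = pairing m i + pairing m' i.
Proof.
rewrite /pairing -big_split; apply: eq_bigr => j _.
by rewrite ffunE mulrDl.
Qed.

Lemma pairing_opp m i : pairing (- m) i = - pairing m i.
Proof. by rewrite /pairing -sumrN; apply: eq_bigr => j _; rewrite ffunE mulNr. Qed.

Lemma deg_mulz (i : I) p j : (deg i *~ p) j = if j == i then p else 0.
Proof.
have E (k : nat) : (deg i *+ k) j = if j == i then k%:Z else 0.
  elim: k => [|k IH]; first by rewrite mulr0n ffunE; case: ifP.
  by rewrite mulrS ffunE IH ffunE; case: (j == i) => //; rewrite -addn1 PoszD addrC.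
case: p => k; first exact: E.
by rewrite NegzE mulrNz ffunE E; case: ifP => //; rewrite oppr0.
Qed.

Lemma refl_degE i m j :
  refl_deg i m j = m j - (if j == i then pairing m i else 0).
Proof. by rewrite !ffunE deg_mulz. Qed.

Lemma refl_degK i m : refl_deg i (refl_deg i m) = m.
Proof.
have e2 : pairing (refl_deg i m) i = - pairing m i.
  rewrite /refl_deg pairingD pairing_opp.
  have -> : pairing (deg i *~ pairing m i) i = pairing m i * 2.
    rewrite {1}/pairing (bigD1 i) //= deg_mulz eqxx (KM_diag cP) big1 ?addr0 //.
    by move=> j /negbTE ji; rewrite deg_mulz ji mul0r.
  by rewrite mulrDr !mulr1; lia.
apply/ffunP => j; rewrite refl_degE refl_degE e2.
by case: ifP => _; rewrite ?subr0 // opprK subrK.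
Qed.

(** Let p >= 0 be the pairing, and climb from x to the top y of its string, q steps up, by local
    nilpotency of [e i]. Then y has weight p + 2q for the coroot, and descending p + q steps reaches
    the reflected degree. A negative pairing is reduced to this by passing to the opposite root. *)
Lemma root_reflect i m : is_root g m -> is_root g (refl_deg i m).
Proof.
wlog p0 : m / 0 <= pairing m i.
  move=> wl rm; have [/wl|pn] := leP 0 (pairing m i); first exact.
  have -> : refl_deg i m = - refl_deg i (- m).
    apply/ffunP => j; rewrite [RHS]ffunE !refl_degE pairing_opp [X in - (X - _)]ffunE.
    by case: ifP => _; ring.
  apply: root_opp => //; apply: wl; last exact: root_opp.
  by rewrite pairing_opp oppr_ge0 ltW.
move=> /is_rootP[m0 [x x0 wx]]; apply/is_rootP; split.
  move=> r0; apply: m0; rewrite -(refl_degK i m) r0.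
  have p00 : pairing 0 i = 0 by rewrite /pairing big1 // => j _; rewrite ffunE mul0r.
  by rewrite /refl_deg p00 mulr0z subr0.
have [k0 k0P k0min] := ex_minnP (P := fun k => `[< iter k (br (e i)) x = 0 >])
  (let: ex_intro k ek := br_e_nilpotent i x in ex_intro _ k (asboolT ek)).
case: k0 k0P k0min => [/asboolP//|q /asboolP xq qmin].
pose y := iter q (br (e i)) x.
have y0 : y <> 0.
  by move=> y0; have := qmin q (asboolT y0); rewrite ltnn.
have wy : wt (m + deg i *+ q) y by apply: weight_vector_iter_e.
have [p pE] : exists p : nat, pairing m i = p by exists `|pairing m i|%N; lia.
have hy : br (incl (av i)) y = ((p + q.*2)%:R) *: y.
  rewrite wy weightD pairing_coroot pE pairing_coroot -rmorphD /=.
  have -> : pairing (deg i *+ q) i = (q.*2)%:Z.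
    have -> : deg i *+ q = deg i *~ q by [].
    rewrite {1}/pairing (bigD1 i) //= deg_mulz eqxx (KM_diag cP) big1 ?addr0.
      by rewrite mulrDr !mulr1; lia.
    by move=> j /negbTE ji; rewrite deg_mulz ji mul0r.
  by rewrite -PoszD -pmulrn.
have hf : br (incl (av i)) (f i) = - (2 *: f i).
  by rewrite (ch_hf chg) km_pairing (KM_diag cP).
have ef : br (e i) (f i) = incl (av i) by rewrite (ch_ef chg) eqxx.
have str := br_e_iter_f brL hf ef hy xq.
(* The coefficients k (p + 2q - k + 1) of the string do not vanish before its end, in characteristic
   zero. *)
have nz k : (k <= p + q.*2)%N -> iter k (br (f i)) y <> 0.
  elim: k => [//|k IH] kl ek.
  have := str k; rewrite ek (br0r brL) => /esym/eqP.
  rewrite scaler_eq0 mulf_eq0 => /orP[/orP[]|] /eqP.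
  - by rewrite pmulrn => /intK.
  - rewrite -natrB; last by rewrite ltnW.
    by rewrite pmulrn => /intK/eqP; rewrite eqz_nat subn_eq0 leqNgt kl.
  - by apply: IH; rewrite ltnW.
exists (iter (p + q) (br (f i)) y).
  by apply: nz; rewrite leq_add2l -addnn leq_addr.
have -> : refl_deg i m = m + deg i *+ q - deg i *+ (p + q).
  by rewrite /refl_deg pE mulrnDr opprD -addrA [X in _ = m + X]addrCA subrr addr0.
exact: weight_vector_iter_f.
Qed.

End RootReflection.

Local Open Scope classical_set_scope.
Local Open Scope ring_scope.

(** * Weyl group and roots as linear forms *)

Section Forms.
Variables (R : realType) (I : finType) (D : vectorial_datum I).
Local Notation n := (vd_rank D).
Local Notation form := (model_form R D).
Local Notation pt := (model R D).
Local Notation sr := (@simple_root R I D).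
Local Notation sc := (@simple_coroot R I D).
Local Notation c := (vd_mat D).
Local Notation "a .( x )" := (app_form a x) (at level 2, format "a .( x )").
Implicit Types (a b : form) (x y v : pt).

Lemma app_formDr a x y : app_form a (x + y) = app_form a x + app_form a y.
Proof. by rewrite /app_form mulmxDr mxE. Qed.

Lemma app_formZr a t x : app_form a (t *: x) = t * app_form a x.
Proof. by rewrite /app_form -scalemxAr mxE. Qed.

Lemma app_formNr a x : app_form a (- x) = - app_form a x.
Proof. by rewrite /app_form mulmxN mxE. Qed.

Lemma app_formZl a t x : app_form (t *: a) x = t * app_form a x.
Proof. by rewrite /app_form -scalemxAl mxE. Qed.

Lemma app_formNl a x : app_form (- a) x = - app_form a x.
Proof. by rewrite /app_form mulNmx mxE. Qed.

Lemma app_form_suml (J : Type) (r : seq J) (F : J -> form) x :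
  app_form (\sum_(j <- r) F j) x = \sum_(j <- r) app_form (F j) x.
Proof. by rewrite /app_form mulmx_suml summxE. Qed.

Lemma app_form_sumr (J : Type) (r : seq J) a (F : J -> pt) :
  app_form a (\sum_(j <- r) F j) = \sum_(j <- r) app_form a (F j).
Proof. by rewrite /app_form mulmx_sumr summxE. Qed.

Lemma app_form_mul a (w : 'M[R]_n) x : app_form (a *m w : form) x = app_form a (w *m x).
Proof. by rewrite /app_form mulmxA. Qed.

Lemma form_ext a b : (forall x, app_form a x = app_form b x) -> a = b.
Proof.
move=> ab; apply/rowP => j; have := ab (delta_mx j ord0).
by rewrite /app_form -!colE !mxE.
Qed.

Lemma continuous_app_form a : continuous (app_form a).
Proof.
have -> : app_form a = (fun y : pt => \sum_j a ord0 j * y j ord0).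
  by apply/funext => y; rewrite /app_form mxE.
apply: (@continuous_big R 'I_n +%R 0 predT (@add_continuous R^o)) => j _ x.
apply: (@cvgM R pt (nbhs x) _ (fun=> a ord0 j) (fun y => y j ord0)).
  exact: cvg_cst.
exact: coord_continuous.
Qed.

Lemma app_form_root_coroot i j : app_form (sr j) (sc i) = (c i j)%:~R.
Proof.
rewrite /app_form /simple_root /simple_coroot -map_mxM mxE.
by rewrite vd_pairing.
Qed.

Lemma simple_root_free_rat :
  row_free (\matrix_(i < #|I|) map_mx intr (vd_root D (enum_val i)) : 'M[rat]_(_, n)).
Proof.
apply: inj_row_free => v v0.
pose N : int := \prod_j denq (v ord0 j).
have Nn : N != 0 by apply/prodf_neq0 => j _; rewrite denq_neq0.
have [m mE] : exists m : 'I_#|I| -> int, forall j, (m j)%:~R = N%:~R * v ord0 j.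
  exists (fun j => numq (v ord0 j) * \prod_(k | k != j) denq (v ord0 k)) => j.
  have -> : N = denq (v ord0 j) * \prod_(k | k != j) denq (v ord0 k).
    by rewrite /N (bigD1 j).
  by rewrite /= !intrM numqE; ring.
have m0 := @vd_root_free _ D (fun i => m (enum_rank i)).
have : \sum_i m (enum_rank i) *: vd_root D i = 0.
  apply/rowP => k; rewrite summxE mxE; apply/eqP; rewrite -(intr_eq0 rat).
  have /rowP/(_ k) := v0; rewrite mxE mxE => e0.
  apply/eqP; rewrite rmorph_sum /=.
  transitivity (N%:~R * 0 : rat); last by rewrite mulr0.
  rewrite -[X in _ = _ * X]e0 mulr_sumr.
  rewrite (reindex (@enum_val I predT)) /=; last first.
    by exists enum_rank => ? _; rewrite ?enum_valK ?enum_rankK.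
  apply: eq_bigr => i _; rewrite !mxE enum_valK rmorphM /= mE mulrA.
  by [].
move=> /m0 mz; apply/rowP => j; rewrite mxE.
have := mE j; have -> : m j = 0 by rewrite -(enum_valK j) mz.
by move=> /esym/eqP; rewrite mulf_eq0 intr_eq0 (negbTE Nn) => /eqP.
Qed.

(** Independence over the integers gives independence over the rationals by clearing denominators,
    and the rank is unchanged over R. The columns of a right inverse are the dual vectors. *)
Lemma dual_vectors : exists om : I -> pt,
  forall i j, app_form (sr j) (om i) = (i == j)%:R.
Proof.
have := simple_root_free_rat; rewrite -(row_free_map (@ratr R)) => /row_freeP[B AB].
exists (fun i => col (enum_rank i) B) => i j.
have /matrixP/(_ (enum_rank j) (enum_rank i)) := AB.
rewrite [RHS]mxE (can_eq enum_rankK) eq_sym => <-; rewrite /app_form !mxE.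
apply: eq_bigr => k _; rewrite !mxE enum_rankK; congr (_ * _).
by symmetry; exact: ratr_int.
Qed.

Definition dual_vector : I -> pt := xget (fun=> 0) [set om : I -> pt |
  forall i j, app_form (sr j) (om i) = (i == j)%:R].

Lemma app_form_dual i j : app_form (sr j) (dual_vector i) = (i == j)%:R.
Proof. by have /(xgetPex (fun=> 0)) := dual_vectors; apply. Qed.

Definition vector_of (t : I -> R) : pt := \sum_i t i *: dual_vector i.

Lemma app_form_vector_of t i : app_form (sr i) (vector_of t) = t i.
Proof.
rewrite app_form_sumr (bigD1 i) //= app_formZr app_form_dual eqxx mulr1 big1 ?addr0 //.
by move=> j /negbTE ji; rewrite app_formZr app_form_dual ji mulr0.
Qed.

Lemma simple_root_free (t : I -> R) : \sum_i t i *: sr i = 0 -> forall i, t i = 0.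
Proof.
move=> t0 i; have := congr1 (fun a : form => app_form a (dual_vector i)) t0.
rewrite app_form_suml (bigD1 i) //= app_formZl app_form_dual eqxx mulr1 big1.
  by rewrite addr0 => ->; rewrite /app_form mul0mx mxE.
by move=> j /negbTE ji; rewrite app_formZl app_form_dual eq_sym ji mulr0.
Qed.

Lemma reflectionE i x : reflection R D i *m x = x - app_form (sr i) x *: sc i.
Proof.
rewrite /reflection mulmxBl mul1mx -mulmxA; congr (_ - _).
apply/colP => k; rewrite [LHS]mxE big_ord1 [RHS]mxE mulrC /app_form.
by rewrite (ord1 ord0).
Qed.

Lemma reflectionK i x : reflection R D i *m (reflection R D i *m x) = x.
Proof.
rewrite !reflectionE app_formDr app_formNr app_formZr app_form_root_coroot.
rewrite (KM_diag (vd_matP D)) -addrA -opprD -scalerDl.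
have -> : forall t : R, t + (t - t * 2%:~R) = 0 by move=> t; ring.
by rewrite scale0r subr0.
Qed.

Lemma reflection2 i : reflection R D i *m reflection R D i = 1%:M.
Proof.
apply/matrixP => j k.
have := congr1 (fun y : 'cV_n => y j ord0) (reflectionK i (delta_mx k ord0)).
by rewrite mulmxA -colE !mxE andbT => <-.
Qed.

Lemma reflection_unit i : reflection R D i \in unitmx.
Proof. by case: (mulmx1_unit (reflection2 i)). Qed.

Lemma Wv_unit (w : 'M[R]_n) : Wv R D w -> w \in unitmx.
Proof.
elim=> [i||v u _ vu _ uu|u _ uu]; [exact: reflection_unit|exact: unitmx1| |].
  by rewrite unitmx_mul vu uu.
by rewrite unitmx_inv.
Qed.

Lemma Wv1 : Wv R D 1%:M. Proof. exact: Weyl_one. Qed.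

Lemma Wv_mul (v w : 'M[R]_n) : Wv R D v -> Wv R D w -> Wv R D (v *m w).
Proof. exact: Weyl_mul. Qed.

Lemma Wv_inv (w : 'M[R]_n) : Wv R D w -> Wv R D (invmx w).
Proof. exact: Weyl_inv. Qed.

Lemma Wv_reflection i : Wv R D (reflection R D i).
Proof. exact: Weyl_refl. Qed.

Lemma Wv_ind (P : 'M[R]_n -> Prop) :
  (forall i, P (reflection R D i)) -> P 1%:M ->
  (forall u w, Wv R D u -> Wv R D w -> P u -> P w -> P (u *m w)) ->
  (forall w, Wv R D w -> P w -> P (invmx w)) ->
  forall w, Wv R D w -> P w.
Proof.
by move=> Pr P1 PM Pi w; elim=> *; [exact: Pr|exact: P1|exact: PM|exact: Pi].
Qed.

End Forms.

Section Roots.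
Variables (R : realType) (I : finType) (D : vectorial_datum I).
Variable g : Kac_Moody_algebra R[i] (vd_mat D).
Local Notation n := (vd_rank D).
Local Notation form := (model_form R D).
Local Notation pt := (model R D).
Local Notation sr := (@simple_root R I D).
Local Notation sc := (@simple_coroot R I D).
Local Notation c := (vd_mat D).
Local Notation Delta := (Delta g).
Implicit Types (a b : form) (x y v : pt) (m : {ffun I -> int}).

Lemma complex_int_eq0 (z : int) : z%:~R = 0 :> R[i] -> z = 0.
Proof. by move/eqP; rewrite intr_eq0 => /eqP. Qed.
Let intK := complex_int_eq0.
Let cP := vd_matP D.

Definition root_form m : form := \sum_i (m i)%:~R *: sr i.

Lemma app_root_form m x :
  app_form (root_form m) x = \sum_i (m i)%:~R * app_form (sr i) x.
Proof. by rewrite app_form_suml; under eq_bigr do rewrite app_formZl. Qed.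

Lemma root_formN m : root_form (- m) = - root_form m.
Proof.
rewrite /root_form -sumrN; apply: eq_bigr => i _.
by rewrite ffunE rmorphN scaleNr.
Qed.

Lemma root_form_inj : injective root_form.
Proof.
move=> m m' mm; apply/ffunP => i; apply/eqP; rewrite -subr_eq0 -(intr_eq0 R).
have := congr1 (fun a : form => app_form a (dual_vector R D i)) mm.
rewrite !app_root_form => e; rewrite rmorphB subr_eq0 /=; apply/eqP.
have E m0 : \sum_j (m0 j)%:~R * app_form (sr j) (dual_vector R D i) = (m0 i)%:~R.
  rewrite (bigD1 i) //= app_form_dual eqxx mulr1 big1 ?addr0 // => j /negbTE ji.
  by rewrite app_form_dual eq_sym ji mulr0.
by rewrite -!E.
Qed.

Lemma root_form_deg i : root_form (deg i) = sr i.
Proof.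
rewrite /root_form (bigD1 i) //= ffunE eqxx scale1r big1 ?addr0 // => j /negbTE ji.
by rewrite ffunE ji scale0r.
Qed.

Lemma root_form_reflection m i :
  root_form m *m reflection R D i = root_form (refl_deg c i m).
Proof.
apply: form_ext => x; rewrite app_form_mul reflectionE app_formDr app_formNr app_formZr.
have -> : app_form (root_form m) (sc i) = (pairing c m i)%:~R.
  rewrite app_root_form /pairing rmorph_sum; apply: eq_bigr => j _.
  by rewrite rmorphM app_form_root_coroot.
rewrite !app_root_form [X in X - _](bigD1 i) //= [RHS](bigD1 i) //= refl_degE eqxx.
rewrite [in RHS](eq_bigr (fun j => (m j)%:~R * app_form (sr j) x)); last first.
  by move=> j /negbTE ji; rewrite refl_degE ji subr0.
by rewrite intrB; ring.
Qed.

Lemma DeltaP a : Delta a <-> exists2 m, is_root g m & a = root_form m.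
Proof.
split=> [[m rm ->]|[m rm ->]]; last by exists m.
exists [ffun i => m i].
  by rewrite /is_root (_ : ([ffun i => m i] : I -> int) = m) //; apply/funext => i; rewrite ffunE.
by apply: eq_bigr => i _; rewrite ffunE.
Qed.

Lemma Delta_opp a : Delta a -> Delta (- a).
Proof.
move=> /DeltaP[m rm ->]; apply/DeltaP; exists (- m); last by rewrite root_formN.
exact: root_opp.
Qed.

Lemma Delta_Wv (w : 'M[R]_n) : Wv R D w -> forall a, Delta (a *m w) <-> Delta a.
Proof.
elim/Wv_ind=> [i|a|u v _ _ hu hv a|{}w ww hw a].
- have refl a : Delta a -> Delta (a *m reflection R D i).
    move=> /DeltaP[m rm ->]; apply/DeltaP; exists (refl_deg c i m).
      exact: root_reflect.
    exact: root_form_reflection.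
  move=> a; split; last exact: refl.
  by move=> /refl; rewrite -mulmxA reflection2 mulmx1.
- by rewrite mulmx1.
- by rewrite mulmxA hv hu.
- by rewrite -hw -mulmxA mulVmx ?mulmx1 // Wv_unit.
Qed.

Definition Dpos a := exists m, [/\ is_root g m, deg_pos m & a = root_form m].

Lemma Dpos_Delta a : Dpos a -> Delta a.
Proof. by case=> m [rm _ ->]; apply/DeltaP; exists m. Qed.

Lemma Delta_sign a : Delta a -> Dpos a \/ Dpos (- a).
Proof.
move=> /DeltaP[m rm ->]; have [mp|mn] := root_sign intK rm; [left|right].
  by exists m.
by exists (- m); split=> //; [apply: root_opp|rewrite root_formN].
Qed.

Lemma Dpos_opp a : Dpos a -> ~ Dpos (- a).
Proof.
move=> [m [rm mp ->]] [m' [rm' mp']]; rewrite -root_formN => /root_form_inj mm.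
by have := deg_posN mp; rewrite mm mp'.
Qed.

Lemma Dpos_simple i : Dpos (sr i).
Proof.
by exists (deg i); split; [apply: root_deg|apply: deg_pos_deg|rewrite root_form_deg].
Qed.

Lemma Dpos_mono a x y : Dpos a ->
  (forall i, app_form (sr i) x <= app_form (sr i) y) ->
  app_form a x <= app_form a y.
Proof.
move=> [m [_ /deg_posP[_ mp] ->]] xy; rewrite !app_root_form.
by apply: ler_sum => i _; apply: ler_wpM2l => //; rewrite ler0z.
Qed.

Lemma Dpos_ge0 a v : Dpos a -> (forall i, 0 <= app_form (sr i) v) ->
  0 <= app_form a v.
Proof.
move=> pa v0; have e0 b : app_form b (0 : pt) = 0 by rewrite /app_form mulmx0 mxE.
rewrite -(e0 a); apply: Dpos_mono => // i.
by rewrite e0.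
Qed.

Lemma Dpos_gt0 a v : Dpos a -> fundamental_chamber v -> 0 < app_form a v.
Proof.
move=> [m [_ /deg_posP[m0 mp] ->]] vC; rewrite app_root_form.
have [i mi] : exists i, m i != 0.
  apply: contrapT => nex; apply: m0; apply/ffunP => i; rewrite ffunE.
  by apply/eqP/negPn/negP => mi; apply: nex; exists i.
rewrite (bigD1 i) //= ltr_pwDl //.
  by apply: mulr_gt0 (vC i); rewrite ltr0z lt0r mi mp.
by apply: sumr_ge0 => j _; apply: mulr_ge0 (ltW (vC j)); rewrite ler0z.
Qed.

Lemma Dpos_eq0 a v x : Dpos a -> (forall i, 0 <= app_form (sr i) v) ->
  (forall i, app_form (sr i) v = 0 -> app_form (sr i) x = 0) ->
  app_form a v = 0 -> app_form a x = 0.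
Proof.
move=> [m [_ /deg_posP[m0 mp] ->]] v0 vx; rewrite !app_root_form => /eqP.
rewrite psumr_eq0; last by move=> i _; rewrite mulr_ge0 ?ler0z.
move=> /allP al; rewrite big1 // => i _.
have := al i (mem_index_enum _); rewrite mulf_eq0 => /orP[/eqP ->|/eqP/vx ->].
  by rewrite mul0r.
by rewrite mulr0.
Qed.

(** Each coordinate of such a root lies between 0 and [B / app_form (sr i) v], so these roots fit in
    a finite box. *)
Lemma Dpos_bounded_finite v (B : R) : fundamental_chamber v ->
  finite_set [set a | Dpos a /\ app_form a v <= B].
Proof.
move=> vC; pose N := (\max_i `|Num.ceil (B / app_form (sr i) v)|)%N.
pose P : set {ffun I -> 'I_N.+1} := setT.
apply: (@sub_finite_set _ _ ((fun k : {ffun I -> 'I_N.+1} =>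
    root_form [ffun i => (nat_of_ord (k i))%:Z]) @` P)); last first.
  by apply: finite_image; exact: finite_finset.
move=> _ [[m [_ /deg_posP[_ mp] ->]] mB].
have mN i : (`|m i| < N.+1)%N.
  rewrite ltnS; apply: leq_trans (leq_bigmax i) => /=.
  have mi : (m i)%:~R <= B / app_form (sr i) v.
    rewrite ler_pdivlMr //; apply: le_trans mB; rewrite app_root_form (bigD1 i) //=.
    by rewrite lerDl sumr_ge0 // => j _; rewrite mulr_ge0 ?ler0z // ltW.
  have : m i <= Num.ceil (B / app_form (sr i) v).
    by rewrite -(ler_int R); apply: le_trans mi (ceil_ge _).
  by have := mp i; lia.
exists [ffun i => Ordinal (mN i)] => //; congr root_form.
by apply/ffunP => i; rewrite !ffunE /=; have := mp i; lia.
Qed.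

(** A simple reflection inverts only its own root, and the inversions of a product u v are among
    those of u and the translates by the inverse of u of those of v. *)
Lemma inversions_finite (w : 'M[R]_n) : Wv R D w ->
  finite_set [set a | Dpos a /\ Dpos (- (a *m w))].
Proof.
have sgn a (u : 'M[R]_n) : Wv R D u -> Dpos a -> Dpos (a *m u) \/ Dpos (- (a *m u)).
  by move=> wu pa; apply: Delta_sign; apply/Delta_Wv => //; apply: Dpos_Delta.
elim/Wv_ind=> [i||u v wu wv fu fv|{}w ww fw].
- apply: (@sub_finite_set _ _ [set sr i]); last exact: finite_set1.
  move=> _ [[m [rm /deg_posP[m0 mp] ->]]]; rewrite root_form_reflection -root_formN.
  move=> [m' [_ /deg_posP[_ mp'] /root_form_inj em]].
  (* The reflection does not change the j-th coordinate, which is nonnegative both in the root and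
     in the opposite of its image. *)
  have mz j : j != i -> m j = 0.
    move=> /negbTE ji; have := mp' j; have := mp j.
    by rewrite -em ffunE refl_degE ji subr0; lia.
  have [->|mi] := root_rank1 intK rm mz; first by rewrite /= root_form_deg.
  by have := mp i; rewrite mi !ffunE eqxx.
- rewrite (_ : [set _ | _] = set0) // -subset0 => a [pa].
  by rewrite mulmx1 => /(Dpos_opp pa).
- apply: (@sub_finite_set _ _ ([set a | Dpos a /\ Dpos (- (a *m u))]
    `|` ((fun a => a *m invmx u) @` [set a | Dpos a /\ Dpos (- (a *m v))]))).
    move=> a [pa pauv]; have [pu|nu] := sgn a u wu pa; last by left.
    right; exists (a *m u); first by split; rewrite // -mulmxA.
    by rewrite -mulmxA mulmxV ?mulmx1 // Wv_unit.
  by rewrite finite_setU; split=> //; apply: finite_image.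
- apply: (@sub_finite_set _ _
    ((fun a => - (a *m w)) @` [set a | Dpos a /\ Dpos (- (a *m w))])).
    move=> a [pa na]; exists (- (a *m invmx w)).
      by split=> //; rewrite mulNmx opprK -mulmxA mulVmx ?mulmx1 // Wv_unit.
    by rewrite mulNmx opprK -mulmxA mulVmx ?mulmx1 // Wv_unit.
  exact: finite_image.
Qed.

Lemma Delta_coroot_lattice a (b : pt) : Delta a -> coroot_lattice b ->
  exists k : int, app_form a b = k%:~R.
Proof.
move=> /DeltaP[m _ ->] [p ->].
exists (\sum_i p i * pairing c m i); rewrite app_form_sumr rmorph_sum.
apply: eq_bigr => i _; rewrite app_formZr rmorphM app_root_form; congr (_ * _).
rewrite /pairing rmorph_sum; apply: eq_bigr => j _.
by rewrite rmorphM app_form_root_coroot.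
Qed.

(** A point of the fundamental face of type {i}. The next vector lies in the fundamental chamber,
    and the value of a root on it is its height. *)
Definition wall_vector i : pt := vector_of D (fun j => (j != i)%:R).
Definition chamber_vector : pt := vector_of D (fun=> 1).

Lemma app_chamber_vector i : app_form (sr i) chamber_vector = 1.
Proof. exact: app_form_vector_of. Qed.

Lemma app_wall_vector i j : app_form (sr j) (wall_vector i) = (j != i)%:R.
Proof. exact: app_form_vector_of. Qed.

(* As r_i permutes the positive roots other than alpha_i, the coefficient of
   alpha_i in such a root is controlled by the other coefficients.           *)
Lemma Dpos_wall_vector i : exists2 C : R, 0 < C & forall a, Dpos a -> a <> sr i ->
  app_form a chamber_vector <= C * app_form a (wall_vector i).
Proof.
(* The sum bounds the i-th coordinate by the other coordinates, and the summand 1 accounts for these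
   in the height. *)
pose C : R := 1 + \sum_j `|(c i j)%:~R|; exists C.
  by rewrite ltr_pwDl // sumr_ge0.
move=> _ [m [rm /deg_posP[m0 mp] ->]] mi.
(* Some positive coordinate j is untouched by the reflection, so the reflected root is positive by
   sign coherence; its i-th coordinate being nonnegative is the inequality sought. *)
have [mi' mj] : deg_pos (refl_deg c i m) /\ exists2 j, j != i & m j != 0.
  have [j ji mj] : exists2 j, j != i & m j != 0.
    apply: contrapT => nex; have mz j : j != i -> m j = 0.
      by move=> ji; apply/eqP/negPn/negP => mj; apply: nex; exists j.
    have [e|e] := root_rank1 intK rm mz; first by apply: mi; rewrite e root_form_deg.
    by have := mp i; rewrite e !ffunE eqxx.
  split; last by exists j.
  have [//|/deg_posP[_ /(_ j)]] := root_sign intK (root_reflect cP intK i rm).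
  rewrite ffunE refl_degE (negbTE ji) subr0 oppr_ge0 => mj0.
  by have := mp j; case/eqP: mj; apply/le_anti; rewrite mj0 mp.
have /deg_posP[_ /(_ i)] := mi'.
rewrite refl_degE eqxx subr_ge0 /pairing (bigD1 i) //= (KM_diag cP) => mi2.
have {}mi2 : (m i)%:~R <= \sum_(j | j != i) (m j)%:~R * - (c i j)%:~R :> R.
  have : m i <= \sum_(j | j != i) m j * - c i j.
    under eq_bigr do rewrite mulrN; rewrite sumrN; move: mi2.
    by move: (\sum_(j | j != i) m j * c i j) => S; lia.
  rewrite -(ler_int R) rmorph_sum => h; apply: (le_trans h).
  by rewrite le_eqVlt; apply/orP; left; apply/eqP; apply: eq_bigr => j _; rewrite rmorphM rmorphN.
rewrite !app_root_form (bigD1 i) //= app_chamber_vector mulr1.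
rewrite [X in C * X](bigD1 i) //= app_wall_vector eqxx mulr0 add0r.
rewrite [X in C * X](eq_bigr (fun j => (m j)%:~R)); last first.
  by move=> j ji; rewrite app_wall_vector ji mulr1.
rewrite [X in _ + X](eq_bigr (fun j => (m j)%:~R)); last first.
  by move=> j ji; rewrite app_chamber_vector mulr1.
rewrite /C mulrDl mul1r [X in _ <= X]addrC lerD2r; apply: (le_trans mi2).
rewrite mulr_sumr; apply: ler_sum => j ji; rewrite mulrC.
apply: ler_wpM2r; first by rewrite ler0z.
rewrite (bigD1 j) //=; apply: (@le_trans _ _ `|(c i j)%:~R|).
  by rewrite -normrN ler_norm.
by rewrite lerDl sumr_ge0.
Qed.

End Roots.

(** * Finitely many real roots force a finite Weyl group *)

Section InfiniteWeylGroup.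
Variables (R : realType) (I : finType) (D : vectorial_datum I).
Variable g : Kac_Moody_algebra R[i] (vd_mat D).
Local Notation n := (vd_rank D).
Local Notation form := (model_form R D).
Local Notation pt := (model R D).
Local Notation sr := (@simple_root R I D).
Local Notation sc := (@simple_coroot R I D).
Local Notation refl := (@reflection R I D).
Implicit Types (a : form) (x y z : pt).

Lemma real_root_Delta a : real_root a -> Delta g a.
Proof.
move=> [w [i [ww ->]]]; apply/Delta_Wv; first exact: Wv_inv.
exact/Dpos_Delta/Dpos_simple.
Qed.

Lemma real_root_refl a i : real_root a -> real_root (a *m refl i : form).
Proof.
move=> [w [j [ww ->]]]; exists (refl i *m w), j; split.
  by apply: Wv_mul => //; apply: Wv_reflection.
have uw := Wv_unit ww; have ur := reflection_unit R D i.
have urw : refl i *m w \in unitmx by rewrite unitmx_mul ur.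
rewrite -mulmxA; congr (_ *m _); apply: (can_inj (mulmxK urw)).
by rewrite mulVmx // -mulmxA (mulmxA (refl i)) reflection2 mul1mx mulVmx.
Qed.

Lemma Wv_sub_coroots (w : 'M[R]_n) : Wv R D w ->
  forall x, exists t : I -> R, w *m x - x = \sum_i t i *: sc i.
Proof.
elim/Wv_ind=> [i x|x|u v _ _ hu hv x|{}w ww hw x].
- exists (fun j => if j == i then - app_form (sr i) x else 0).
  rewrite reflectionE (bigD1 i) //= eqxx big1 => [|j /negbTE ->]; last by rewrite scale0r.
  by rewrite addr0 scaleNr addrC addKr.
- by exists (fun=> 0); rewrite mul1mx subrr big1 // => i _; rewrite scale0r.
- have [t et] := hv x; have [t' et'] := hu (v *m x).
  exists (fun i => t' i + t i); under eq_bigr do rewrite scalerDl.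
  by rewrite big_split /= -et -et' mulmxA addrA subrK.
- have [t et] := hw (invmx w *m x); exists (fun i => - t i).
  under eq_bigr do rewrite scaleNr; rewrite sumrN -et mulmxA mulmxV ?Wv_unit //.
  by rewrite mul1mx opprB.
Qed.

Section FiniteRoots.
Variable s : seq form.
Hypotheses (us : uniq s) (sP : forall a, a \in s <-> real_root a).

(* A W-invariant semidefinite form; it makes the matrix symmetrizable, and its
   radical meets the span of the coroots trivially.                          *)
Let B x y : R := \sum_(a <- s) app_form a x * app_form a y.

Let BDl x y z : B (x + y) z = B x z + B y z.
Proof. by rewrite -big_split; apply: eq_bigr => a _; rewrite app_formDr mulrDl. Qed.

Let BZl t x z : B (t *: x) z = t * B x z.
Proof. by rewrite mulr_sumr; apply: eq_bigr => a _; rewrite app_formZr mulrA. Qed.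

Let BC x y : B x y = B y x.
Proof. by apply: eq_bigr => a _; rewrite mulrC. Qed.

Let B_refl i x y : B (refl i *m x) (refl i *m y) = B x y.
Proof.
rewrite /B; under eq_bigr do rewrite -!app_form_mul.
rewrite -(big_map (fun a => a *m refl i) predT (fun a => app_form a x * app_form a y)).
have inv : injective (fun a : form => a *m refl i).
  by apply: (can_inj (g := fun a => a *m refl i)) => a; rewrite -mulmxA reflection2 mulmx1.
apply: perm_big; apply: uniq_perm => //; first by rewrite map_inj_uniq.
move=> a; apply/mapP/idP => [[b /sP rb ->]|/sP ra]; first exact/sP/real_root_refl.
by exists (a *m refl i); [apply/sP/real_root_refl|rewrite -mulmxA reflection2 mulmx1].
Qed.

Let B_coroot i y : 2 * B (sc i) y = app_form (sr i) y * B (sc i) (sc i).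
Proof.
have rc : refl i *m sc i = -1 *: sc i.
  rewrite reflectionE app_form_root_coroot (KM_diag (vd_matP D)).
  by rewrite -[X in X - _]scale1r -scalerBl; congr (_ *: _); ring.
have := B_refl i (sc i) y; rewrite rc reflectionE BZl BC BDl -scaleNr BZl BC.
rewrite [B (sc i) (sc i)]lock; lra.
Qed.

(** The vector w x - x is a combination of coroots on which all roots vanish, so it is in the
    radical of [B]. Through [B_coroot] this becomes a linear relation between simple roots, with
    coefficients [t i * B (sc i) (sc i)]; the second factor is positive because alpha_i itself
    contributes to it. *)
Lemma Wv_fix_roots (w : 'M[R]_n) : Wv R D w ->
  (forall i, sr i *m w = sr i) -> w = 1%:M.
Proof.
move=> ww fw.
suff fx x : w *m x = x.
  apply/matrixP => j k; have := congr1 (fun y : 'cV_n => y j ord0) (fx (delta_mx k ord0)).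
  by rewrite -colE !mxE andbT.
apply/eqP; rewrite -subr_eq0; apply/eqP; have [t et] := Wv_sub_coroots ww x.
have z0 i : app_form (sr i) (w *m x - x) = 0.
  by rewrite app_formDr app_formNr -app_form_mul fw subrr.
have Bz y : B (w *m x - x) y = 0.
  rewrite /B big_seq big1 // => a /sP/real_root_Delta/DeltaP[m _ ->].
  by rewrite app_root_form big1 ?mul0r // => i _; rewrite z0 mulr0.
have tb : \sum_i (t i * B (sc i) (sc i)) *: sr i = 0.
  apply: form_ext => y; rewrite app_form_suml [RHS]/app_form mul0mx mxE.
  transitivity (2 * B (w *m x - x) y); last by rewrite Bz mulr0.
  rewrite et.
  have -> : B (\sum_i t i *: sc i) y = \sum_i t i * B (sc i) y.
    elim/big_ind2: _ => [|u v u' v' <- <-|i _]; [|exact: BDl|exact: BZl].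
    by rewrite -(scale0r 0) BZl mul0r.
  rewrite mulr_sumr; apply: eq_bigr => i _.
  by rewrite app_formZl mulrCA B_coroot; ring.
rewrite et big1 // => i _; have /eqP := simple_root_free tb i.
rewrite mulf_eq0 => /orP[/eqP ->|]; first by rewrite scale0r.
have si : sr i \in s.
  by apply/sP; exists 1%:M, i; split; [exact: Wv1|rewrite invmx1 mulmx1].
rewrite /B (big_rem _ si) /= app_form_root_coroot (KM_diag (vd_matP D)).
by rewrite gt_eqF // ltr_pwDl // sumr_ge0 // => a _; rewrite -expr2 sqr_ge0.
Qed.

End FiniteRoots.

(** By [Wv_fix_roots] an element of the Weyl group is determined by its images of the simple roots,
    for which there are finitely many choices. *)
Lemma Wv_finite : finite_set (@real_root R I D) -> finite_set (Wv R D).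
Proof.
move=> /finite_seqP[s0 rs]; pose s := undup s0.
have sP a : a \in s <-> real_root a by rewrite mem_undup rs.
have key (v w : 'M[R]_n) : Wv R D v -> Wv R D w ->
    (forall i, sr i *m invmx v = sr i *m invmx w) -> v = w.
  move=> wv ww vw; have uv := Wv_unit wv; have uw := Wv_unit ww.
  have /(_ (invmx v *m w)) := Wv_fix_roots (undup_uniq s0) sP.
  move=> /(_ (Wv_mul (Wv_inv wv) ww)) e.
  rewrite -[v]mulmx1 -e ?mulmxA ?mulmxV ?mul1mx // => i.
  by rewrite mulmxA vw -mulmxA mulVmx // mulmx1.
pose W_of (k : {ffun I -> 'I_(size s)}) := xget (1%:M : 'M[R]_n)
  [set w | Wv R D w /\ forall i, sr i *m invmx w = nth 0 s (k i)].
apply: (@sub_finite_set _ _ (W_of @` setT)); last exact/finite_image/finite_finset.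
move=> w ww.
have ws i : (index (sr i *m invmx w) s < size s)%N.
  by rewrite index_mem; apply/sP; exists w, i.
pose k := [ffun i => Ordinal (ws i)].
have wk : [set w | Wv R D w /\ forall i, sr i *m invmx w = nth 0 s (k i)] w.
  split=> // i; rewrite ffunE /= nth_index //; apply/sP.
  by exists w, i.
exists k => //; have [ww' wE'] := xgetPex 1%:M (ex_intro _ w wk).
apply: key => // i; rewrite wE'; by case: wk.
Qed.

Lemma Dpos_unbounded : infinite_set (Wv R D) -> forall B : R,
  exists2 a, real_root a & B < `|app_form a (chamber_vector R D)|.
Proof.
move=> winf B; apply: contrapT => nex; apply: winf; apply: Wv_finite.
have vC : fundamental_chamber (chamber_vector R D).
  by move=> i; rewrite app_chamber_vector.
pose S := [set a | Dpos g a /\ app_form a (chamber_vector R D) <= B].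
have fS : finite_set S by apply: Dpos_bounded_finite.
apply: (@sub_finite_set _ _ (S `|` (-%R @` S))).
  move=> a ra; have aB : `|app_form a (chamber_vector R D)| <= B.
    by rewrite leNgt; apply/negP => aB; apply: nex; exists a.
  have [pa|na] := Delta_sign (real_root_Delta ra).
    by left; split=> //; apply: le_trans aB; apply: ler_norm.
  right; exists (- a); last by rewrite opprK.
  by split=> //; apply: le_trans aB; rewrite app_formNl -normrN ler_norm.
by rewrite finite_setU; split=> //; apply: finite_image.
Qed.

Lemma Dpos_infinite : infinite_set (Wv R D) -> infinite_set (Dpos g).
Proof.
move=> winf fD; apply: winf; apply: Wv_finite.
apply: (@sub_finite_set _ _ (Dpos g `|` (-%R @` Dpos g))).
  move=> a /real_root_Delta/Delta_sign[pa|na]; first by left.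
  by right; exists (- a); rewrite ?opprK.
by rewrite finite_setU; split=> //; apply: finite_image.
Qed.

End InfiniteWeylGroup.

(** * Faces as germs of half-open enclosed sets along rays *)

Section Rays.
Variables (R : realType) (I : finType) (D : vectorial_datum I).
Variable g : Kac_Moody_algebra R[i] (vd_mat D).
Local Notation n := (vd_rank D).
Local Notation form := (model_form R D).
Local Notation pt := (model R D).
Local Notation sr := (@simple_root R I D).
Local Notation sc := (@simple_coroot R I D).
Local Notation refl := (@reflection R I D).
Local Notation H := (half_open_enclosed_set g).
Local Notation Dpos := (Dpos g).
Implicit Types (a : form) (x y v b : pt).

Lemma half_space_eq a y y' : app_form a y = app_form a y' ->
  forall k, half_space a k y <-> half_space a k y'.
Proof. by move=> e [k|] //=; rewrite e. Qed.

Lemma open_half_space_eq a y y' : app_form a y = app_form a y' ->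
  forall k, open_half_space a k y <-> open_half_space a k y'.
Proof. by move=> e [k|] //=; rewrite e. Qed.

Lemma nbhs_ray x v (O : set pt) : nbhs x O ->
  exists2 e : R, 0 < e & forall t : R, `|t| <= e -> O (x + t *: v).
Proof.
move=> Ox; have : (fun t : R => x + t *: v) @ (0 : R) --> x.
  rewrite -[X in _ --> X]addr0 -(scale0r v).
  by apply: cvgD; [exact: cvg_cst|apply: cvgZr_tmp; exact: cvg_id].
move=> /(_ _ Ox) /nbhs_ballP[e /= e0 eO]; exists (e / 2); first by rewrite divr_gt0.
move=> t te; apply: eO; rewrite /ball /= sub0r normrN (le_lt_trans te) //.
by rewrite gtr_pMr // invf_lt1 // ltr1n.
Qed.

(** A face seen through a single direction v of its vectorial face; [face_ray] shows that nothing is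
    lost. The bound e is common to all roots. *)
Definition ray_filter x v : set_system pt :=
  filter_from [set k | exists2 e : R, 0 < e &
    forall t, 0 < t <= e -> H k (x + t *: v)] H.

Lemma ray_filter_ray x v E : ray_filter x v E ->
  exists2 e : R, 0 < e & forall t, 0 < t <= e -> E (x + t *: v).
Proof. by move=> [k [e e0 ke] kE]; exists e => // t te; apply/kE/ke. Qed.

Lemma ray_filter_half_open x v k : ray_filter x v (H k) <->
  exists2 e : R, 0 < e & forall t, 0 < t <= e -> H k (x + t *: v).
Proof. by split=> [/ray_filter_ray|ke]; last exists k. Qed.

Lemma ray_filterS x v (E E' : set pt) :
  E `<=` E' -> ray_filter x v E -> ray_filter x v E'.
Proof. by move=> EE' [k ke kE]; exists k => //; apply: subset_trans EE'. Qed.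

Definition opt_min (k k' : option int) : option int :=
  match k, k' with
  | Some z, Some z' => Some (Order.min z z')
  | Some z, None => Some z
  | None, _ => k'
  end.

Lemma half_space_min a k k' :
  half_space a (opt_min k k') = half_space a k `&` half_space a k'.
Proof.
case: k k' => [z|] [z'|]; rewrite ?setTI ?setIT //; apply/seteqP; split=> y /=.
- have [zz|zz] := leP z z' => h; split=> //; apply: le_trans h _;
  by rewrite lerD2l ler_int // ltW.
- by move=> h; have [_|_] := leP z z'; case: h.
Qed.

Lemma open_half_space_min a k k' :
  open_half_space a (opt_min k k') = open_half_space a k `&` open_half_space a k'.
Proof.
case: k k' => [z|] [z'|]; rewrite ?setTI ?setIT //; apply/seteqP; split=> y /=.
- have [zz|zz] := leP z z' => h; split=> //; apply: lt_le_trans h _;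
  by rewrite lerD2l ler_int // ltW.
- by move=> h; have [_|_] := leP z z'; case: h.
Qed.

Lemma half_open_enclosed_setI k k' :
  H (fun a => opt_min (k.1 a) (k'.1 a), fun a => opt_min (k.2 a) (k'.2 a))
  = H k `&` H k'.
Proof.
apply/seteqP; split=> y.
  move=> ky; split=> a Da; have := ky a Da; rewrite /= half_space_min open_half_space_min;
  by move=> [[? ?] [? ?]].
move=> [ky ky'] a Da /=; rewrite half_space_min open_half_space_min.
by have [? ?] := ky a Da; have [? ?] := ky' a Da.
Qed.

Lemma ray_filterI x v (E E' : set pt) :
  ray_filter x v E -> ray_filter x v E' -> ray_filter x v (E `&` E').
Proof.
move=> [k [e e0 ke] kE] [k' [e' e0' ke'] kE'].
exists (fun a => opt_min (k.1 a) (k'.1 a), fun a => opt_min (k.2 a) (k'.2 a)).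
  exists (Order.min e e'); first by rewrite lt_min e0.
  move=> t /andP[t0]; rewrite le_min => /andP[te te'].
  by rewrite half_open_enclosed_setI; split; [apply: ke|apply: ke']; rewrite t0.
by rewrite half_open_enclosed_setI => y [/kE ? /kE' ?].
Qed.

Definition single_bound a z : form -> option int :=
  fun a' => if a' == a then Some z else None.

Lemma half_open_single a (z : int) : Delta g a -> H (single_bound a z, fun=> None) = half_space a (Some z).
Proof.
move=> Da; apply/seteqP; split=> y.
  by move=> /(_ a Da)[]; rewrite /= /single_bound eqxx.
by move=> ay b Db; rewrite /single_bound; split=> //=; case: eqP => // ->.
Qed.

Lemma enclosed_setE k : enclosed_set g k = H (k, fun=> None).
Proof.
by apply/seteqP; split=> y ky a Da; have := ky a Da; rewrite /= ?setIT //; case.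
Qed.

Lemma ray_half_space a x v z : Delta g a -> 
  (app_form a x + z%:~R > 0 \/ app_form a x + z%:~R = 0 /\ app_form a v >= 0) ->
  ray_filter x v (half_space a (Some z)).
Proof.
move=> Da h; rewrite -half_open_single //; apply/ray_filter_half_open.
rewrite half_open_single //; case: h => [h|[h v0]]; last first.
  exists 1 => // t /andP[t0 _]; rewrite /= app_formDr app_formZr.
  by rewrite addrAC h add0r mulr_ge0 // ltW.
have d0 : 0 < 1 + `|app_form a v| by rewrite ltr_pwDl.
exists ((app_form a x + z%:~R) / (1 + `|app_form a v|)); first by rewrite divr_gt0.
move=> t /andP[t0]; rewrite ler_pdivlMr // mulrDr mulr1 => tl.
rewrite /= app_formDr app_formZr addrAC.
have : - (t * app_form a v) <= t * `|app_form a v|.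
  by rewrite -mulrN ler_wpM2l ?(ltW t0) // -normrN ler_norm.
by move: tl; lra.
Qed.

Section Affine.
Variables (w : 'M[R]_n) (b : pt).
Hypotheses (ww : Wv R D w) (bQ : coroot_lattice b).

(** Pulls the bounds back along the affine map. At a root, [Num.floor] only reads as an [int] a
    value on the coroot lattice, which is already integral. *)
Definition shift (k : form -> option int) : form -> option int :=
  fun a => omap (fun z => z + Num.floor (app_form (a *m invmx w : form) b)) (k (a *m invmx w)).

Lemma preimage_half_open k : affine_map w b @^-1` (H k) = H (shift k.1, shift k.2).
Proof.
have Dw a : Delta g a -> Delta g (a *m invmx w).
  by move=> Da; apply/Delta_Wv => //; apply: Wv_inv.
have fl a z y : Delta g a -> app_form (a *m invmx w : form) (w *m y + b) + z%:~R =
    app_form a y + (z + Num.floor (app_form (a *m invmx w : form) b))%:~R.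
  move=> Da; rewrite app_formDr -app_form_mul -mulmxA mulVmx ?Wv_unit // mulmx1.
  have [p ->] := Delta_coroot_lattice (Dw a Da) bQ.
  by rewrite intrKfloor intrD [z%:~R + _]addrC addrA.
have hs a y o : Delta g a -> half_space (a *m invmx w) o (affine_map w b y) <->
    half_space a (omap (fun z => z + Num.floor (app_form (a *m invmx w : form) b)) o) y.
  by case: o => [z|] Da //=; rewrite fl.
have os a y o : Delta g a -> open_half_space (a *m invmx w) o (affine_map w b y) <->
    open_half_space a (omap (fun z => z + Num.floor (app_form (a *m invmx w : form) b)) o) y.
  by case: o => [z|] Da //=; rewrite fl.
apply/seteqP; split=> y Hy a Da.
  by have [h1 h2] := Hy _ (Dw a Da); split; [apply/hs|apply/os].
have Daw : Delta g (a *m w) by apply/Delta_Wv.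
have [h1 h2] := Hy _ Daw; move: h1 h2; rewrite /shift.
have -> : a = a *m w *m invmx w by rewrite -mulmxA mulmxV ?mulmx1 // Wv_unit.
by rewrite -[a *m w *m invmx w *m w]mulmxA mulVmx ?mulmx1 ?Wv_unit // => /hs h1 /os h2; split; [exact: h1|exact: h2].
Qed.

Lemma preimage_ray_filter x v E :
  ray_filter (affine_map w b x) (w *m v) E -> ray_filter x v (affine_map w b @^-1` E).
Proof.
move=> [k [e e0 ke] kE]; exists (shift k.1, shift k.2).
  exists e => // t te; rewrite -preimage_half_open /=.
  have := ke t te; rewrite /affine_map mulmxDr -scalemxAr addrAC.
  by [].
by rewrite -preimage_half_open => y /kE.
Qed.

End Affine.

Lemma coroot_lattice_Wv (w : 'M[R]_n) : Wv R D w ->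
  forall b, coroot_lattice (w *m b : pt) <-> coroot_lattice b.
Proof.
elim/Wv_ind=> [i|b|u v _ _ hu hv b|{}w ww hw b].
- have rf b : coroot_lattice b -> coroot_lattice (refl i *m b : pt).
    move=> [m ->]; exists (fun j => m j - (if j == i then \sum_j m j * vd_mat D j i else 0)).
    rewrite reflectionE app_form_sumr.
    under [RHS]eq_bigr do rewrite intrB scalerBl.
    rewrite sumrB; congr (_ - _); rewrite [RHS](bigD1 i) //= eqxx [X in _ = _ + X]big1 ?addr0.
      congr (_ *: _); rewrite rmorph_sum; apply: eq_bigr => j _.
      by rewrite app_formZr app_form_root_coroot rmorphM.
    by move=> j /negbTE ->; rewrite scale0r.
  by move=> b; split=> [/rf|/rf//]; rewrite mulmxA reflection2 mul1mx.
- by rewrite mul1mx.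
- by rewrite -mulmxA hu hv.
- by rewrite -hw mulmxA mulmxV ?mul1mx // Wv_unit.
Qed.

Lemma coroot_latticeN b : coroot_lattice b -> coroot_lattice (- b).
Proof.
move=> [m ->]; exists (fun i => - m i); rewrite -sumrN; apply: eq_bigr => i _.
by rewrite rmorphN scaleNr.
Qed.

Lemma affine_mapK (w : 'M[R]_n) b : w \in unitmx ->
  cancel (affine_map w b : pt -> pt) (affine_map (invmx w) (- (invmx w *m b))).
Proof. by move=> uw x; rewrite /affine_map mulmxDr mulmxA mulVmx // mul1mx addrK. Qed.

Lemma affine_mapVK (w : 'M[R]_n) b : w \in unitmx ->
  cancel (affine_map (invmx w) (- (invmx w *m b)) : pt -> pt) (affine_map w b).
Proof.
by move=> uw x; rewrite /affine_map mulmxDr mulmxN !mulmxA mulmxV // !mul1mx subrK.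
Qed.

Lemma image_ray_filter (w : 'M[R]_n) b x v : Wv R D w -> coroot_lattice b ->
  fmap (affine_map w b) (ray_filter x v) = ray_filter (affine_map w b x) (w *m v).
Proof.
move=> ww bQ; have uw := Wv_unit ww; have wi := Wv_inv ww.
have bQ' : coroot_lattice (- (invmx w *m b) : pt).
  by apply: coroot_latticeN; apply/coroot_lattice_Wv.
apply/seteqP; split=> E; rewrite /fmap /=; last exact: preimage_ray_filter.
move=> xE; have := @preimage_ray_filter _ _ wi bQ' (affine_map w b x) (w *m v)
  (affine_map w b @^-1` E).
rewrite affine_mapK // mulmxA mulVmx // mul1mx => /(_ xE).
by apply: ray_filterS => y; rewrite /= affine_mapVK.
Qed.

Section Faces.
Variable V : set pt.
Hypothesis faceV : vectorial_face V.

Lemma vectorial_face_scale t v : 0 < t -> V v -> V (t *: v).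
Proof.
have [w [J [ww VE]]] := faceV; move=> t0.
have FJ v' : fundamental_face J v' -> fundamental_face J (t *: v').
  move=> F i; have := F i; rewrite app_formZr; case: ifP => _; first by move=> ->; rewrite mulr0.
  by move=> ?; rewrite mulr_gt0.
by case: VE => -> [v' Fv' <-]; exists (t *: v'); rewrite -?scalemxAr -?scalerN //; apply: FJ.
Qed.

(** The factor t may depend on the root. On a vectorial face each root vanishes identically or keeps
    a strict sign, so the ratio of its values at y and v is positive, and it is bounded by the
    ratios at the finitely many simple roots outside J. *)
Lemma vectorial_face_near v (e : R) : 0 < e -> V v -> exists2 N : set pt, nbhs (0 : pt) N &
  forall y, N y -> V y -> forall a, Delta g a ->
    exists2 t : R, 0 < t <= e & app_form a y = t * app_form a v.
Proof.
move=> e0 Vv; have [w [J [ww VE]]] := faceV; have uw := Wv_unit ww.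
have key (v0 y0 : pt) a : fundamental_face J v0 -> fundamental_face J y0 ->
    (forall j, j \notin J -> app_form (sr j) y0 <= e * app_form (sr j) v0) -> Delta g a ->
    exists2 t : R, 0 < t <= e & app_form a y0 = t * app_form a v0.
  move=> Fv Fy yv; wlog pa : a / Dpos a.
    move=> wl /[dup] Da /Delta_sign[pa|na]; first exact: wl.
    have [|t te] := wl _ na; first exact: Dpos_Delta.
    by rewrite !app_formNl mulrN => /oppr_inj; exists t.
  move=> Da; have ge0 z i : fundamental_face J z -> 0 <= app_form (sr i) z.
    by move=> /(_ i); case: ifP => _ => [->|/ltW].
  have z0 z z' i : fundamental_face J z -> fundamental_face J z' ->
      app_form (sr i) z = 0 -> app_form (sr i) z' = 0.
    move=> /(_ i) + /(_ i); case: ifP => _ //.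
    by move=> h _ h'; rewrite h' ltxx in h.
  have [av0|av0] := eqVneq (app_form a v0) 0.
    exists e; first by rewrite e0 lexx.
    rewrite av0 mulr0; apply: Dpos_eq0 pa _ _ av0 => i; first exact: ge0.
    exact: z0.
  have avp : 0 < app_form a v0.
    by rewrite lt0r av0 (Dpos_ge0 pa) // => i; apply: ge0.
  have ayp : 0 < app_form a y0.
    rewrite lt0r (Dpos_ge0 pa) ?andbT; last by move=> i; apply: ge0.
    apply: contra_neq av0 => ay0; apply: Dpos_eq0 pa _ _ ay0 => i; first exact: ge0.
    exact: z0.
  exists (app_form a y0 / app_form a v0); last by rewrite divfK.
  rewrite divr_gt0 //= ler_pdivrMr // -app_formZr; apply: (Dpos_mono pa) => i.
  rewrite app_formZr; have [iJ|iJ] := boolP (i \in J); last exact: yv.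
  by have := Fy i; have := Fv i; rewrite iJ => -> ->; rewrite mulr0.
(* The sign s is 1 for a positive face and -1 for a negative one. *)
pose N (s : R) (v0 : pt) := [set y : pt | forall j, j \notin J ->
  app_form (sr j *m invmx w : form) y * s < e * app_form (sr j) v0].
have nbN s v0 : fundamental_face J v0 -> nbhs (0 : pt) (N s v0).
  move=> Fv; apply: (@filter_forall pt I (fun j => [set y | j \notin J ->
    app_form (sr j *m invmx w : form) y * s < e * app_form (sr j) v0])
    (nbhs (0 : pt)) (nbhs_filter _)) => j.
  have [jJ|jJ] := boolP (j \in J); first by apply: nearW.
  pose a : form := s *: (sr j *m invmx w); pose r := e * app_form (sr j) v0.
  have opa : open [set y : pt | app_form a y < r].
    have := @open_comp _ _ (app_form a : pt -> R) [set z | z < r].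
    by apply; [move=> y _; apply: continuous_app_form|exact: open_lt].
  have : nbhs (0 : pt) [set y : pt | app_form a y < r].
    apply: (open_nbhs_nbhs (conj opa _)).
    rewrite /= {1}/app_form mulmx0 mxE /r mulr_gt0 //.
    by have := Fv j; rewrite (negbTE jJ).
  apply: (@filterS _ _ (nbhs_filter _)) => y /=.
  by rewrite app_formZl mulrC => h _.
have wV (y : pt) : invmx w *m (w *m y) = y by rewrite mulmxA mulVmx // mul1mx.
case: VE Vv => -> [v0 Fv <-].
  exists (N 1 v0); first exact: nbN.
  move=> y Ny [y0 Fy ey] a Da; rewrite -{y}ey in Ny *; rewrite -!app_form_mul; apply: key => //.
    by move=> j jJ; have := Ny j jJ; rewrite mulr1 app_form_mul wV => /ltW.
  exact/Delta_Wv.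
exists (N (-1) v0); first exact: nbN.
move=> y Ny [y0 Fy ey] a Da; rewrite -{y}ey in Ny *; rewrite !app_formNr -!app_form_mul.
have [j jJ||t te ->] := key v0 y0 (a *m w) Fv Fy _ _.
- by have := Ny j jJ; rewrite mulrN1 app_formNr opprK app_form_mul wV => /ltW.
- exact/Delta_Wv.
by exists t; rewrite // mulrN.
Qed.

(** Conversely to the ray entering the face, a point x + y of the face near x satisfies, for each
    root, the inequalities of some point of the ray, by [vectorial_face_near]. *)
Lemma face_ray x v : V v -> face g x V = ray_filter x v.
Proof.
move=> Vv; congr filter_from; apply/seteqP; split=> k.
  move=> [N Nx OH]; have [e e0 eO] := nbhs_ray v Nx; exists e => // t /andP[t0 te].
  apply: OH; split; first by apply: eO; rewrite gtr0_norm.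
  by exists (t *: v) => //; apply: vectorial_face_scale.
move=> [e e0 ke]; have [N N0 NV] := vectorial_face_near e0 Vv.
exists [set y | N (y - x)].
  apply/(nbhs0P (V := 'cV[R]_n) [set y | N (y - x)] x).
  apply: (@filterS _ _ (nbhs_filter _)) N0 => y Ny.
  by rewrite /= addrC addKr.
move=> x' [/= Ny [y Vy ex']] a Da; move: Ny; rewrite -{x'}ex' addrC addKr => Ny.
have [t te ay] := NV y Ny Vy a Da.
have e1 : app_form a (x + y) = app_form a (x + t *: v).
  by rewrite !app_formDr app_formZr ay.
have [h1 h2] := ke t te a Da; split.
  by rewrite (half_space_eq e1).
by rewrite (open_half_space_eq e1).
Qed.

End Faces.

Definition face_dir v := exists2 V, vectorial_face V & V v.

Lemma is_faceP F : is_face g F <-> exists x v, face_dir v /\ F = ray_filter x v.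
Proof.
split=> [[x [V [fV ->]]]|[x [v [[V fV Vv] ->]]]]; last first.
  by exists x, V; split=> //; rewrite (face_ray fV x Vv).
have [v Vv] : exists v, V v.
  have [w [J [ww VE]]] := fV; pose v0 := vector_of D (fun i => (i \notin J)%:R : R).
  have Fv0 : fundamental_face J v0.
    by move=> i; rewrite /v0 app_form_vector_of; case: (i \in J) => /=; rewrite ?ltr01.
  by case: VE => ->; [exists (w *m v0)|exists (- (w *m v0))]; exists v0.
by exists x, v; split; [exists V|apply: face_ray].
Qed.

Lemma face_dir_Wv (w : 'M[R]_n) v : Wv R D w -> face_dir v -> face_dir (w *m v).
Proof.
move=> ww [V [u [J [wu VE]]] Vv].
case: VE Vv => -> [v0 Fv <-].
  exists [set (w *m u) *m y | y in fundamental_face J].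
    by exists (w *m u), J; split; [exact: Wv_mul|left].
  by exists v0; rewrite // mulmxA.
exists [set - ((w *m u) *m y) | y in fundamental_face J].
  by exists (w *m u), J; split; [exact: Wv_mul|right].
by exists v0; rewrite // mulmxN mulmxA.
Qed.

(** Up to sign v is w applied to a dominant vector, and the positive roots negative on such a vector
    are inversions of w. The two alternatives stand for the two signs of a face. *)
Lemma face_dir_finite v : face_dir v ->
  finite_set [set a | Dpos a /\ app_form a v < 0] \/
  finite_set [set a | Dpos a /\ app_form a (- v) < 0].
Proof.
move=> [V [w [J [ww VE]]] Vv].
suff fin (v0 : pt) : fundamental_face J v0 ->
    finite_set [set a | Dpos a /\ app_form a (w *m v0) < 0].
  case: VE Vv => -> [v0 Fv <-]; [left|right]; rewrite ?opprK; exact: fin.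
move=> Fv; apply: (@sub_finite_set _ _ _ _ (inversions_finite g ww)).
move=> a [pa]; rewrite -app_form_mul => aw; split=> //.
have [//|p] : Dpos (a *m w) \/ Dpos (- (a *m w)); last by [].
  by apply: Delta_sign; apply/Delta_Wv => //; apply: Dpos_Delta.
move=> p; have : 0 <= app_form (a *m w : form) v0; last by rewrite leNgt aw.
by apply: (Dpos_ge0 p) => i; have := Fv i; case: ifP => _ => [->|/ltW].
Qed.

Lemma chamber_dir v : fundamental_chamber v -> face_dir v.
Proof.
move=> vC; exists [set 1%:M *m y | y in fundamental_face finset.set0].
  by exists 1%:M, finset.set0; split; [exact: Wv1|left].
by exists v; rewrite ?mul1mx // => i; rewrite finset.inE.
Qed.

Lemma wall_dir i : face_dir (wall_vector R D i).
Proof.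
exists [set 1%:M *m y | y in fundamental_face (finset.set1 i)].
  by exists 1%:M, (finset.set1 i); split; [exact: Wv1|left].
exists (wall_vector R D i); rewrite ?mul1mx // => j.
by rewrite finset.inE app_wall_vector; case: eqP.
Qed.

End Rays.

(** * Chambers dominating a panel *)

Section LinearGerms.
Variable R : realType.
Implicit Types p q e t : R.

Lemma germ_ge0 p q e : 0 < e -> (forall t, 0 < t <= e -> 0 <= p + t * q) -> 0 <= p.
Proof.
move=> e0 h; rewrite leNgt; apply/negP => p0.
have d0 : 0 < 1 + `|q| by rewrite ltr_pwDl.
have m0 : 0 < Order.min e (- p / (2 * (1 + `|q|))).
  by rewrite lt_min e0 divr_gt0 ?mulr_gt0 // oppr_gt0.
have := h (Order.min e (- p / (2 * (1 + `|q|)))); rewrite m0 ge_min lexx => /(_ isT).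
set t := Order.min _ _ in m0 *.
have : t <= - p / (2 * (1 + `|q|)) by rewrite /t ge_min lexx orbT.
rewrite ler_pdivlMr ?mulr_gt0 // => ht.
have : t * q <= t * `|q| by rewrite ler_wpM2l ?(ltW m0) // ler_norm.
by move: ht; rewrite mulrCA mulrDr mulr1; lra.
Qed.

Lemma germ_gt0 p q : 0 < p \/ p = 0 /\ 0 < q ->
  exists2 e, 0 < e & forall t, 0 < t <= e -> 0 < p + t * q.
Proof.
case=> [p0|[-> q0]]; last by exists 1 => // t /andP[t0 _]; rewrite add0r mulr_gt0.
have d0 : 0 < 1 + `|q| by rewrite ltr_pwDl.
exists (p / (2 * (1 + `|q|))); first by rewrite divr_gt0 ?mulr_gt0.
move=> t /andP[t0]; rewrite ler_pdivlMr ?mulr_gt0 // => ht.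
have : - (t * q) <= t * `|q|.
  by rewrite -mulrN ler_wpM2l ?(ltW t0) // -normrN ler_norm.
by move: ht; rewrite mulrCA mulrDr mulr1; have := mulr_ge0 (ltW t0) (normr_ge0 q); lra.
Qed.

Lemma finite_common_germ (S : choiceType) (A : set S) (P : S -> R -> Prop) :
  finite_set A ->
  (forall a e t, P a e -> 0 < t <= e -> P a t) ->
  (forall a, A a -> exists2 e, 0 < e & P a e) ->
  exists2 e, 0 < e & forall a, A a -> P a e.
Proof.
move=> /finite_seqP[s ->] Pm; elim: s => [|a s IH] PA; first by exists 1.
have [e e0 Pe] := PA a (mem_head _ _).
have [|e' e0' Pe'] := IH; first by move=> b bs; apply: PA; rewrite /= inE bs orbT.
have m0 : 0 < Order.min e e' by rewrite lt_min e0.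
exists (Order.min e e') => // b; rewrite /= inE => /orP[/eqP ->|bs].
  by apply: Pm Pe _; rewrite m0 ge_min lexx.
by apply: Pm (Pe' b bs) _; rewrite m0 ge_min lexx orbT.
Qed.

End LinearGerms.

Section ChambersAtAPanel.
Variables (R : realType) (I : finType) (D : vectorial_datum I).
Variable g : Kac_Moody_algebra R[i] (vd_mat D).
Local Notation n := (vd_rank D).
Local Notation form := (model_form R D).
Local Notation pt := (model R D).
Local Notation sr := (@simple_root R I D).
Local Notation sc := (@simple_coroot R I D).
Local Notation refl := (@reflection R I D).
Local Notation H := (half_open_enclosed_set g).
Local Notation Dpos := (Dpos g).
Local Notation ray_filter := (ray_filter g).
Implicit Types (a : form) (x y v : pt).

Lemma open_half_space_sub a o y : open_half_space a o y -> half_space a o y.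
Proof. by case: o => [z|] //= /ltW. Qed.

Lemma app_ray a x v (t : R) : app_form a (x + t *: v) = app_form a x + t * app_form a v.
Proof. by rewrite app_formDr app_formZr. Qed.

Lemma half_space_limit a o x v (e : R) : 0 < e ->
  (forall t, 0 < t <= e -> half_space a o (x + t *: v)) -> half_space a o x.
Proof.
case: o => [z|] //= e0 h; apply: (germ_ge0 (q := app_form a v) e0) => t te.
by have := h t te; rewrite app_ray addrAC.
Qed.

Lemma ray_filter_dir (V : set pt) x v v' : vectorial_face V -> V v -> V v' ->
  ray_filter x v = ray_filter x v'.
Proof. by move=> fV Vv Vv'; rewrite -(face_ray g fV x Vv) -(face_ray g fV x Vv'). Qed.

(* Plays the role of the closure of [H k], which it contains; its preimages under
   the affine Weyl group are again of this form.                              *)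
Definition closed_hull k : set pt := H (k.1, fun=> None) `&` H (k.2, fun=> None).

Lemma closed_hullP k y : closed_hull k y <->
  forall a, Delta g a -> half_space a (k.1 a) y /\ half_space a (k.2 a) y.
Proof.
split=> [[h1 h2] a Da|h].
  by have [? _] := h1 a Da; have [? _] := h2 a Da.
by split=> a Da; have [? ?] := h a Da.
Qed.

Lemma closure_half_open k : closure (H k) `<=` closed_hull k.
Proof.
have cl a o : closed (half_space a o : set pt).
  case: o => [z|]; last exact: closedT.
  have -> : half_space a (Some z) = app_form a @^-1` [set r : R | - z%:~R <= r].
    by apply/seteqP; split=> y /=; lra.
  apply: closed_comp; last exact: closed_ge.
  by move=> y _; apply: continuous_app_form.
move=> y Hy; apply/closed_hullP => a Da; split.
  have /closure_id -> := cl a (k.1 a); apply: closure_subset Hy => y' h.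
  by have [] := h a Da.
have /closure_id -> := cl a (k.2 a); apply: closure_subset Hy => y' h.
by have [_ /open_half_space_sub] := h a Da.
Qed.

Definition weakly_dominates (P C : set_system pt) :=
  forall k, C (H k) -> P (closed_hull k).

(** What is retained of a chamber having full support; it excludes the faces contained in the wall,
    such as the panel itself. *)
Definition in_no_hyperplane (C : set_system pt) :=
  forall a (r : R), C [set y | app_form a y = r] -> a = 0.

Lemma preimage_closed_hull (w : 'M[R]_n) (b : pt) k :
  Wv R D w -> coroot_lattice b ->
  affine_map w b @^-1` closed_hull k = closed_hull (shift w b k.1, shift w b k.2).
Proof. by move=> ww bQ; rewrite /closed_hull preimage_setI !preimage_half_open. Qed.

Lemma weakly_dominates_image (w : 'M[R]_n) (b : pt) P C :
  Wv R D w -> coroot_lattice b -> weakly_dominates P C ->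
  weakly_dominates (fmap (affine_map w b) P) (fmap (affine_map w b) C).
Proof.
move=> ww bQ PC k; rewrite /fmap /= preimage_closed_hull //.
by rewrite preimage_half_open // => /PC.
Qed.

Lemma in_no_hyperplane_image (w : 'M[R]_n) (b : pt) C :
  w \in unitmx -> in_no_hyperplane C -> in_no_hyperplane (fmap (affine_map w b) C).
Proof.
move=> uw nC a r; rewrite /fmap /= => Ca.
suff : a *m w = 0 by move=> /(congr1 (mulmx^~ (invmx w))); rewrite mulmxK // mul0mx.
apply: (nC _ (r - app_form a b)); move: Ca; congr C; apply/seteqP; split=> y /=;
  rewrite app_formDr app_form_mul => /eqP; last by rewrite eq_sym subr_eq eq_sym => /eqP.
by rewrite eq_sym -subr_eq eq_sym => /eqP.
Qed.

Section Panel.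
Variables (i : I) (k0 : int) (x : pt).
Hypothesis xM : app_form (sr i) x + k0%:~R = 0.

Local Notation u := (wall_vector R D i).
Local Notation v := (chamber_vector R D).
Local Notation P0 := (ray_filter x u).
Local Notation Cp := (ray_filter x v).

Let vC : fundamental_chamber v.
Proof. by move=> j; rewrite app_chamber_vector. Qed.

Let Di : Delta g (sr i). Proof. exact/Dpos_Delta/Dpos_simple. Qed.

Let Delta_v a : Delta g a -> app_form a v != 0.
Proof.
move=> /Delta_sign[pa|na]; first by rewrite gt_eqF // (Dpos_gt0 pa).
by rewrite -oppr_eq0 -app_formNl gt_eqF // (Dpos_gt0 na).
Qed.

Section SamePositiveSide.
Variables x2 v2 : pt.
Local Notation C := (ray_filter x2 v2).
Hypothesis domC : weakly_dominates P0 C.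
Hypothesis sideC : exists2 e : R, 0 < e &
  forall t, 0 < t <= e -> 0 < app_form (sr i) (x2 + t *: v2) + k0%:~R.

(** Each bound met by C is shown to hold strictly on a common initial part of the ray from x along
    v. For a positive root the closed inequality at x suffices. For a negative root other than -
    alpha_i, domination gives room along u, and [Dpos_wall_vector] compares v with u. For - alpha_i
    the room comes from the side of C and integrality. *)
Lemma dominating_sub : C `<=` Cp.
Proof.
move=> E [k [e e0 ke] kE].
have [e1 e10 k1] : exists2 e1 : R, 0 < e1 & forall t, 0 < t <= e1 ->
    closed_hull k (x + t *: u).
  by apply: (@ray_filter_ray _ _ _ g); apply: domC; apply/ray_filter_half_open; exists e.
have [Cst C0 HC] := Dpos_wall_vector g i.
have [e3 e30 side] := sideC.
(* The first bound makes t times the height at most half of the room available at x + e1 u; the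
   second serves for - alpha_i, where the room is 1. *)
pose e2 := Order.min (e1 / (2 * Cst)) 2^-1.
have e20 : 0 < e2 by rewrite lt_min divr_gt0 ?mulr_gt0 // invr_gt0 ltr0n.
suff key a o : Delta g a ->
    (forall t, 0 < t <= e -> half_space a o (x2 + t *: v2)) ->
    (forall t, 0 < t <= e1 -> half_space a o (x + t *: u)) ->
    forall t, 0 < t <= e2 -> open_half_space a o (x + t *: v).
  apply: (ray_filterS kE); apply/ray_filter_half_open; exists e2 => // t te a Da.
  split; [apply: open_half_space_sub|]; apply: key te => // t' te'.
  - by have [] := ke t' te' a Da.
  - by have /closed_hullP/(_ a Da)[] := k1 t' te'.
  - by have [_ /open_half_space_sub] := ke t' te' a Da.
  - by have /closed_hullP/(_ a Da)[] := k1 t' te'.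
case: o => [z|] //= Da h2 h1 t /andP[t0]; rewrite le_min => /andP[t1 t2].
have h1x := half_space_limit (o := Some z) e10 h1.
have [pa|na] := Delta_sign Da.
  have := Dpos_gt0 pa vC; rewrite app_ray addrAC => av.
  by rewrite ltr_wpDl // mulr_gt0.
have [ai|ai] := eqVneq (- a) (sr i).
  have {}ai : a = - sr i by rewrite -ai opprK.
  pose t' := Order.min e e3.
  have t0' : 0 < t' by rewrite lt_min e0.
  have := h2 t'; rewrite t0' ge_min lexx => /(_ isT).
  have := side t'; rewrite t0' ge_min lexx orbT => /(_ isT).
  rewrite ai !app_formNl => h3 h4.
  (* C lies strictly on the positive side of the wall and inside the half-space, so the integral
     bound exceeds - k0, hence by at least 1. *)
  have zk : (- k0 < z)%R by rewrite -(ltr_int R) rmorphN; move: h3 h4; lra.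
  have {}zk : - k0%:~R + 1 <= z%:~R :> R.
    by rewrite -rmorphN -intrD1 ler_int; lia.
  rewrite app_ray app_chamber_vector mulr1; move: xM zk t2; lra.
have nai : - a <> sr i by apply/eqP.
have := HC _ na nai; have := Dpos_gt0 na vC.
have := h1 e1; rewrite e10 lexx => /(_ isT); rewrite !app_ray.
move: t1; rewrite ler_pdivlMr ?mulr_gt0 // !app_formNl => t1.
set au := app_form a u; set av := app_form a v => hx av0 avu.
have au0 : 0 < - au by rewrite -(pmulr_rgt0 _ C0); apply: lt_le_trans avu.
have s1 : t * - av <= t * (Cst * - au) by rewrite ler_wpM2l // ltW.
have s2 : (t * (2 * Cst)) * - au <= e1 * - au by rewrite ler_wpM2r // ltW.
have s3 : 0 < e1 * - au by rewrite mulr_gt0.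
have e4 : t * (2 * Cst) * - au = 2 * (t * (Cst * - au)) by ring.
by move: hx s1 s2 s3; rewrite e4; lra.
Qed.

End SamePositiveSide.

Section Converse.
Hypothesis Dinf : infinite_set Dpos.
Variables x2 v2 : pt.
Hypothesis dir2 : face_dir v2.
Local Notation C := (ray_filter x2 v2).
Hypothesis CCp : C `<=` Cp.

(** The half-space where a is at least the ceiling of a(x2) minus 1 has x2 in its interior, so it
    belongs to C, hence to Cp, and being closed it contains x. The 1 is the price of integral
    bounds. *)
Lemma chamber_no_separation a : Delta g a ->
  app_form a x2 <= app_form a x + 1.
Proof.
move=> Da; pose z := 1 - Num.ceil (app_form a x2).
have : ray_filter x2 v2 (half_space a (Some z)).
  apply: ray_half_space => //; left; rewrite /z rmorphB /=.
  by have := ceilB1_lt (app_form a x2); rewrite intrD /= ; lra.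
move=> /CCp/ray_filter_ray[e e0 he].
have := half_space_limit e0 he; rewrite /= /z rmorphB /=.
by have := ceil_ge (app_form a x2); lra.
Qed.

(** Otherwise the opposite closed half-space belongs to C, hence to Cp, and the ray from x along v
    stays in a hyperplane, although no root vanishes on v. The e obtained depends on the root. *)
Lemma chamber_half_space a o (e0 : R) : Delta g a -> 0 < e0 ->
  (forall t, 0 < t <= e0 -> half_space a o (x + t *: v)) ->
  exists2 e : R, 0 < e & forall t, 0 < t <= e -> open_half_space a o (x2 + t *: v2).
Proof.
case: o => [z|] Da e00 h /=; last by exists 1.
have [gt|ngt] := pselect (0 < app_form a x2 + z%:~R \/
   app_form a x2 + z%:~R = 0 /\ 0 < app_form a v2).
  have [e e1 he] := germ_gt0 gt; exists e => // t te.
  by rewrite app_ray addrAC he.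
have [] : False.
have : ray_filter x2 v2 (half_space (- a) (Some (- z))).
  apply: ray_half_space; first exact: Delta_opp.
  rewrite rmorphN /= !app_formNl.
  have [l|ge] := ltP (app_form a x2 + z%:~R) 0; first by left; lra.
  right; have e1 : app_form a x2 + z%:~R = 0.
    apply/eqP; rewrite eq_le ge andbT leNgt; apply/negP => gt; apply: ngt; by left.
  split; first by lra.
  by rewrite oppr_ge0 leNgt; apply/negP => gt; apply: ngt; right.
move=> /CCp/ray_filter_ray[e e1 he].
pose t := Order.min e e0.
have t0 : 0 < t by rewrite lt_min e1.
have te : t <= e by rewrite ge_min lexx.
have te0 : t <= e0 by rewrite ge_min lexx orbT.
have eq0 s : 0 < s <= t -> app_form a x + s * app_form a v + z%:~R = 0.
  move=> /andP[s0 st]; have := he s; rewrite s0 (le_trans st te) => /(_ isT).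
  have := h s; rewrite s0 (le_trans st te0) => /(_ isT) /=.
  by rewrite app_formNl rmorphN /= !app_ray; lra.
have := eq0 t; rewrite t0 lexx => /(_ isT).
have := eq0 (t / 2); rewrite divr_gt0 // ler_pdivrMr // mulr_natr mulr2n lerDl ltW //.
move=> /(_ isT) e2 e3; have /eqP := Delta_v Da; apply.
have : t / 2 * app_form a v = 0 by lra.
by move/eqP; rewrite mulf_eq0 gt_eqF ?divr_gt0 //= => /eqP.
Qed.

(* Otherwise v2 is of negative type, and an element of C bounds almost all the
   positive roots uniformly on a segment from x in the direction v.           *)
Lemma chamber_positive : finite_set [set a | Dpos a /\ app_form a v2 < 0].
Proof.
case: (face_dir_finite g dir2) => // fin; case: Dinf.
(* Only roots nonnegative on v2 are bounded, so one e works for all of them along v2. Read along v,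
   this bounds e times the height by 2: one unit from rounding, one from [chamber_no_separation]. *)
pose k : form -> option int := fun a =>
  if 0 <= app_form a v2 then Some (Num.ceil (- app_form a x2)) else None.
have : ray_filter x2 v2 (H (k, fun=> None)).
  apply/ray_filter_half_open; exists 1 => // t /andP[t0 _] a Da; split=> //=.
  rewrite /k; case: ifP => //= av; rewrite app_ray.
  have := ceil_ge (- app_form a x2); have := mulr_ge0 (ltW t0) av; lra.
move=> /CCp/ray_filter_ray[e e0 /(_ e)]; rewrite e0 lexx => /(_ isT) Hk.
apply: (@sub_finite_set _ _ ([set a | Dpos a /\ app_form a (- v2) < 0] `|`
   [set a | Dpos a /\ app_form a v <= 2 / e])); last first.
  by rewrite finite_setU; split=> //; apply: Dpos_bounded_finite.
move=> a pa; have [av|av] := ltP (app_form a (- v2)) 0; [by left|right; split=> //].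
have Da := Dpos_Delta pa; have [] := Hk _ (Delta_opp Da).
rewrite /= /k app_formNl -app_formNr av /= app_ray !app_formNl opprK.
have := chamber_no_separation Da; have := ceilB1_lt (app_form a x2).
rewrite rmorphB /= ler_pdivlMr // mulrN mulrC; lra.
Qed.

(** [chamber_half_space] settles finitely many roots at once. A root nonnegative on v2 keeps its
    inequality along the whole ray, and a negative root of large height has room proportional to its
    height, against which the unit lost by [chamber_no_separation] is negligible. *)
Lemma dominating_sup : Cp `<=` C.
Proof.
move=> E [k [e0 e00 ke] kE].
pose c2 : R := 1 + \sum_j `|app_form (sr j) v2|.
have c20 : 0 < c2 by rewrite ltr_pwDl // sumr_ge0.
have Hc2 a : Dpos a -> - app_form (- a) v2 <= c2 * app_form a v.
  move=> pa; rewrite app_formNl opprK -app_formZr; apply: (Dpos_mono pa) => j.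
  rewrite app_formZr app_chamber_vector mulr1 /c2 (bigD1 j) //=.
  have := ler_norm (app_form (sr j) v2).
  have : 0 <= \sum_(j0 | j0 != j) `|app_form (sr j0) v2| by rewrite sumr_ge0.
  lra.
(* Beyond height 2 / e0 the room e0 times the height exceeds 2, so more than half of it remains
   after losing 1. *)
pose F := [set a | Dpos a /\ app_form a v2 < 0] `|`
  (-%R @` [set a | Dpos a /\ app_form a v <= 2 / e0]).
have Ffin : finite_set F.
  rewrite finite_setU; split; first exact: chamber_positive.
  by apply: finite_image; apply: Dpos_bounded_finite.
pose P a (e : R) := Delta g a -> forall t, 0 < t <= e ->
  half_space a (k.1 a) (x2 + t *: v2) /\ open_half_space a (k.2 a) (x2 + t *: v2).
have h1 a t : Delta g a -> 0 < t <= e0 -> half_space a (k.1 a) (x + t *: v).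
  by move=> Da te; have [] := ke t te a Da.
have h2 a t : Delta g a -> 0 < t <= e0 -> half_space a (k.2 a) (x + t *: v).
  by move=> Da te; have [_ /open_half_space_sub] := ke t te a Da.
have [eF eF0 PF] : exists2 e : R, 0 < e & forall a, F a -> P a e.
  apply: finite_common_germ => // [a e t Pe /andP[t0 te] Da s /andP[s0 st]|a Fa].
    by apply: Pe => //; rewrite s0 (le_trans st).
  have [Da|nDa] := pselect (Delta g a); last by exists 1.
  have [s s0 hs] := chamber_half_space Da e00 (fun t => @h1 a t Da).
  have [s' s0' hs'] := chamber_half_space Da e00 (fun t => @h2 a t Da).
  exists (Order.min s s'); first by rewrite lt_min s0.
  move=> _ t /andP[t0]; rewrite le_min => /andP[ts ts'].
  by split; [apply/open_half_space_sub/hs|apply: hs']; rewrite t0.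
(* With |b(v2)| at most c2 times the height of b when b(v2) is positive, this step uses at most the
   remaining half of the room. *)
pose e := Order.min eF (e0 / (2 * c2)).
have e1 : 0 < e by rewrite lt_min eF0 divr_gt0 // mulr_gt0.
exists k => //; exists e => // t /andP[t0]; rewrite le_min => /andP[tF tc] a Da.
have [/PF Pa|nF] := pselect (F a); first by apply: Pa => //; rewrite t0.
suff key o : (forall t, 0 < t <= e0 -> half_space a o (x + t *: v)) ->
    open_half_space a o (x2 + t *: v2).
  by split; [apply: open_half_space_sub|]; apply: key => t' te; [apply: h1|apply: h2].
case: o => [z|] //= h.
have [av|av] := leP 0 (app_form a v2).
  have [s s0 hs] := chamber_half_space (o := Some z) Da e00 h.
  have p0 : 0 <= app_form a x2 + z%:~R.
    by apply: (half_space_limit (o := Some z) s0) => t' te'; apply/open_half_space_sub/hs.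
  have := hs s; rewrite s0 lexx => /(_ isT); rewrite /= !app_ray.
  move: av; rewrite le_eqVlt => /orP[/eqP <-|av]; first by rewrite !mulr0.
  by have := mulr_gt0 t0 av; lra.
have [pa|na] := Delta_sign Da; first by case: nF; left.
have nb : 2 / e0 < app_form (- a) v.
  by rewrite ltNge; apply/negP => l; apply: nF; right; exists (- a); rewrite ?opprK.
have := h e0; rewrite e00 lexx => /(_ isT).
have := chamber_no_separation (Delta_opp Da); have := Hc2 _ na.
move: nb tc; rewrite opprK ltr_pdivrMr // ler_pdivlMr ?mulr_gt0 // !app_ray !app_formNl.
set av' := app_form a v => nb tc hc hn he.
have s1 : t * - app_form a v2 <= t * (c2 * - av') by rewrite ler_wpM2l // ltW.
have av0 : 0 <= - av' by rewrite -app_formNl ltW // (Dpos_gt0 na).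
have s2 : t * (2 * c2) * - av' <= e0 * - av' by rewrite ler_wpM2r.
have e4 : t * (2 * c2) * - av' = 2 * (t * (c2 * - av')) by ring.
move: nb s1 s2 hn he; rewrite e4 mulrN [- av' * e0]mulrC; lra.
Qed.

End Converse.

Definition panel_reflection : pt -> pt := affine_map (refl i) (- k0%:~R *: sc i).
Local Notation s := panel_reflection.

Let sQ : coroot_lattice (- k0%:~R *: sc i : pt).
Proof.
exists (fun j => if j == i then - k0 else 0).
by rewrite (bigD1 i) //= eqxx big1 ?addr0 ?rmorphN // => j /negbTE ->; rewrite scale0r.
Qed.

Lemma panel_reflectionE y : s y = y - (app_form (sr i) y + k0%:~R) *: sc i.
Proof. by rewrite /s /affine_map reflectionE scalerDl scaleNr opprD addrA. Qed.

Lemma panel_reflection_fix y : app_form (sr i) y + k0%:~R = 0 -> s y = y.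
Proof. by rewrite panel_reflectionE => ->; rewrite scale0r subr0. Qed.

Lemma app_panel_reflection y : app_form (sr i) (s y) + k0%:~R = - (app_form (sr i) y + k0%:~R).
Proof.
rewrite panel_reflectionE app_formDr app_formNr app_formZr app_form_root_coroot.
by rewrite (KM_diag (vd_matP D)); ring.
Qed.

Lemma panel_reflectionK : involutive s.
Proof.
move=> y; rewrite panel_reflectionE app_panel_reflection panel_reflectionE.
by rewrite scaleNr opprK subrK.
Qed.

Lemma fmap_panel_reflectionK (F : set_system pt) : fmap s (fmap s F) = F.
Proof.
apply/funext => E; rewrite /fmap /=; congr F.
by apply/seteqP; split=> y /=; rewrite panel_reflectionK.
Qed.

Lemma panel_reflection_Wa : Wa R D s.
Proof. by exists (refl i), (- k0%:~R *: sc i); split; first exact: Wv_reflection. Qed.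

Lemma image_panel_reflection y w : fmap s (ray_filter y w) = ray_filter (s y) (refl i *m w).
Proof. by apply: image_ray_filter; [exact: Wv_reflection|]. Qed.

Lemma panel_hyperplane : P0 [set y | app_form (sr i) y + k0%:~R = 0].
Proof.
have ui : app_form (sr i) u = 0 by rewrite app_wall_vector eqxx.
have h1 : P0 (half_space (sr i) (Some k0)).
  by apply: ray_half_space => //; right; rewrite ui lexx.
have h2 : P0 (half_space (- sr i) (Some (- k0))).
  apply: ray_half_space; first exact: Delta_opp.
  by right; rewrite !app_formNl rmorphN ui oppr0 lexx -opprD xM oppr0.
apply: ray_filterS (ray_filterI h1 h2) => y [/=].
by rewrite app_formNl rmorphN /= -opprD oppr_ge0 => ? ?; apply/le_anti/andP.
Qed.

Lemma panel_reflection_panel : fmap s P0 = P0.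
Proof.
rewrite image_panel_reflection panel_reflection_fix // reflectionE.
by rewrite app_wall_vector eqxx scale0r subr0.
Qed.

(** The side of the wall is given by x2, or by v2 when x2 is on the wall; value zero for both would
    put the filter in the wall. The negative side is carried to the positive one by the panel
    reflection, which fixes the panel. *)
Lemma dominating_chamber (Dinf : infinite_set Dpos) x2 v2 :
  face_dir v2 -> weakly_dominates P0 (ray_filter x2 v2) ->
  in_no_hyperplane (ray_filter x2 v2) ->
  ray_filter x2 v2 = Cp \/ ray_filter x2 v2 = fmap s Cp.
Proof.
have pos y w : face_dir w -> weakly_dominates P0 (ray_filter y w) ->
    0 < app_form (sr i) y + k0%:~R \/
      app_form (sr i) y + k0%:~R = 0 /\ 0 < app_form (sr i) w ->
    ray_filter y w = Cp.
  move=> dw dom gt; have [e e0 he] := germ_gt0 gt.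
  have sub : ray_filter y w `<=` Cp.
    apply: dominating_sub => //; exists e => // t te.
    by rewrite app_ray addrAC he.
  by apply/seteqP; split=> //; apply: dominating_sup.
move=> d2 dom2 np2.
have [gt|] := ltP 0 (app_form (sr i) x2 + k0%:~R); first by left; apply: pos => //; left.
rewrite le_eqVlt => /orP[/eqP e0|lt0]; last first.
  right; rewrite -(pos (s x2) (refl i *m v2)); last 1 first.
  - by left; rewrite app_panel_reflection oppr_gt0.
  - by rewrite -image_panel_reflection fmap_panel_reflectionK.
  - by apply: face_dir_Wv => //; exact: Wv_reflection.
  rewrite -image_panel_reflection -panel_reflection_panel.
  by apply: weakly_dominates_image => //; exact: Wv_reflection.
have [gt|] := ltP 0 (app_form (sr i) v2); first by left; apply: pos => //; right.
rewrite le_eqVlt => /orP[/eqP v0|lt0].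
  have h1 : ray_filter x2 v2 (half_space (sr i) (Some k0)).
    by apply: ray_half_space => //; right; rewrite v0 lexx.
  have h2 : ray_filter x2 v2 (half_space (- sr i) (Some (- k0))).
    apply: ray_half_space; first exact: Delta_opp.
    by right; rewrite !app_formNl rmorphN v0 oppr0 lexx -opprD e0 oppr0.
  have : sr i = 0.
    apply: (np2 _ (- k0%:~R)); apply: ray_filterS (ray_filterI h1 h2) => y [/=].
    rewrite app_formNl rmorphN /= -opprD oppr_ge0 => ge le.
    by apply/eqP; rewrite -addr_eq0; apply/eqP/le_anti/andP.
  by move=> e1; have /eqP := Delta_v Di; rewrite e1 /app_form mul0mx mxE.
right; rewrite -(pos (s x2) (refl i *m v2)); last 1 first.
- right; rewrite app_panel_reflection e0 oppr0; split=> //.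
  rewrite reflectionE app_formDr app_formNr app_formZr app_form_root_coroot.
  by rewrite (KM_diag (vd_matP D)); lra.
- by rewrite -image_panel_reflection fmap_panel_reflectionK.
- by apply: face_dir_Wv => //; exact: Wv_reflection.
rewrite -image_panel_reflection -panel_reflection_panel.
by apply: weakly_dominates_image => //; exact: Wv_reflection.
Qed.

(** Replacing v by u lowers positive roots, so an inequality for a negative root persists; for a
    positive root it follows from its limit at x. *)
Lemma chamber_dominates : weakly_dominates P0 Cp.
Proof.
move=> k /ray_filter_ray[e e0 ke].
suff key a o : Delta g a -> (forall t, 0 < t <= e -> half_space a o (x + t *: v)) ->
    forall t, 0 < t <= e -> half_space a o (x + t *: u).
  by apply: ray_filterI; apply/ray_filter_half_open; exists e => // t te a Da; split=> //=;
    apply: (key) te => // t' te'; have [// h /open_half_space_sub] := ke t' te' a Da.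
have uv j : app_form (sr j) u <= app_form (sr j) v.
  by rewrite app_wall_vector app_chamber_vector; case: eqP => /=; rewrite ?ler01.
case: o => [z|] //= Da h t /andP[t0 te].
have [pa|na] := Delta_sign Da.
  have := half_space_limit (o := Some z) e0 h; rewrite /= app_ray addrAC => ax.
  rewrite addr_ge0 // mulr_ge0 ?(ltW t0) // (Dpos_ge0 pa) // => j.
  by rewrite app_wall_vector ler0n.
have := h t; rewrite t0 te => /(_ isT); rewrite !app_ray.
have := Dpos_mono na uv; rewrite !app_formNl lerN2 => /(ler_wpM2l (ltW t0)); lra.
Qed.

(* Half-open sets near the panel may miss the point x when x is on other walls. *)
Lemma panel_member_base :
  (forall a, Delta g a -> app_form a u != 0 -> forall z : int, app_form a x != z%:~R) ->
  forall E, P0 E -> E x.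
Proof.
move=> gen E [k [e e0 ke] kE]; apply: kE => a Da; split.
  by apply: (half_space_limit (v := u) e0) => t te; have [] := ke t te a Da.
case E2 : (k.2 a) => [z|] //=.
have ax : 0 <= app_form a x + z%:~R.
  apply: (half_space_limit (o := Some z) (v := u) e0) => t te.
  by have [_] := ke t te a Da; rewrite E2 => /ltW.
rewrite lt0r ax andbT; apply/eqP => ax0.
have [au|au] := eqVneq (app_form a u) 0.
  have := ke e; rewrite e0 lexx => /(_ isT a Da)[_]; rewrite E2 /= app_ray au mulr0 addr0.
  by rewrite ax0 ltxx.
by have /eqP := gen a Da au (- z); apply; rewrite rmorphN /=; lra.
Qed.

End Panel.

End ChambersAtAPanel.

(** * Generic points and density of walls *)

Section GenericPoints.
Variables (R : realType) (I : finType) (D : vectorial_datum I).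
Variable g : Kac_Moody_algebra R[i] (vd_mat D).
Local Notation n := (vd_rank D).
Local Notation form := (model_form R D).
Local Notation pt := (model R D).
Local Notation sr := (@simple_root R I D).
Local Notation ray_filter := (ray_filter g).
Local Notation v := (chamber_vector R D).
Local Notation u := (wall_vector R D).
Implicit Types (a : form) (x y : pt).

Lemma chamber_vectorC : fundamental_chamber v.
Proof. by move=> j; rewrite app_chamber_vector. Qed.

Lemma small_perturbation y (d : pt) : exists2 e : R, 0 < e &
  forall j, 0 < app_form (sr j) y -> 0 < app_form (sr j) (y + e *: d).
Proof.
pose P j (e : R) := forall t, 0 < t <= e -> 0 < app_form (sr j) y + t * app_form (sr j) d.
have [|||e e0 he] := @finite_common_germ R I [set j | 0 < app_form (sr j) y] P.
- exact: finite_finset.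
- move=> j e t Pe /andP[t0 te] s /andP[s0 st].
  by apply: Pe; rewrite s0 (le_trans st).
- by move=> j yj; apply: germ_gt0; left.
by exists e => // j yj; rewrite app_ray; apply: he => //; rewrite e0 lexx.
Qed.

(** The directions v and v + e d define the same filter, so a form constant on one of its elements
    has equal values at x + t v and x + t (v + e d), hence vanishes on d. *)
Lemma chamber_in_no_hyperplane x : in_no_hyperplane (ray_filter x v).
Proof.
move=> a r ar; apply: form_ext => d; rewrite [RHS]/app_form mul0mx mxE.
have [e e0 he] := small_perturbation v d.
have vC' : fundamental_chamber (v + e *: d) by move=> j; apply/he/chamber_vectorC.
pose V := [set 1%:M *m y | y in fundamental_face (R := R) (D := D) finset.set0].
have fV : vectorial_face V by exists 1%:M, finset.set0; split; [exact: Wv1|left].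
have inV (y : pt) : fundamental_chamber y -> V y.
  by move=> yC; exists y; rewrite ?mul1mx // => i; rewrite finset.inE.
have ar' : ray_filter x (v + e *: d) [set y | app_form a y = r].
  by rewrite (ray_filter_dir g x fV (inV _ vC') (inV _ chamber_vectorC)).
have [t1 t10 h1] := ray_filter_ray ar; have [t2 t20 h2] := ray_filter_ray ar'.
pose t := Order.min t1 t2; have t0 : 0 < t by rewrite lt_min t10.
have := h1 t; have := h2 t; rewrite t0 !ge_min !lexx orbT => /(_ isT) /= + /(_ isT) /=.
rewrite !app_ray => hh1 hh2.
have /eqP : t * (e * app_form a d) = 0 by lra.
by rewrite !mulf_eq0 (gt_eqF t0) (gt_eqF e0) /= => /eqP.
Qed.

Lemma app_lker a (d : pt) :
  (d \in lker (linfun (mulmx a : pt -> 'M[R]_(1, 1)))) = (app_form a d == 0).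
Proof.
rewrite memv_ker lfunE /= /app_form; apply/eqP/eqP => [->|e]; first by rewrite mxE.
by apply/matrixP => i j; rewrite (ord1 i) (ord1 j) e [RHS]mxE.
Qed.

Lemma is_chamber_in_no_hyperplane (C : set_system pt) :
  is_chamber g C -> in_no_hyperplane C.
Proof.
move=> [_ [p [V [[_ minC] pT]]]] a r ar.
have [//|a0] := eqVneq a 0.
have [w0 aw0] : exists w0 : pt, app_form a w0 = 1.
  apply: contrapT => nex; case/eqP: a0; apply: form_ext => d.
  rewrite [RHS]/app_form mul0mx mxE; apply: contrapT => /eqP ad; apply: nex.
  by exists ((app_form a d)^-1 *: d); rewrite app_formZr mulVf.
have := minC (r *: w0) (lker (linfun (mulmx a : pt -> 'M[R]_(1, 1)))).
have -> : affine_subspace (r *: w0) (lker (linfun (mulmx a : pt -> 'M[R]_(1, 1))))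
    = [set y | app_form a y = r].
  by apply/seteqP; split=> y; rewrite /affine_subspace /= app_lker app_formDr app_formNr
    app_formZr aw0 mulr1 subr_eq0 => /eqP.
rewrite pT => /(_ ar) all; apply: form_ext => d; rewrite [RHS]/app_form mul0mx mxE.
by have := all d Logic.I; have := all (2 *: d) Logic.I; rewrite /= app_formZr; lra.
Qed.

Lemma panel_is_panel i (k0 : int) x : app_form (sr i) x + k0%:~R = 0 ->
  is_panel g (ray_filter x (u i)).
Proof.
move=> xM; split; first by apply/is_faceP; exists x, (u i); split; first exact: wall_dir.
exists x, (lker (linfun (mulmx (sr i) : pt -> 'M[R]_(1, 1)))).
have eM : affine_subspace x (lker (linfun (mulmx (sr i) : pt -> 'M[R]_(1, 1))))
    = [set y | app_form (sr i) y + k0%:~R = 0].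
  by apply/seteqP; split=> y; rewrite /affine_subspace /= app_lker app_formDr app_formNr
    => h; apply/eqP; move: h; rewrite ?subr_eq0 => /eqP h; apply/eqP; lra.
split; last first.
  exists (sr i), k0; split; last exact: eM.
  by exists 1%:M, i; split; [exact: Wv1|rewrite invmx1 mulmx1].
split; first by rewrite eM; apply: panel_hyperplane.
move=> q U qU y; rewrite eM /= => yM; pose d := y - x.
have di : app_form (sr i) d = 0 by rewrite app_formDr app_formNr; lra.
have [e e0 he] := small_perturbation (u i) d.
pose V := [set 1%:M *m z | z in fundamental_face (R := R) (D := D) (finset.set1 i)].
have fV : vectorial_face V by exists 1%:M, (finset.set1 i); split; [exact: Wv1|left].
have uV : V (u i).
  exists (u i); rewrite ?mul1mx // => j.
  by rewrite finset.inE app_wall_vector; case: eqP.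
have udV : V (u i + e *: d).
  exists (u i + e *: d); rewrite ?mul1mx // => j; rewrite finset.inE.
  case: eqP => [->|/eqP ji]; first by rewrite app_ray di app_wall_vector eqxx mulr0 addr0.
  by apply: he; rewrite app_wall_vector ji.
have qU' : ray_filter x (u i + e *: d) (affine_subspace q U).
  by rewrite (ray_filter_dir g x fV udV uV).
have [t1 t10 h1] := ray_filter_ray qU; have [t2 t20 h2] := ray_filter_ray qU'.
pose t := Order.min t1 t2; have t0 : 0 < t by rewrite lt_min t10.
have tt1 : t <= t1 by rewrite ge_min lexx.
have tt2 : t <= t2 by rewrite ge_min lexx orbT.
(* Two points of the ray along [u i] put x in the affine subspace, and one point of the perturbed
   ray then puts d in its direction. *)
have := h1 t; have := h1 (t / 2); have := h2 t.
rewrite /affine_subspace /= t0 tt1 tt2 divr_gt0 // => /(_ isT) m2 + /(_ isT) m1.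
have -> : t / 2 <= t1 by rewrite ler_pdivrMr // mulr_natr mulr2n (le_trans tt1) // lerDl ltW.
move=> /(_ isT) m3.
have xq : x - q \in U.
  have -> : x - q = 2 *: (x + t / 2 *: u i - q) - (x + t *: u i - q).
    by apply/colP => j; rewrite !(mxE, mulrDl) /=; field.
  by rewrite rpredB // rpredZ.
have ed : (t * e) *: d \in U.
  have -> : (t * e) *: d = (x + t *: (u i + e *: d) - q) - (x + t *: u i - q).
    by apply/colP => j; rewrite !mxE /=; ring.
  by rewrite rpredB.
have -> : y - q = (x - q) + (t * e)^-1 *: ((t * e) *: d).
  rewrite scalerA mulVf ?scale1r ?mulf_neq0 ?gt_eqF // /d.
  by apply/colP => j; rewrite !mxE /=; ring.
by rewrite rpredD // rpredZ.
Qed.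

(** Move from x0 inside the wall along [u i]. A root not vanishing on [u i] and an integer exclude
    one parameter t, hence countably many are excluded, while an interval has positive measure. *)
Lemma generic_point i (k0 : int) x0 (N : set pt) :
  app_form (sr i) x0 + k0%:~R = 0 -> nbhs x0 N ->
  exists x, [/\ N x, app_form (sr i) x + k0%:~R = 0 &
    forall a, Delta g a -> app_form a (u i) != 0 -> forall z : int, app_form a x != z%:~R].
Proof.
move=> x0M Nx; have [e e0 he] := nbhs_ray (u i) Nx.
pose bad (p : {ffun I -> int} * int) : R :=
  (p.2%:~R - app_form (root_form R D p.1) x0) / app_form (root_form R D p.1) (u i).
have cb : countable (range bad).
  exact: (sub_countable (card_image_le _ _) (countableP _)).
have [t [t0 te tb]] : exists t, [/\ 0 < t, t <= e & ~ range bad t].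
  apply: contrapT => nex; have : lebesgue_measure (`[e / 2, e]%classic : set R) = 0%E.
    apply: countable_lebesgue_measure0; apply: sub_countable cb.
    apply: subset_card_le => t /=; rewrite in_itv /= => /andP[t0 te].
    apply: contrapT => tb; apply: nex; exists t; split=> //.
    by apply: lt_le_trans t0; rewrite divr_gt0.
  rewrite lebesgue_measure_itv /= lte_fin ltr_pdivrMr // mulr_natr mulr2n ltrDl e0.
  by rewrite -EFinD => -[]; lra.
exists (x0 + t *: u i); split.
- by apply: he; rewrite gtr0_norm.
- by rewrite app_ray app_wall_vector eqxx mulr0 addr0.
move=> a /DeltaP[m _ ->] au z; apply/eqP => ez; apply: tb; exists (m, z) => //.
by rewrite /bad /= -ez app_ray addrAC subrr add0r mulfK.
Qed.

(** A real root of height greater than 1 / e in absolute value takes an integral value within e of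
    x0 along v. An element of the Weyl group turns it into a simple root. *)
Lemma walls_dense (winf : infinite_set (Wv R D)) x0 (N : set pt) : nbhs x0 N ->
  exists (w : 'M[R]_n) i (k0 : int) y, [/\ Wv R D w, N (w *m y) &
    app_form (sr i) y + k0%:~R = 0].
Proof.
move=> Nx; have [e e0 he] := nbhs_ray v Nx.
have [a [w [i [ww aE]]] ae] := Dpos_unbounded g winf e^-1.
have [t te [z tz]] : exists2 t, `|t| <= e & exists z : int, app_form a (x0 + t *: v) = z%:~R.
  set p := app_form a x0; set q := app_form a v in ae *.
  have q0 : q != 0 by rewrite -normr_gt0 (lt_trans _ ae) // invr_gt0.
  exists (((Num.floor p)%:~R - p) / q); last first.
    by exists (Num.floor p); rewrite app_ray divfK // addrC subrK.
  rewrite normrM normfV ler_pdivrMr ?normr_gt0 //.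
  have : 1 < e * `|q| by rewrite -ltr_pdivrMl // mulr1.
  have : `|(Num.floor p)%:~R - p| <= 1.
    rewrite ler_norml; have := floor_le p; have := floorD1_gt p.
    by rewrite intrD /=; lra.
  by lra.
exists w, i, (- z), (invmx w *m (x0 + t *: v)); split=> //.
  by rewrite mulmxA mulmxV ?Wv_unit // mul1mx; apply: he.
by rewrite -app_form_mul -aE tz rmorphN /= subrr.
Qed.

End GenericPoints.

(** * Masures *)

Section Branching.
Variables (R : realType) (I : finType) (D : vectorial_datum I).
Variable g : Kac_Moody_algebra R[i] (vd_mat D).
Local Notation n := (vd_rank D).
Local Notation pt := (model R D).
Local Notation sr := (@simple_root R I D).
Local Notation ray_filter := (ray_filter g).
Local Notation v := (chamber_vector R D).
Local Notation u := (wall_vector R D).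
Implicit Types (x y : pt) (h : pt -> pt).

Lemma coroot_lattice0 : coroot_lattice (0 : pt).
Proof. by exists (fun=> 0); rewrite big1 // => i _; rewrite scale0r. Qed.

Lemma coroot_latticeD (b b' : pt) :
  coroot_lattice b -> coroot_lattice b' -> coroot_lattice (b + b').
Proof.
move=> [m ->] [m' ->]; exists (fun i => m i + m' i); rewrite -big_split.
by apply: eq_bigr => i _; rewrite intrD scalerDl.
Qed.

Lemma Wa_comp h h' : Wa R D h -> Wa R D h' -> Wa R D (h \o h').
Proof.
move=> [w [b [ww bQ ->]]] [w' [b' [ww' bQ' ->]]].
exists (w *m w'), (w *m b' + b); split; first exact: Wv_mul.
  by apply: coroot_latticeD => //; apply/coroot_lattice_Wv.
by apply/funext => y; rewrite /affine_map /= mulmxDr mulmxA addrA.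
Qed.

Lemma Wa_inv h : Wa R D h -> exists h', [/\ Wa R D h', cancel h h' & cancel h' h].
Proof.
move=> [w [b [ww bQ ->]]]; exists (affine_map (invmx w) (- (invmx w *m b))).
have wi := Wv_inv ww; have uw := Wv_unit ww; split.
- exists (invmx w), (- (invmx w *m b)); split=> //.
  by apply: coroot_latticeN; apply/coroot_lattice_Wv.
- exact: affine_mapK.
- exact: affine_mapVK.
Qed.

Lemma Wa_id : Wa R D id.
Proof.
exists 1%:M, 0; split; [exact: Wv1|exact: coroot_lattice0|].
by apply/funext => y; rewrite /affine_map mul1mx addr0.
Qed.

Lemma Wa_linear (w : 'M[R]_n) : Wv R D w -> Wa R D (fun y => w *m y).
Proof.
move=> ww; exists w, 0; split=> //; first exact: coroot_lattice0.
by apply/funext => y; rewrite /affine_map addr0.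
Qed.

Lemma Tits_cone_dominant y : (forall j, 0 <= app_form (sr j) y) -> Tits_cone y.
Proof.
move=> y0; exists 1%:M, y; split; [exact: Wv1| |by rewrite mul1mx].
move=> N Ny; have [e e0 he] := nbhs_ray v Ny.
exists (y + e *: v); split; last by apply: he; rewrite gtr0_norm.
by move=> j; rewrite app_ray app_chamber_vector mulr1 ltr_wpDl.
Qed.

Lemma fmap_eq_on (T : Type) (f f' : pt -> T) x y (K : set pt) :
  ray_filter x y K -> {in K, f =1 f'} ->
  fmap f (ray_filter x y) = fmap f' (ray_filter x y).
Proof.
move=> xK ff'; apply/seteqP; split=> E; rewrite /fmap /= => xE;
  apply: ray_filterS (ray_filterI xK xE) => z [Kz]; rewrite /= ff' //; exact/mem_set.
Qed.

Section Apartments.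
Variables (T : Type) (M : apartment_system R D T).
Hypotheses (ma1 : MA1 M) (ma2 : MA2 g M setT).
Implicit Types (A : set T) (f : pt -> T).

Lemma Isomw_bij A f : apartment M A -> Isomw M A f -> set_bij setT A f.
Proof.
move=> aA; have [f0 bf0 IE] := ma1 aA; rewrite IE => -[h Wh <-].
have [h' [_ hK h'K]] := Wa_inv Wh; have [/= fA fi fs] := bf0; split.
- by move=> y _; apply: fA.
- by move=> y z _ _ /fi -/(_ (mem_set Logic.I) (mem_set Logic.I)) /(can_inj hK).
- by move=> t /fs[y _ <-]; exists (h' y); rewrite //= h'K.
Qed.

Lemma Isomw_comp A f h : apartment M A -> Isomw M A f -> Wa R D h ->
  Isomw M A (f \o h).
Proof.
move=> aA; have [f0 bf0 IE] := ma1 aA; rewrite IE => -[h' Wh' <-] Wh.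
by exists (h' \o h); [exact: Wa_comp|].
Qed.

Lemma Isomw_trans A f f' : apartment M A -> Isomw M A f -> Isomw M A f' ->
  exists2 h, Wa R D h & f' = f \o h.
Proof.
move=> aA; have [f0 bf0 IE] := ma1 aA; rewrite IE => -[h Wh <-] [h1 Wh1 <-].
have [h' [Wh' hK h'K]] := Wa_inv Wh; exists (h' \o h1); first exact: Wa_comp.
by apply/funext => y; rewrite /= h'K.
Qed.

Lemma Isomw_inj A f : apartment M A -> Isomw M A f -> injective f.
Proof.
move=> aA fA; have [_ fi _] := Isomw_bij aA fA.
by move=> y z e; apply: fi => //; exact: mem_set.
Qed.

(** As y is dominant, the germ at x of the segment is preordered and (MA2) applies; in charts the
    isomorphism becomes an element h of [Wa]. The charts then agree on a whole enclosed set, not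
    just along the segment. *)
Lemma germ_coincidence A A1 f f1 x y (e : R) :
  apartment M A -> apartment M A1 -> Isomw M A f -> Isomw M A1 f1 ->
  y != 0 -> (forall j, 0 <= app_form (sr j) y) -> 0 < e ->
  (forall t, 0 <= t <= e -> A1 (f (x + t *: y))) ->
  exists h k (e' : R), [/\ Wa R D h, 0 < e',
    forall t, 0 <= t <= e' -> enclosed_set g k (x + t *: y) &
    {in enclosed_set g k, f =1 f1 \o h}].
Proof.
move=> aA aA1 fA fA1 y0 yC e0 hA.
pose x' : pt := x + e *: y; pose F0 := within (segment x x') (nbhs x).
have xx' : x' - x = e *: y by rewrite /x' addrC addKr.
have preF : filter_in M A (MA2_filter g) (fmap f F0).
  exists f, F0; split=> //; constructor 2; exists x, x'; split=> //.
    move=> /esym/eqP; rewrite -subr_eq0 xx' scaler_eq0 (negbTE y0) orbF.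
    by rewrite gt_eqF.
  left; rewrite /Tits_le xx'; apply: Tits_cone_dominant => j.
  by rewrite app_formZr mulr_ge0 // ltW.
have FA1 : fmap f F0 A1.
  rewrite /fmap /F0 /within /=; apply: (@filterS _ _ (nbhs_filter x) setT); last exact: filterT.
  move=> z _ [t /=]; rewrite in_itv /= => /andP[t0 t1] <-.
  rewrite xx' scalerA; apply: hA; rewrite mulr_ge0 ?(ltW e0) //=.
  by rewrite ger_pMl.
have [_ [phi [_ [bphi hphi] [E [f2 fA2 [k kF kE]] phiE]]]] := ma2 aA aA1 preF FA1.
have [h2 Wh2 f2E] := Isomw_trans aA fA fA2.
have [h2' [Wh2' h2K h2'K]] := Wa_inv Wh2.
have [h Wh phif] := hphi f f1 fA fA1.
have [w [b [ww bQ h2'E]]] := Wh2'.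
(* The enclosure is expressed in some chart f2 of A, so its bounds are carried back to f. *)
have kK : h2' @^-1` enclosed_set g k = enclosed_set g (shift w b k).
  by rewrite h2'E !enclosed_setE preimage_half_open.
have := kF; rewrite /fmap /F0 /within /= => kF'.
have [e1 e10 he1] := nbhs_ray y kF'.
exists h, (shift w b k), (Order.min e e1); split=> //.
- by rewrite lt_min e0.
- move=> t /andP[t0]; rewrite le_min => /andP[te te1]; rewrite -kK /=.
  have nt : `|t| <= e1 by rewrite ger0_norm.
  have [|z Kz ez] := he1 t nt.
    exists (t / e); first by rewrite /= in_itv /= divr_ge0 ?(ltW e0) //= ler_pdivrMr // mul1r.
    by rewrite xx' scalerA divfK // gt_eqF.
  move: ez; rewrite f2E => /(Isomw_inj aA fA) <-.
  by rewrite h2K.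
move=> z /set_mem; rewrite -kK /= => /kE /=; rewrite f2E /= h2'K => Ez.
by rewrite -phif phiE.
Qed.

Section OpenSubset.
Variables (A : set T) (f : pt -> T) (U : set T).
Hypotheses (aA : apartment M A) (fA : Isomw M A f) (UA : U `<=` A).
Hypothesis openU : forall A1 f1, apartment M A1 -> Isomw M A1 f1 -> open (f1 @^-1` U).
Hypothesis Dinf : infinite_set (Dpos g).
Variables (i : I) (k0 : int) (x : pt).
Hypotheses (xM : app_form (sr i) x + k0%:~R = 0) (Ux : U (f x)).
Hypothesis gen : forall a, Delta g a -> app_form a (u i) != 0 ->
  forall z : int, app_form a x != z%:~R.
Local Notation P0 := (ray_filter x (u i)).
Local Notation Cp := (ray_filter x v).
Local Notation s := (@panel_reflection R I D i k0).

(** The enclosed set on which f1 = f o h belongs to the filter of the chamber and, being closed, to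
    that of the panel. There f and f1 agree, so h fixes the panel, and h Cp still weakly dominates
    it; [dominating_chamber] applies inside A. *)
Lemma chamber_in_apartment A1 f1 K : apartment M A1 -> Isomw M A1 f1 ->
  P0 K -> {in K, f =1 f1} ->
  fmap f1 Cp = fmap f Cp \/ fmap f1 Cp = fmap f (fmap s Cp).
Proof.
move=> aA1 fA1 PK fK.
have Kx : K x := panel_member_base gen PK.
have Ox : nbhs x (f1 @^-1` U).
  by apply: open_nbhs_nbhs; split; [exact: openU aA1 fA1|rewrite /= -(fK _ (mem_set Kx))].
have [e e0 he] := nbhs_ray v Ox.
have vn0 : v != 0.
  apply/eqP => v0; have := app_chamber_vector R D i.
  by rewrite v0 /app_form mulmx0 mxE => /eqP; rewrite eq_sym oner_eq0.
have [|t /andP[t0 te]|h [k [e' [Wh e0' kx hk]]]] :=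
  @germ_coincidence A1 A f1 f x v e aA1 aA fA1 fA vn0 _ e0.
- by move=> j; rewrite app_chamber_vector.
- by apply: UA; apply: he; rewrite ger0_norm.
have kC : Cp (enclosed_set g k).
  rewrite enclosed_setE; apply/ray_filter_half_open; exists e' => // t /andP[t0 te].
  by rewrite -enclosed_setE; apply: kx; rewrite (ltW t0).
have kP : P0 (enclosed_set g k).
  move: kC; rewrite enclosed_setE => /(@chamber_dominates _ _ _ g i x).
  by apply: ray_filterS => y [].
have -> : fmap f1 Cp = fmap f (fmap h Cp) by rewrite (fmap_eq_on kC hk).
have hP : fmap h P0 = P0.
  rewrite -[RHS](_ : fmap id P0 = P0) //; apply/esym.
  apply: (fmap_eq_on (ray_filterI PK kP)) => y /set_mem[Ky ky].
  apply: (Isomw_inj aA fA); rewrite fK ?hk //; exact/mem_set.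
have [w [b [ww bQ hE]]] := Wh.
have hC : fmap h Cp = ray_filter (h x) (w *m v) by rewrite hE image_ray_filter.
have [|||CE|CE] := @dominating_chamber _ _ _ g i k0 x xM Dinf (h x) (w *m v).
- by apply: face_dir_Wv => //; apply/chamber_dir/chamber_vectorC.
- rewrite -hC -hP hE; apply: weakly_dominates_image => //.
  exact: chamber_dominates.
- rewrite -hC hE; apply: in_no_hyperplane_image; first exact: Wv_unit.
  exact: chamber_in_no_hyperplane.
- by rewrite hC CE; left.
- by rewrite hC CE; right.
Qed.

Lemma chambers_at_panel C : in_closure g M (fmap f P0) C ->
  C = fmap f Cp \/ C = fmap f (fmap s Cp).
Proof.
move=> [A1 [f1 [P1 [C1 [aA1 fA1 [panP1 chC1] dom [PE ->]]]]]].
have [b1 _ _] := Isomw_bij aA1 fA1.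
have P1T : P1 setT.
  have [/is_faceP[y [z [_ ->]]] _] := panP1.
  exists (fun=> None, fun=> None) => //.
  by exists 1 => // t _ a Da.
have PA1 : P0 (f @^-1` A1).
  have : fmap f P0 A1.
    by rewrite PE /fmap /=; have -> : f1 @^-1` A1 = setT by apply/seteqP; split=> // y _; apply: b1.
  by [].
have A1x := panel_member_base gen PA1.
have [e e0 he] := ray_filter_ray PA1.
(* If i were the only index, [u i] would be zero and give no segment; but then alpha_i would be the
   only positive root. *)
have [j0 j0i] : exists j, j != i.
  apply: contrapT => nex; apply: Dinf.
  apply: (@sub_finite_set _ _ [set sr i]); last exact: finite_set1.
  move=> _ [m [rm mp ->]].
  have mz j : j != i -> m j = 0 by move=> ji; case: nex; exists j.
  have [->|mi] := root_rank1 (@complex_int_eq0 R) rm mz; first by rewrite /= root_form_deg.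
  by move: mp; rewrite mi (negbTE (deg_posN (deg_pos_deg i))).
have un0 : u i != 0.
  apply/eqP => ui0; have := app_wall_vector R D i j0.
  by rewrite ui0 /app_form mulmx0 mxE j0i => /eqP; rewrite eq_sym oner_eq0.
have [|t /andP[t0 te]|h [k [e' [Wh e0' kx hk]]]] :=
  @germ_coincidence A A1 f f1 x (u i) e aA aA1 fA fA1 un0 _ e0.
- by move=> j; rewrite app_wall_vector ler0n.
- have [->|t0'] := eqVneq t 0; first by rewrite scale0r addr0.
  by apply: he; rewrite lt0r t0' t0.
pose f2 := f1 \o h; have fA2 : Isomw M A1 f2 by apply: Isomw_comp.
have [h' [Wh' hK h'K]] := Wa_inv Wh.
have kP : P0 (enclosed_set g k).
  rewrite enclosed_setE; apply/ray_filter_half_open; exists e' => // t /andP[t0 te].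
  by rewrite -enclosed_setE; apply: kx; rewrite (ltW t0).
(* P0 and P1 are the same filter of the masure, read in the charts f2 and f1. *)
have P01 : fmap h' P1 = P0.
  apply/seteqP; split=> E; rewrite /fmap /= => HE.
    have : fmap f P0 (f2 @` E).
      rewrite PE /fmap /=; suff -> : f1 @^-1` (f2 @` E) = h' @^-1` E by [].
      apply/seteqP; split=> y /=.
        by move=> [z Ez] /(Isomw_inj aA1 fA1) <-; rewrite hK.
      by move=> Ey; exists (h' y); rewrite // /f2 /= h'K.
    rewrite (fmap_eq_on kP hk) /fmap /=; apply: ray_filterS => y [z Ez].
    by move=> /(Isomw_inj aA1 fA2) <-.
  have : fmap f P0 (f2 @` E).
    rewrite (fmap_eq_on kP hk) /fmap /=; apply: ray_filterS HE => y Ey.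
    by exists y.
  rewrite PE /fmap /=; suff -> : f1 @^-1` (f2 @` E) = h' @^-1` E by [].
  apply/seteqP; split=> y /=.
    by move=> [z Ez] /(Isomw_inj aA1 fA1) <-; rewrite hK.
  by move=> Ey; exists (h' y); rewrite // /f2 /= h'K.
have -> : fmap f1 C1 = fmap f2 (fmap h' C1).
  apply/funext => E; rewrite /fmap /=; congr C1; apply/seteqP; split=> y /=;
  by rewrite /f2 /= h'K.
have noC1 := is_chamber_in_no_hyperplane chC1.
have [[x2 [v2 [dir2 C1E]]] _] : (exists x2 v2, face_dir v2 /\ C1 = ray_filter x2 v2) /\ True.
  by split=> //; apply/is_faceP; case: chC1.
have domC1 : weakly_dominates g P1 C1.
  move=> k' Ck'; apply: dom; exists (half_open_enclosed_set g k') => //.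
  exact: closure_half_open.
have [w [b [ww bQ h'E]]] := Wh'.
have hC1 : fmap h' C1 = ray_filter (h' x2) (w *m v2) by rewrite C1E h'E image_ray_filter.
have key := @dominating_chamber _ _ _ g i k0 x xM Dinf (h' x2) (w *m v2).
have {key}[|||CE|CE] := key.
- exact: face_dir_Wv.
- by rewrite -hC1 -P01 h'E; apply: weakly_dominates_image.
- by rewrite -hC1 h'E; apply: in_no_hyperplane_image => //; apply: Wv_unit.
- by rewrite hC1 CE; exact: (chamber_in_apartment aA1 fA2 kP hk).
(* In the reflected case the chart f2 o s is used: it still agrees with f on the panel, since s
   fixes the wall pointwise. *)
rewrite hC1 CE.
have -> : fmap f2 (fmap s Cp) = fmap (f2 \o s) Cp by [].
apply: (@chamber_in_apartment A1 (f2 \o s) _ aA1 _ (ray_filterI kP (panel_hyperplane g xM))).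
  by apply: Isomw_comp => //; apply: panel_reflection_Wa.
move=> y /set_mem[ky yM]; rewrite /= panel_reflection_fix //.
by apply: hk; apply: mem_set.
Qed.

End OpenSubset.
End Apartments.
End Branching.

Lemma card_pair_le2 (T : Type) (S : set T) (a b : T) (k : nat) :
  S `<=` [set a; b] -> (S #= `I_k)%card -> (k <= 2)%N.
Proof.
move=> Sab; rewrite card_eq_le => /andP[_ kS]; rewrite -card_le_II.
apply: (card_le_trans kS); apply: (card_le_trans (subset_card_le Sab)).
have -> : [set a; b] = (fun j : nat => if j == 0%N then a else b) @` `I_2.
  apply/seteqP; split=> [t [->|->]|t [j _ <-]]; [by exists 0%N|by exists 1%N|].
  by case: eqP => _; [left|right].
exact: card_image_le.
Qed.

Lemma apartment_no_interior_point (R : realType) (I : finType) (D : vectorial_datum I)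
    (g : Kac_Moody_algebra R[i] (vd_mat D))
    (T : topologicalType) (M : apartment_system R D T) (A U : set T) (t : T) :
  MA1 M -> MA2 g M setT -> thick g M -> infinite_set (Wv R D) ->
  induces_affine_topology M -> apartment M A -> open U -> U `<=` A -> U t -> False.
Proof.
move=> ma1 ma2 thickM winf top aA oU UA Ut.
have [f fA] : exists f, Isomw M A f.
  by have [f bf IE] := ma1 A aA; exists f; rewrite IE; exists id => //; apply: Wa_id.
have [_ _ /(_ t (UA t Ut))[x1 _ x1t]] := Isomw_bij ma1 aA fA.
have openU A1 f1 : apartment M A1 -> Isomw M A1 f1 -> open (f1 @^-1` U).
  by move=> aA1 fA1; apply/(top A1 f1 aA1 fA1); exists U.
have nU : nbhs x1 (f @^-1` U).
  by apply: open_nbhs_nbhs; split; [exact: openU aA fA|rewrite /= x1t].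
have [w [i [k0 [x0 [ww Ux0 x0M]]]]] := walls_dense g winf nU.
(* Changing the chart by w turns the wall met by U into one directed by a simple root. *)
pose f' := f \o (fun y => w *m y).
have fA' : Isomw M A f' by apply: Isomw_comp => //; apply: Wa_linear.
have nU' : nbhs x0 (f' @^-1` U).
  by apply: open_nbhs_nbhs; split; first exact: openU aA fA'.
have [x [Ux xM gen]] := generic_point g x0M nU'.
have panP : filter_somewhere M (is_panel g) (fmap f' (ray_filter g x (wall_vector R D i))).
  exists A => //; exists f', (ray_filter g x (wall_vector R D i)); split=> //.
  exact: panel_is_panel xM.
have [k k2 card] := thickM _ panP.
have Dinf : infinite_set (Dpos g) by apply: Dpos_infinite.
suff : (k <= 2)%N by rewrite leqNgt k2.
pose Cp := ray_filter g x (chamber_vector R D).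
apply: (@card_pair_le2 _ _ (fmap f' Cp)
  (fmap f' (fmap (@panel_reflection R I D i k0) Cp)) _ _ card) => C.
exact: (chambers_at_panel ma1 ma2 aA fA' UA openU Dinf xM Ux gen).
Qed.

(* The distance d is the distance of the metric space T. *)
Theorem proposition14 (R : realType) (I : finType) (D : vectorial_datum I)
  (g : Kac_Moody_algebra R[i] (vd_mat D))
  (T : metricType R) (M : apartment_system R D T)
  (masureM : is_masure g M) (thickM : thick g M)
  (G : groupType) (act : G -> T -> T)
  (transM : strongly_transitive g M act)
  (f0 : model R D -> T) (f0P : standard_apartment M act f0)
  (not_building : ~ is_building M)
  (affineM : induces_affine_topology M) (A : set T) :
  apartment M A -> A° = set0.
Proof.
move=> aA; rewrite -subset0 => t /= At.
apply: (@apartment_no_interior_point R I D g T M A A° t) => //.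
- exact: masure_MA1 masureM.
- exact: masure_MA2 masureM.
- exact: open_interior.
- exact: interior_subset.
Qed.
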